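(* (a) Let $k\in\mathbb{N}$ and let $\mathcal{L}$ be a topological link $mS^1\to S^3$ (or a topological string link). Then the strong $k$-quasi-isotopy classes of all sufficiently ($C^0$-)close PL approximations to $\mathcal{L}$ by PL links (respectively, by PL string links) coincide. (b) TOP isotopic PL links (or TOP isotopic PL string links) are strongly $k$-quasi-isotopic for all $k\in\mathbb{N}$.
   Context: $\mathbb{N}$ contains $0$; $mS^1=S^1_1\sqcup\dots\sqcup S^1_m$. A topological (PL) link is a topological (PL) embedding $mS^1\to S^3$. A topological (PL) string link is a topological (PL) embedding $L\colon(I_1\sqcup\dots\sqcup I_m,\partial)\to(I\times\mathbb{R}^2,\partial)$ of $m$ copies of $I=[0,1]$, with prescribed endpoints: $i\in I_j$ is sent to $(i,p_j)$ for $i=0,1$, where $p_1,\dots,p_m\in\mathbb{R}^2$ are fixed distinct points (for $m=2$: $p$ and $-p$ with $p\ne0$). Homotopies of string links fix the endpoints. A TOP isotopy is a homotopy through one-to-one continuous maps. A PL homotopy is generic if it passes through embeddings at all but finitely many times, and at each exceptional time the map (a singular link of the homotopy) has exactly one double point, which is transversal in the usual general position sense. A PL map $f\colon mS^1\to S^3$ with precisely one double point $x$ is a strong $k$-quasi-embedding if, in addition to $P_0=\{x\}$, there exist PL $3$-balls $P_1,\dots,P_k\subset S^3$ and arcs $J_0,\dots,J_k\subset mS^1$ with $\partial J_0=f^{-1}(x)$ such that $f^{-1}(P_j)\subset J_j$ for each $j\le k$, and $P_j\cup f(J_j)\subset P_{j+1}$ for each $j<k$, the latter inclusion being null-homotopic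 for each $j<k$ (automatic for balls). For singular string links the definition is the same with $mS^1$ and $S^3$ replaced by $I_1\sqcup\dots\sqcup I_m$ and $I\times\mathbb{R}^2$. Two PL links (string links) are strongly $k$-quasi-isotopic if they can be joined by a generic PL homotopy all of whose singular links are strong $k$-quasi-embeddings. *)

(* Defs.v *)
From mathcomp Require Import all_boot all_order all_algebra.
From mathcomp Require Import all_classical all_reals all_analysis.

Set Implicit Arguments.
Unset Strict Implicit.
Unset Printing Implicit Defensive.

Import Order.TTheory GRing.Theory Num.Theory.
Import numFieldNormedType.Exports.

Local Open Scope classical_set_scope.
Local Open Scope ring_scope.

(** * Piecewise linear maps between compact polyhedra

    All spaces are subsets of Euclidean spaces ['rV[R]_n], and a map from a
    subset [D] is a total function of which only the values on [D] matter. *)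

Definition hull (R : realType) (n : nat) (s : seq 'rV[R]_n) : set 'rV[R]_n :=
  [set x | exists w : 'I_(size s) -> R,
     [/\ forall i, 0 <= w i, \sum_i w i = 1 & x = \sum_i w i *: s`_i]].

(** [D] is a compact polyhedron, i.e. a finite union of convex polytopes, and
    for a suitable choice of these polytopes [f] is affine on each of them.
    Polytopes are closed, so that [f] is automatically continuous on [D]. *)
Definition pl (R : realType) (n q : nat) (D : set 'rV[R]_n)
    (f : 'rV[R]_n -> 'rV[R]_q) : Prop :=
  exists2 F : seq (seq 'rV[R]_n),
    D = \bigcup_(s in [set` F]) hull s &
    forall s, s \in F -> exists (M : 'M[R]_(n, q)) (b : 'rV[R]_q),
      forall x, hull s x -> f x = x *m M + b.

(** A homeomorphism of [D] onto its image, which lies in [Y]. *)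
Definition embedding (R : realType) (n q : nat) (D : set 'rV[R]_n)
    (Y : set 'rV[R]_q) (f : 'rV[R]_n -> 'rV[R]_q) : Prop :=
  [/\ f @` D `<=` Y, {within D, continuous f} &
      exists2 g : 'rV[R]_q -> 'rV[R]_n,
        forall x, D x -> g (f x) = x & {within f @` D, continuous g}].

Definition pl_embedding (R : realType) (n q : nat) (D : set 'rV[R]_n)
    (Y : set 'rV[R]_q) (f : 'rV[R]_n -> 'rV[R]_q) : Prop :=
  pl D f /\ embedding D Y f.

(** The norm on ['rV[R]_n] is the sup norm: the unit ball and the unit sphere
    are a cube and its boundary, i.e. the standard PL ball and PL sphere. *)
Definition unit_ball (R : realType) (n : nat) : set 'rV[R]_n :=
  [set x | `|x| <= 1].

Definition unit_sphere (R : realType) (n : nat) : set 'rV[R]_n :=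
  [set x | `|x| = 1].

Definition unit_interval (R : realType) : set 'rV[R]_1 :=
  [set s | 0 <= s 0 0 <= 1].

Definition pl_ball (R : realType) (n q : nat) (Y B : set 'rV[R]_q) : Prop :=
  exists2 g : 'rV[R]_n -> 'rV[R]_q,
    pl_embedding (@unit_ball R n) Y g & g @` (@unit_ball R n) = B.

Definition pl_arc (R : realType) (n : nat) (D J : set 'rV[R]_n)
    (a b : 'rV[R]_n) : Prop :=
  exists g : 'rV[R]_1 -> 'rV[R]_n,
    [/\ pl_embedding (@unit_interval R) D g, g @` (@unit_interval R) = J,
        g 0 = a & g 1%:M = b].

(** * Homotopies *)

Definition cylinder (R : realType) (n : nat) (D : set 'rV[R]_n) :
    set 'rV[R]_(n + 1) :=
  [set z | D (lsubmx z) /\ 0 <= rsubmx z 0 0 <= 1].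

Definition on_cylinder (R : realType) (n q : nat)
    (H : R -> 'rV[R]_n -> 'rV[R]_q) : 'rV[R]_(n + 1) -> 'rV[R]_q :=
  fun z => H (rsubmx z 0 0) (lsubmx z).

Definition homotopy (R : realType) (n q : nat) (D : set 'rV[R]_n)
    (Y : set 'rV[R]_q) (H : R -> 'rV[R]_n -> 'rV[R]_q) : Prop :=
  {within cylinder D, continuous (on_cylinder H)} /\
  (forall t : R, 0 <= t <= 1 -> H t @` D `<=` Y).

Definition joins (R : realType) (n q : nat) (D : set 'rV[R]_n)
    (H : R -> 'rV[R]_n -> 'rV[R]_q) (f0 f1 : 'rV[R]_n -> 'rV[R]_q) : Prop :=
  forall x, D x -> H 0 x = f0 x /\ H 1 x = f1 x.

Definition null_homotopic_inclusion (R : realType) (q : nat)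
    (A B : set 'rV[R]_q) : Prop :=
  A `<=` B /\
  exists (H : R -> 'rV[R]_q -> 'rV[R]_q) (c : 'rV[R]_q),
    [/\ B c, homotopy A B H & joins A H id (fun=> c)].

(** * Links and string links *)

(** [X_1 + ... + X_m], realised as the union of the slices [{j} * X]. *)
Definition copies (R : realType) (d m : nat) (X : set 'rV[R]_d) :
    set 'rV[R]_(1 + d) :=
  [set row_mx (j%:R%:M : 'rV[R]_1) x | j in [set: 'I_m] & x in X].

(** Links and string links are treated uniformly: they are embeddings
    [source -> target] with prescribed values, namely [f x = y] for every pair
    [(x, y)] in [prescribed]. *)
Record setting (R : realType) (n q : nat) := Setting {
  source : set 'rV[R]_n;
  target : set 'rV[R]_q;
  prescribed : set ('rV[R]_n * 'rV[R]_q) }.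

Definition links (R : realType) (m : nat) : setting R (1 + 2) 4 :=
  Setting (copies m (@unit_sphere R 2)) (@unit_sphere R 4) set0.

(** In [I * R^2] the factor [I] is the first coordinate; the booleans [i]
    stand for the two endpoints 0 and 1 of [I]. *)
Definition string_links (R : realType) (m : nat) (p : 'I_m -> 'rV[R]_2) :
    setting R (1 + 1) (1 + 2) :=
  Setting (copies m (@unit_interval R))
    [set y | @unit_interval R (lsubmx y)]
    [set z | exists (j : 'I_m) (i : bool),
       z = (row_mx (j%:R%:M : 'rV[R]_1) (i%:R%:M : 'rV[R]_1),
            row_mx (i%:R%:M : 'rV[R]_1) (p j))].

Definition respects_prescribed (R : realType) (n q : nat) (A : setting R n q)
    (f : 'rV[R]_n -> 'rV[R]_q) : Prop :=
  forall z, prescribed A z -> f z.1 = z.2.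

Definition top_link (R : realType) (n q : nat) (A : setting R n q)
    (L : 'rV[R]_n -> 'rV[R]_q) : Prop :=
  embedding (source A) (target A) L /\ respects_prescribed A L.

Definition pl_link (R : realType) (n q : nat) (A : setting R n q)
    (L : 'rV[R]_n -> 'rV[R]_q) : Prop :=
  pl_embedding (source A) (target A) L /\ respects_prescribed A L.

Definition c0_close (R : realType) (n q : nat) (A : setting R n q) (e : R)
    (f g : 'rV[R]_n -> 'rV[R]_q) : Prop :=
  forall x, source A x -> `|f x - g x| < e.

Definition top_isotopic (R : realType) (n q : nat) (A : setting R n q)
    (L0 L1 : 'rV[R]_n -> 'rV[R]_q) : Prop :=
  exists H : R -> 'rV[R]_n -> 'rV[R]_q,
    [/\ homotopy (source A) (target A) H,
        forall t : R, 0 <= t <= 1 ->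
          set_inj (source A) (H t) /\ respects_prescribed A (H t) &
        joins (source A) H L0 L1].

(** * Generic PL homotopies *)

(** [x] is the only multiple point of [f] on [D], and its preimage is
    [{u, v}]. *)
Definition only_double_point (R : realType) (n q : nat) (D : set 'rV[R]_n)
    (f : 'rV[R]_n -> 'rV[R]_q) (x : 'rV[R]_q) (u v : 'rV[R]_n) : Prop :=
  [/\ D u /\ D v, u <> v, f u = x /\ f v = x &
      forall u' v', D u' -> D v' -> u' <> v' -> f u' = f v' ->
        [set u'; v'] = [set u; v]].

(** A PL coordinate system around [x], sending the origin to [x]. For a
    [d]-manifold [Y] the image of the cube is a neighbourhood of [x] by
    invariance of domain; in particular [x] is not on the boundary. *)
Definition pl_chart (R : realType) (d q : nat) (Y : set 'rV[R]_q)
    (x : 'rV[R]_q) (g : 'rV[R]_d -> 'rV[R]_q) : Prop :=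
  pl_embedding (@unit_ball R d) Y g /\ g 0 = x.

(** General position at the double point [x = H t0 u = H t0 v]. In suitable PL
    coordinates around [u], [v] (in the 1-manifold [D]) and [x] (in the
    3-manifold [Y]) the two branches of the homotopy are affine near [(u, t0)]
    and [(v, t0)], and their tracks [(s, t) |-> (H t s, t)], which are then
    planes in R^3 x R spanned by [(a_i, 0)] and [(b_i, 1)], are
    complementary. *)
Definition transversal_double_point (R : realType) (n q : nat)
    (D : set 'rV[R]_n) (Y : set 'rV[R]_q) (H : R -> 'rV[R]_n -> 'rV[R]_q)
    (t0 : R) (x : 'rV[R]_q) (u v : 'rV[R]_n) : Prop :=
  exists (phi1 phi2 : 'rV[R]_1 -> 'rV[R]_n) (psi : 'rV[R]_3 -> 'rV[R]_q)
         (a1 b1 a2 b2 : 'rV[R]_3),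
    [/\ pl_chart D u phi1 /\ pl_chart D v phi2,
        pl_chart Y x psi,
        \forall s \near (0 : 'rV[R]_1) & t \near t0,
          H t (phi1 s) = psi (s *m a1 + (t - t0) *: b1) /\
          H t (phi2 s) = psi (s *m a2 + (t - t0) *: b2) &
        row_free (col_mx (block_mx a1 0 b1 (1%:M : 'M[R]_1))
                         (block_mx a2 0 b2 (1%:M : 'M[R]_1)))].

(** [E] lists the exceptional times; they are interior, as the homotopy is
    meant to join two embeddings. *)
Definition generic_pl_homotopy (R : realType) (n q : nat) (A : setting R n q)
    (H : R -> 'rV[R]_n -> 'rV[R]_q) (E : seq R) : Prop :=
  [/\ pl (cylinder (source A)) (on_cylinder H) /\
        homotopy (source A) (target A) H,
      forall t : R, 0 <= t <= 1 -> respects_prescribed A (H t),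
      forall t : R, t \in E -> 0 < t < 1,
      forall t : R, 0 <= t <= 1 -> t \notin E ->
        embedding (source A) (target A) (H t) &
      forall t : R, t \in E -> exists x u v,
        only_double_point (source A) (H t) x u v /\
        transversal_double_point (source A) (target A) H t x u v].

(** * Strong quasi-isotopy *)

Definition strong_quasi_embedding (R : realType) (n q : nat)
    (A : setting R n q) (k : nat) (f : 'rV[R]_n -> 'rV[R]_q) : Prop :=
  [/\ pl (source A) f, f @` source A `<=` target A &
      exists (x : 'rV[R]_q) (u v : 'rV[R]_n)
             (P : nat -> set 'rV[R]_q) (J : nat -> set 'rV[R]_n),
        [/\ only_double_point (source A) f x u v,
            P 0%N = [set x] /\
              (forall j, (1 <= j <= k)%N -> pl_ball 3 (target A) (P j)),
            pl_arc (source A) (J 0%N) u v /\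
              (forall j, (j <= k)%N -> exists a b, pl_arc (source A) (J j) a b),
            forall j, (j <= k)%N -> source A `&` f @^-1` P j `<=` J j &
            forall j, (j < k)%N ->
              null_homotopic_inclusion (P j `|` f @` J j) (P j.+1)]].

Definition strongly_quasi_isotopic (R : realType) (n q : nat)
    (A : setting R n q) (k : nat) (L0 L1 : 'rV[R]_n -> 'rV[R]_q) : Prop :=
  exists (H : R -> 'rV[R]_n -> 'rV[R]_q) (E : seq R),
    [/\ generic_pl_homotopy A H E, joins (source A) H L0 L1 &
        forall t, t \in E -> strong_quasi_embedding A k (H t)].

(* Main.v *)
Require Import Defs.
From mathcomp Require Import all_boot all_order all_algebra.
From mathcomp Require Import all_classical all_reals all_analysis.
From mathcomp Require Import ring lra.

Set Implicit Arguments.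
Unset Strict Implicit.
Unset Printing Implicit Defensive.

Import Order.TTheory GRing.Theory Num.Theory.
Import numFieldNormedType.Exports.

Local Open Scope classical_set_scope.
Local Open Scope ring_scope.

(** Two PL links close to [L] are related by moving the vertices of a common
    subdivision, one after the other, to the same generic positions. While a
    vertex [v] moves along a segment, only the edges at [v] move, each after a
    delay of its own, so that they cross the other edges transversally and at
    distinct times. All intermediate maps [f] are close to [L]. Since [L] is an
    embedding, the preimage under [f] of a small cube lies in a small arc, and
    the image of this arc in a slightly bigger cube; iterating this [k] times
    from a double point, one gets the balls and arcs of a strong
    [k]-quasi-embedding. This is (a) for maps into a cube. In general the image
    of [L] lies in the interior of a PL cube: for the sphere because [L] misses
    a point, for I * R^2 because [L] is bounded. For (b), every stage of a TOP
    isotopy has by (a) a neighbourhood whose PL links, which exist, are all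
    equivalent, and [0, 1] is connected. *)

(** * Uniform continuity and the sup norm *)

(** The obstacle in (b) is that a stage of a TOP isotopy is only a topological embedding, so that PL
    links near it have to be produced. The vertex moves that prove (a) also do this: the vertices of
    a PL link already nearby are moved towards the given embedding, and every single move ends with
    an embedding. Hence (b) starts from [L0] itself and never leaves its class. A move depends on
    two independent choices. The new position of the vertex fixes where edges cross, as the
    triangles swept out do not depend on the delays; general position makes the crossings finite in
    number, interior to the edges and transversal. The delays only fix when they happen. The map
    must be PL in space and time jointly; this is why points move at unit speed and stop after their
    share of the way: a speed proportional to that share would give a bilinear map. The cube is
    there because segments between points of the target must stay in the target. In the sup norm its
    intersections with small cubes are boxes, thus convex PL balls. *)

Lemma withinP (R : realType) (V W : normedModType R) (D : set V) (f : V -> W) :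
  {within D, continuous f} <->
  forall x, D x -> forall e : R, 0 < e ->
    exists2 d, 0 < d & forall y, D y -> `|x - y| < d -> `|f x - f y| < e.
Proof.
rewrite subspace_continuousP; split=> [cf x Dx e e0|cf x Dx].
  have /cvgrPdist_lt/(_ e e0) := cf x Dx.
  rewrite /within/= => /nbhs_normP[d /= d0 Hd].
  by exists d => // y Dy xy; exact: (Hd y).
apply/cvgrPdist_lt => e e0; have [d d0 Hd] := cf x Dx e e0.
by rewrite near_withinE; apply/nbhs_normP; exists d => //= y xy Dy; exact: Hd.
Qed.

(** Only one of the two points has to lie in the compact set. With the image of [L] as [D] and the
    whole space as [D'] this controls the inverse of a chart at the points of PL links near [L],
    which leave that image. *)
Lemma compact_unif_continuous_at (R : realType) (V W : normedModType R)
    (D D' : set V) (f : V -> W) :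
  compact D -> D `<=` D' -> {within D', continuous f} -> forall e : R, 0 < e ->
  exists2 d, 0 < d & forall x y, D x -> D' y -> `|x - y| < d ->
    `|f x - f y| < e.
Proof.
move=> cD DD' /withinP cf e e0.
have /near_covering_withinP covD := (compact_near_coveringP D).1 cD.
pose P (d : R) x := forall y, D' y -> `|x - y| < d -> `|f x - f y| < e.
have H x : D x -> \forall x' \near x & d \near (0 : R)^'+, D x' -> P d x'.
  move=> Dx; have [d d0 Hd] := cf x (DD' x Dx) _ (divr_gt0 e0 (ltr0Sn _ 1)).
  exists (ball x (d / 2), [set r | r < d / 2]) => /=.
    split; first by apply: nbhsx_ballx; rewrite divr_gt0.
    by apply: nbhs_right_lt; rewrite divr_gt0.
  move=> [x' r] /= [xx' rd] Dx' y Dy x'y.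
  rewrite -ball_normE /= in xx'.
  have h1 : `|f x - f x'| < e / 2 by apply: Hd; [exact: DD'|lra].
  have h2 : `|f x - f y| < e / 2.
    by apply: Hd => //; have := ler_distD x' x y; lra.
  have := ler_distD (f x) (f x') (f y); rewrite (distrC (f x') (f x)); lra.
have [d [d0 Hd]] := filter_ex (filterI (nbhs_right_gt (0 : R)) (covD R _ P _ H)).
by exists d => // x y Dx Dy xy; exact: (Hd x).
Qed.

Lemma compact_unif_continuous (R : realType) (V W : normedModType R)
    (D : set V) (f : V -> W) :
  compact D -> {within D, continuous f} -> forall e : R, 0 < e ->
  exists2 d, 0 < d & forall x y, D x -> D y -> `|x - y| < d ->
    `|f x - f y| < e.
Proof. by move=> cD; exact: compact_unif_continuous_at. Qed.

(** The inverse is continuous at [f x] by compactness: if [y] is at distance at least [e] from [x],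
    then [f y] differs from [f x], so [f] keeps a positive distance from [f x] near [y], and
    finitely many such neighbourhoods suffice. *)
Lemma compact_embedding (R : realType) (n q : nat) (D : set 'rV[R]_n)
    (Y : set 'rV[R]_q) (f : 'rV[R]_n -> 'rV[R]_q) :
  compact D -> {within D, continuous f} -> f @` D `<=` Y -> set_inj D f ->
  embedding D Y f.
Proof.
move=> cD cf fY injf; split=> //.
pose g y := xget 0 [set x | D x /\ f x = y].
have gf x : D x -> g (f x) = x.
  move=> Dx; rewrite /g; case: xgetP => [x' _ [Dx' e]|/(_ x) /=]; last by case.
  by apply: injf; rewrite ?inE.
exists g => //; apply/withinP => _ [x Dx <-] e e0.
have /near_covering_withinP covD := (compact_near_coveringP D).1 cD.
pose P (d : R) y := `|f x - f y| < d -> `|x - y| < e.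
have H y : D y -> \forall y' \near y & d \near (0 : R)^'+, D y' -> P d y'.
  move=> Dy; have [xy|xy] := ltP `|x - y| e.
    exists (ball y (e - `|x - y|), [set: R]) => /=.
      by split; [apply: nbhsx_ballx; rewrite subr_gt0|exact: filterT].
    move=> [y' r] /= [yy' _] Dy' _; rewrite -ball_normE /= in yy'.
    by have := ler_distD y x y'; lra.
  have fxy : 0 < `|f x - f y|.
    rewrite normr_gt0 subr_eq0; apply/eqP => fxy.
    move: xy; rewrite (injf x y) ?inE// subrr normr0; lra.
  move/withinP: cf => /(_ y Dy _ (divr_gt0 fxy (ltr0Sn _ 1)))[d d0 Hd].
  exists (ball y d, [set r | r < `|f x - f y| / 2]) => /=.
    split; first exact: nbhsx_ballx.
    by apply: nbhs_right_lt; rewrite divr_gt0.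
  move=> [y' r] /= [yy' rd] Dy' xy'; rewrite -ball_normE /= in yy'.
  have := Hd _ Dy' yy'; have := ler_distD (f y') (f x) (f y).
  by rewrite (distrC (f y')); lra.
have [d [d0 Hd]] := filter_ex (filterI (nbhs_right_gt (0 : R)) (covD R _ P _ H)).
by exists d => // _ [y Dy <-]; rewrite !gf//; exact: (Hd y).
Qed.

Lemma embedding_inj (R : realType) (n q : nat) (D : set 'rV[R]_n)
    (Y : set 'rV[R]_q) (f : 'rV[R]_n -> 'rV[R]_q) :
  embedding D Y f -> set_inj D f.
Proof.
by case=> _ _ [g gf _] x y; rewrite !inE => Dx Dy e; rewrite -(gf x)// e gf.
Qed.

Lemma within_comp (R : realType) (U V W : normedModType R) (D : set U)
    (D' : set V) (f : U -> V) (g : V -> W) :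
  {within D, continuous f} -> f @` D `<=` D' -> {within D', continuous g} ->
  {within D, continuous (g \o f)}.
Proof.
move=> /withinP cf fD /withinP cg; apply/withinP => x Dx e e0.
have Df y : D y -> D' (f y) by move=> Dy; apply: fD; exists y.
have [d d0 Hd] := cg _ (Df x Dx) e e0.
have [d' d'0 Hd'] := cf x Dx d d0.
by exists d' => // y Dy /(Hd' y Dy) xy; apply: Hd => //; exact: Df.
Qed.

Lemma ler_mxnorm (R : realType) (n : nat) (x : 'rV[R]_n) (c : R) :
  0 <= c -> (`|x| <= c <-> forall i, `|x 0 i| <= c).
Proof.
move=> c0; rewrite /Num.Def.normr/= mx_normrE; split=> [/bigmax_leP[_ H] i|H].
  exact: (H (0, i)).
by rewrite bigmax_le// => -[i j] _ /=; rewrite ord1; exact: H.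
Qed.

Lemma ltr_mxnorm (R : realType) (n : nat) (x : 'rV[R]_n) (c : R) :
  0 < c -> (`|x| < c <-> forall i, `|x 0 i| < c).
Proof.
move=> c0; rewrite /Num.Def.normr/= mx_normrE; split=> [/bigmax_ltP[_ H] i|H].
  exact: (H (0, i)).
by apply/bigmax_ltP; split=> // -[i j] _ /=; rewrite ord1; exact: H.
Qed.

Lemma coord_le_norm (R : realType) (n : nat) (x : 'rV[R]_n) i :
  `|x 0 i| <= `|x|.
Proof. exact: (ler_mxnorm x (normr_ge0 x)).1. Qed.

Lemma norm_row_mx_le (R : realType) (n1 n2 : nat) (x : 'rV[R]_n1)
    (y : 'rV[R]_n2) (c : R) :
  0 <= c -> (`|row_mx x y| <= c <-> `|x| <= c /\ `|y| <= c).
Proof.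
move=> c0; split=> [/(ler_mxnorm _ c0) H|[/(ler_mxnorm _ c0) Hx]].
  split; apply/ler_mxnorm => // i.
    by have := H (lshift _ i); rewrite row_mxEl.
  by have := H (rshift _ i); rewrite row_mxEr.
move=> /(ler_mxnorm _ c0) Hy; apply/ler_mxnorm => // i; rewrite mxE.
by case: fintype.split => j; [exact: Hx|exact: Hy].
Qed.

Lemma norm_row_mx_lt (R : realType) (n1 n2 : nat) (x : 'rV[R]_n1)
    (y : 'rV[R]_n2) (c : R) :
  0 < c -> (`|row_mx x y| < c <-> `|x| < c /\ `|y| < c).
Proof.
move=> c0; split=> [/(ltr_mxnorm _ c0) H|[/(ltr_mxnorm _ c0) Hx]].
  split; apply/ltr_mxnorm => // i.
    by have := H (lshift _ i); rewrite row_mxEl.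
  by have := H (rshift _ i); rewrite row_mxEr.
move=> /(ltr_mxnorm _ c0) Hy; apply/ltr_mxnorm => // i; rewrite mxE.
by case: fintype.split => j; [exact: Hx|exact: Hy].
Qed.

Lemma norm_scalar_mx1 (R : realType) (a : R) : `|a%:M : 'rV[R]_1| = `|a|.
Proof.
apply/eqP; rewrite eq_le; apply/andP; split.
  by apply/ler_mxnorm => // i; rewrite ord1 mxE eqxx.
by have := coord_le_norm (a%:M : 'rV[R]_1) 0; rewrite mxE eqxx.
Qed.

Lemma rV1P (R : realType) (x : 'rV[R]_1) : x = (x 0 0)%:M.
Proof. by apply/matrixP => i j; rewrite !ord1 mxE eqxx. Qed.

(** * Convex hulls and piecewise linear maps *)

(** A closed piece that misses [x] misses a neighbourhood of [x]; on a piece through [x] the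
    continuity is that of [g i]. Finitely many radii have a minimum. *)
Lemma finite_paste (R : realType) (V W : normedModType R) (D : set V)
    (f : V -> W) (I : eqType) (cs : seq I) (C : I -> set V) (g : I -> V -> W) :
  (forall x, D x -> exists2 i, i \in cs & C i x) ->
  (forall i, i \in cs -> closed (C i)) ->
  (forall i, i \in cs -> continuous (g i)) ->
  (forall i x, i \in cs -> D x -> C i x -> f x = g i x) ->
  {within D, continuous f}.
Proof.
move=> cov clC cg fg; apply/withinP => x Dx e e0.
have [d d0 Hd] : exists2 d, 0 < d & forall i, i \in cs -> forall y, D y ->
    `|x - y| < d -> C i y -> `|f x - f y| < e.
  elim: cs {cov} clC cg fg => [|i cs IH] clC cg fg; first by exists 1.
  have [j jcs|j jcs|j y jcs|d d0 Hd] := IH.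
  - by apply: clC; rewrite inE jcs orbT.
  - by apply: cg; rewrite inE jcs orbT.
  - by apply: fg; rewrite inE jcs orbT.
  have ics : i \in i :: cs by rewrite mem_head.
  have [d' d'0 Hd'] : exists2 d', 0 < d' & forall y, D y ->
      `|x - y| < d' -> C i y -> `|f x - f y| < e.
    have [Cx|nCx] := pselect (C i x).
      have /cvgrPdist_lt/(_ e e0)/nbhs_normP[d' /= d'0 Hd'] := cg _ ics x.
      by exists d' => // y Dy xy Cy; rewrite !(fg i)//; exact: Hd'.
    have : nbhs x (~` C i) by apply: open_nbhs_nbhs; split=> //;
      exact/closed_openC/clC.
    by move=> /nbhs_normP[d' /= d'0 Hd']; exists d' => // y Dy /Hd'.
  exists (Num.min d d'); first by rewrite lt_min d0.
  move=> j; rewrite inE => /orP[/eqP->|jcs] y Dy; rewrite lt_min => /andP[h1 h2].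
    exact: Hd'.
  exact: Hd.
by exists d => // y Dy xy; have [i ics Ciy] := cov y Dy; exact: (Hd i).
Qed.

Lemma continuous_mulmx_row (R : realType) (n q : nat) (M : 'M[R]_(n, q))
    (b : 'rV[R]_q) : continuous (fun x : 'rV[R]_n => x *m M + b).
Proof.
pose c := 1 + \sum_i \sum_j `|M i j|.
have c0 : 0 < c.
  by rewrite ltr_pwDl// sumr_ge0// => i _; rewrite sumr_ge0.
apply/continuous_subspace_setT/withinP => x _ e e0.
exists (e / c) => /=; first by rewrite divr_gt0.
move=> y _; rewrite /= ltr_pdivlMr// => xy.
rewrite opprD addrACA subrr addr0 -mulmxBl; apply/ltr_mxnorm => // j.
rewrite mxE; apply: le_lt_trans (ler_norm_sum _ _ _) _.
apply: le_lt_trans xy; rewrite mulrDr mulr1 ler_wpDl// mulr_sumr ler_sum// => i _.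
rewrite normrM ler_pM//; first exact: coord_le_norm.
by rewrite (bigD1 j)//= ler_wpDr// sumr_ge0.
Qed.

Section hull.
Variables (R : realType) (n : nat).
Implicit Types (s : seq 'rV[R]_n) (x y : 'rV[R]_n).

(** Points of weight zero are allowed outside the hull. Thus [hull_cut] can sum over all pairs of
    vertices, including those whose segment does not cross the hyperplane. *)
Lemma hull_sum s (I : finType) (w : I -> R) (y : I -> 'rV[R]_n) :
  (forall i, 0 <= w i) -> \sum_i w i = 1 ->
  (forall i, w i != 0 -> hull s (y i)) -> hull s (\sum_i w i *: y i).
Proof.
move=> w0 w1 hy.
have /choice[W HW] i : exists W : 'I_(size s) -> R, w i != 0 ->
    [/\ forall k, 0 <= W k, \sum_k W k = 1 & y i = \sum_k W k *: s`_k].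
  have [wi|/hy[W HW]] := eqVneq (w i) 0; first by exists (fun=> 0).
  by exists W.
exists (fun k => \sum_i w i * W i k); split.
- move=> k; apply: sumr_ge0 => i _.
  have [->|wi] := eqVneq (w i) 0; first by rewrite mul0r.
  by rewrite mulr_ge0//; have [+ _ _] := HW i wi; exact.
- rewrite exchange_big/= -w1; apply: eq_bigr => i _; rewrite -mulr_sumr.
  have [->|wi] := eqVneq (w i) 0; first by rewrite mul0r.
  by have [_ -> _] := HW i wi; rewrite mulr1.
rewrite [RHS](eq_bigr (fun k => \sum_i (w i * W i k) *: s`_k)); last first.
  by move=> k _; rewrite scaler_suml.
rewrite exchange_big/=; apply: eq_bigr => i _.
have [->|wi] := eqVneq (w i) 0.
  by rewrite scale0r big1// => k _; rewrite mul0r scale0r.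
have [_ _ ->] := HW i wi; rewrite scaler_sumr.
by apply: eq_bigr => k _; rewrite scalerA.
Qed.

Lemma hull_mem s x : x \in s -> hull s x.
Proof.
move=> xs; have ks : (index x s < size s)%N by rewrite index_mem.
exists (fun i => (i == Ordinal ks)%:R); split.
- by move=> i; rewrite ler0n.
- by rewrite (bigD1 (Ordinal ks))//= eqxx big1 ?addr0// => i /negPf->.
rewrite (bigD1 (Ordinal ks))//= eqxx scale1r nth_index// big1 ?addr0//.
by move=> i /negPf->; rewrite scale0r.
Qed.

Lemma hull_segment s x y (a b : R) : hull s x -> hull s y ->
  0 <= a -> 0 <= b -> a + b = 1 -> hull s (a *: x + b *: y).
Proof.
move=> hx hy a0 b0 ab.
have := @hull_sum s bool (fun i => if i then a else b) (fun i => if i then x else y).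
rewrite !big_bool/=; apply => //; by [case|case].
Qed.

Lemma sub_hull s s' : (forall x, x \in s' -> hull s x) -> hull s' `<=` hull s.
Proof.
move=> H x [w [w0 w1 ->]]; apply: hull_sum => // i _; apply/H/mem_nth.
exact: ltn_ord.
Qed.

(** One step of the double description method: the new vertices are the old ones in the half-space
    and the points where the hyperplane meets a segment from a strictly positive to a strictly
    negative vertex. *)
Lemma hull_cut s (c : 'cV[R]_n) (b : R) : exists s',
  hull s `&` [set x | b <= (x *m c) 0 0] = hull s'.
Proof.
pose l x := (x *m c) 0 0 - b.
pose N := size s.
pose pt (ij : 'I_N * 'I_N) := let i := ij.1 in let j := ij.2 in
  (l s`_i - l s`_j)^-1 *: (- l s`_j *: s`_i + l s`_i *: s`_j).
pose P := [pred ij : 'I_N * 'I_N | (0 < l s`_ij.1) && (l s`_ij.2 < 0)].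
exists ([seq x <- s | 0 <= l x] ++ [seq pt ij | ij <- enum P]).
have lS (I : finType) (w : I -> R) (y : I -> 'rV[R]_n) : \sum_i w i = 1 ->
    l (\sum_i w i *: y i) = \sum_i w i * l (y i).
  move=> w1; rewrite /l mulmx_suml summxE -[X in _ - X]mul1r -w1 mulr_suml.
  rewrite -sumrB; apply: eq_bigr => i _; rewrite mulrBr; congr (_ - _).
  by rewrite -scalemxAl mxE.
apply/seteqP; split=> x /=.
  case=> -[w [w0 w1 xE]]; rewrite -subr_ge0 -/(l x) => lx.
  pose u (i : 'I_N) : R := if 0 < l s`_i then w i else 0.
  pose v (i : 'I_N) : R := if l s`_i < 0 then w i else 0.
  pose z (i : 'I_N) : R := if l s`_i == 0 then w i else 0.
  have wE i : w i = u i + v i + z i.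
    by rewrite /u /v /z; case: ltgtP => _; rewrite ?addr0 ?add0r.
  have u0 i : 0 <= u i by rewrite /u; case: ifP.
  have v0 i : 0 <= v i by rewrite /v; case: ifP.
  have z0 i : 0 <= z i by rewrite /z; case: ifP.
  pose SP := \sum_(i < N) u i * l s`_i; pose SM := \sum_(i < N) v i * l s`_i.
  have SP0 : 0 <= SP.
    by apply: sumr_ge0 => i _; rewrite /u; case: ltP => [/ltW li|_]; rewrite ?mul0r ?mulr_ge0.
  have SM0 : SM <= 0.
    rewrite -oppr_ge0 -sumrN; apply: sumr_ge0 => i _.
    rewrite -mulrN /v; case: ltP => [li|_]; rewrite ?mul0r//.
    by rewrite mulr_ge0// oppr_ge0 ltW.
  have lxE : l x = SP + SM.
    rewrite xE lS// -big_split/=; apply: eq_bigr => i _.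
    rewrite wE !mulrDl [z i * _](_ : _ = 0) ?addr0//.
    by rewrite /z; case: (l s`_i =P 0) => [->|_]; rewrite ?mulr0 ?mul0r.
  have hu i : u i != 0 -> hull ([seq x <- s | 0 <= l x] ++ [seq pt ij | ij <- enum P]) s`_i.
    move=> ui; apply: hull_mem; rewrite mem_cat mem_filter mem_nth ?ltn_ord// andbT.
    by move: ui; rewrite /u; case: ltP => [/ltW->//|]; rewrite eqxx.
  have hz i : z i != 0 -> hull ([seq x <- s | 0 <= l x] ++ [seq pt ij | ij <- enum P]) s`_i.
    move=> zi; apply: hull_mem; rewrite mem_cat mem_filter mem_nth ?ltn_ord// andbT.
    by move: zi; rewrite /z; case: (l s`_i =P 0) => [->//|]; rewrite ?lexx// eqxx.
  (* Without positive mass there is no negative mass either, because [l x] is nonnegative. The case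
     is separate since the weights below divide by [SP]. *)
  have [SPe|SPn] := eqVneq SP 0.
    have SMe : SM = 0 by apply/eqP; rewrite eq_le SM0/=; lra.
    have v_eq0 i : v i = 0.
      apply/eqP/negPn/negP => vi; have := vi; rewrite {1}/v; case: ltP => [li _|]; last by rewrite eqxx.
      have /eqP : \sum_(i < N) v i * - l s`_i = 0.
        rewrite (eq_bigr (fun k => - (v k * l s`_k))); first by rewrite sumrN -/SM SMe oppr0.
        by move=> k _; rewrite mulrN.
      rewrite psumr_eq0; last first.
        move=> k _; rewrite /v; case: ltP => [lk|_]; rewrite ?mul0r//.
        by rewrite mulr_ge0// oppr_ge0 ltW.
      move=> /allP/(_ i); rewrite mem_index_enum => /(_ isT)/=.
      by rewrite mulf_eq0 (negPf vi)/= oppr_eq0 lt_eqF.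
    rewrite xE; apply: hull_sum => // i; rewrite wE v_eq0 addr0 => uz.
    have [ui|/hu//] := eqVneq (u i) 0; apply: hz.
    by move: uz; rewrite ui add0r.
  have SPp : 0 < SP by rewrite lt_def SPn.
  (* Each negative vertex is cancelled against all positive ones, in proportion to their share of
     [SP]; a positive vertex keeps the fraction [1 + SM / SP] of its weight, which is nonnegative
     because [SP + SM = l x]. The module is arbitrary since the identity is applied twice: to the
     vertices for the point, to the constant 1 for the total weight. *)
  have key (V : lmodType R) (S : 'I_N -> V) :
      \sum_i w i *: S i = \sum_i (z i + u i * (1 + SM / SP)) *: S i +
        \sum_ij (u ij.1 * v ij.2 / SP) *:
          (- l s`_ij.2 *: S ij.1 + l s`_ij.1 *: S ij.2).
    rewrite -(pair_bigA _ (fun i j => (u i * v j / SP) *: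
       (- l s`_j *: S i + l s`_i *: S j)))/=.
    under [X in _ + X]eq_bigr do
      (under eq_bigr do rewrite scalerDr !scalerA; rewrite big_split/=).
    rewrite [X in _ = _ + X]big_split/=.
    rewrite [X in _ = _ + (X + _)](_ : _ = \sum_i (u i * (- SM / SP)) *: S i); last first.
      apply: eq_bigr => i _; rewrite -scaler_suml; congr (_ *: _).
      rewrite [RHS](_ : _ = - u i / SP * SM); last by ring.
      by rewrite /SM mulr_sumr; apply: eq_bigr => j _; ring.
    rewrite [X in _ = _ + (_ + X)](_ : _ = \sum_i v i *: S i); last first.
      rewrite exchange_big/=; apply: eq_bigr => j _; rewrite -scaler_suml; congr (_ *: _).
      rewrite (eq_bigr (fun i => v j / SP * (u i * l s`_i))); last by move=> i _; ring.
      by rewrite -mulr_sumr -/SP divfK.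
    rewrite addrA -!big_split/=; apply: eq_bigr => i _.
    by rewrite -!scalerDl wE; congr (_ *: _); ring.
  pose W (k : 'I_N + 'I_N * 'I_N) := match k with
    | inl i => z i + u i * (1 + SM / SP)
    | inr ij => u ij.1 * v ij.2 / SP * (l s`_ij.1 - l s`_ij.2) end.
  pose Y (k : 'I_N + 'I_N * 'I_N) := match k with inl i => s`_i | inr ij => pt ij end.
  have uv i j : u i * v j != 0 -> 0 < l s`_i /\ l s`_j < 0.
    by rewrite /u /v; case: (ltP 0 (l s`_i)) => [li|_];
      case: (ltP (l s`_j) 0) => [lj|_]; rewrite ?mulr0 ?mul0r ?eqxx.
  have -> : x = \sum_k W k *: Y k.
    rewrite xE (key _ (fun i => s`_i)) big_sumType/=; congr (_ + _).
    apply: eq_bigr => -[i j] _ /=; have [->|/uv[li lj]] := eqVneq (u i * v j) 0.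
      by rewrite !mul0r !scale0r.
    by rewrite scalerA mulfK// subr_eq0 gt_eqF// (lt_trans lj).
  apply: hull_sum.
  - have ratio : 0 <= 1 + SM / SP.
      by rewrite -(ler_pM2r SPp) mul0r mulrDl mul1r divfK//; lra.
    case=> [i|[i j]] /=; first by rewrite addr_ge0// mulr_ge0.
    have [->|/uv[li lj]] := eqVneq (u i * v j) 0; first by rewrite !mul0r.
    by rewrite mulr_ge0// ?divr_ge0// ?mulr_ge0//; lra.
  - rewrite big_sumType/=; transitivity (\sum_i w i); last exact: w1.
    have := key (R^o : lmodType R) (fun=> 1).
    move=> e; rewrite [RHS](_ : _ = \sum_i w i *: (1 : R^o)); last first.
      by apply: eq_bigr => i _; rewrite [RHS]mulr1.
    rewrite e; congr (_ + _); apply: eq_bigr => i _; first by rewrite [RHS]mulr1.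
    by rewrite [- _ *: _]mulr1 [l _ *: _]mulr1 addrC.
  case=> [i|[i j]] /=.
    move=> zu; have [ui|/hu//] := eqVneq (u i) 0; apply: hz.
    by move: zu; rewrite ui mul0r addr0.
  move=> h; have /uv[li lj] : u i * v j != 0.
    by apply: contraNneq h => ->; rewrite !mul0r.
  apply: hull_mem; rewrite mem_cat; apply/orP; right; apply/mapP; exists (i, j) => //.
  by rewrite mem_enum inE/= li.
move=> hx.
have hs : hull s x.
  apply: sub_hull hx => y; rewrite mem_cat mem_filter.
  move=> /orP[/andP[_ /hull_mem//]|/mapP[[i j] + ->]].
  rewrite mem_enum inE/= => /andP[li lj]; rewrite /pt/= scalerDr !scalerA.
  have lij : 0 < l s`_i - l s`_j by lra.
  apply: hull_segment; try exact/hull_mem/mem_nth/ltn_ord.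
  - by apply: mulr_ge0; rewrite ?invr_ge0 ?oppr_ge0 ltW.
  - by apply: mulr_ge0; rewrite ?invr_ge0 ltW.
  by rewrite -mulrDr [- _ + _]addrC mulVf ?gt_eqF.
split=> //; rewrite -subr_ge0 -/(l x); case: hx => w [w0 w1 ->].
rewrite lS//; apply: sumr_ge0 => k _; rewrite mulr_ge0//.
have := mem_nth 0 (ltn_ord k); rewrite mem_cat mem_filter.
move=> /orP[/andP[]//|/mapP[[i j] + ->]].
rewrite mem_enum inE/= => /andP[li lj].
have lij : 0 < l s`_i - l s`_j by lra.
have -> : l (pt (i, j)) = 0; last by [].
rewrite /pt/= scalerDr !scalerA.
have := lS bool (fun k => if k then (l s`_i - l s`_j)^-1 * - l s`_j else
  (l s`_i - l s`_j)^-1 * l s`_i) (fun k => if k then s`_i else s`_j).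
rewrite !big_bool/= => -> //; first by ring.
by rewrite -mulrDr [- _ + _]addrC mulVf ?gt_eqF.
Qed.
End hull.

Section piecewise_linear.
Variable R : realType.

Definition cell n := seq ('cV[R]_n * R).

Definition in_cell n (C : cell n) : set 'rV[R]_n :=
  [set x | forall h, h \in C -> h.2 <= (x *m h.1) 0 0].

(* Unlike [pl], the pieces are given by inequalities, so that two such maps have
   a common refinement without passing from vertices to facets. *)
Definition pwl n q (f : 'rV[R]_n -> 'rV[R]_q) : Prop :=
  exists cs : seq (cell n),
    (forall x, exists2 C, C \in cs & in_cell C x) /\
    forall C, C \in cs -> exists (M : 'M[R]_(n, q)) (b : 'rV[R]_q),
      forall x, in_cell C x -> f x = x *m M + b.

Definition pwls n (f : 'rV[R]_n -> R) : Prop :=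
  pwl (fun x => (f x)%:M : 'rV[R]_1).

Lemma in_cell_cat n (C1 C2 : cell n) x :
  in_cell (C1 ++ C2) x <-> in_cell C1 x /\ in_cell C2 x.
Proof.
split=> [H|[H1 H2] h]; last by rewrite mem_cat => /orP[/H1|/H2].
by split=> h hC; apply: H; rewrite mem_cat hC ?orbT.
Qed.

Lemma pwl_affine n q (M : 'M[R]_(n, q)) b : pwl (fun x => x *m M + b).
Proof.
exists [:: [::]]; split=> [x|C _]; last by exists M, b.
by exists [::] => //; rewrite mem_head.
Qed.

Lemma eq_pwl n q (f g : 'rV[R]_n -> 'rV[R]_q) : f =1 g -> pwl f -> pwl g.
Proof. by move=> /funext->. Qed.

Lemma pwl_comp_affine n p q (f : 'rV[R]_p -> 'rV[R]_q) (M : 'M[R]_(n, p)) b :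
  pwl f -> pwl (fun x => f (x *m M + b)).
Proof.
case=> cs [cov aff].
pose tr (C : cell p) : cell n := [seq (M *m h.1, h.2 - (b *m h.1) 0 0) | h <- C].
have trP C x : in_cell (tr C) x <-> in_cell C (x *m M + b).
  split=> [H h hC|H _ /mapP[h hC ->]] /=.
    have /H : (M *m h.1, h.2 - (b *m h.1) 0 0) \in tr C by apply/mapP; exists h.
    by rewrite /= => Hx; rewrite mulmxDl [X in h.2 <= X]mxE -lerBlDr -mulmxA.
  by have := H h hC; rewrite mulmxDl [X in h.2 <= X]mxE -lerBlDr mulmxA.
exists [seq tr C | C <- cs]; split=> [x|_ /mapP[C /aff[N [c H]] ->]].
  have [C Ccs Cx] := cov (x *m M + b).
  by exists (tr C); [apply/mapP; exists C|apply/trP].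
exists (M *m N), (b *m N + c) => x /trP /H ->.
by rewrite mulmxDl mulmxA addrA.
Qed.

Lemma affine_comp_pwl n p q (f : 'rV[R]_n -> 'rV[R]_p) (M : 'M[R]_(p, q)) b :
  pwl f -> pwl (fun x => f x *m M + b).
Proof.
case=> cs [cov aff]; exists cs; split=> // C /aff[N [c H]].
by exists (N *m M), (c *m M + b) => x /H ->; rewrite mulmxDl mulmxA addrA.
Qed.

Lemma pwl_row_mx n q1 q2 (f : 'rV[R]_n -> 'rV[R]_q1) (g : 'rV[R]_n -> 'rV[R]_q2) :
  pwl f -> pwl g -> pwl (fun x => row_mx (f x) (g x)).
Proof.
case=> cs [cov aff] [cs' [cov' aff']].
exists [seq C ++ C' | C <- cs, C' <- cs']; split=> [x|_ /allpairsP[[C C'] /= [+ + ->]]].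
  have [C Ccs Cx] := cov x; have [C' Ccs' Cx'] := cov' x.
  exists (C ++ C'); last exact/in_cell_cat.
  by apply/allpairsP; exists (C, C').
move=> /aff[N [c H]] /aff'[N' [c' H']].
exists (row_mx N N'), (row_mx c c') => x /in_cell_cat[/H-> /H'->].
by rewrite mul_mx_row add_row_mx.
Qed.

Lemma pwl_add n q (f g : 'rV[R]_n -> 'rV[R]_q) :
  pwl f -> pwl g -> pwl (fun x => f x + g x).
Proof.
move=> pf pg; have := affine_comp_pwl (col_mx 1%:M 1%:M) 0 (pwl_row_mx pf pg).
by apply: eq_pwl => x; rewrite mul_row_col !mulmx1 addr0.
Qed.

Lemma pwl_scale n q (f : 'rV[R]_n -> R) (w : 'rV[R]_q) :
  pwls f -> pwl (fun x => f x *: w).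
Proof.
move=> pf; have := affine_comp_pwl w 0 pf.
by apply: eq_pwl => x; rewrite addr0 mul_scalar_mx.
Qed.

Lemma pwls_affine n (c : 'cV[R]_n) (b : R) : pwls (fun x => (x *m c) 0 0 + b).
Proof.
have := pwl_affine c (b%:M : 'rV[R]_1).
by apply: eq_pwl => x; rewrite raddfD/= -rV1P.
Qed.

Lemma pwls_cst n (b : R) : pwls (fun _ : 'rV[R]_n => b).
Proof.
have := @pwls_affine n 0 b.
by apply: eq_pwl => x; rewrite mulmx0 mxE add0r.
Qed.

Lemma pwls_coord n (i : 'I_n) : pwls (fun x : 'rV[R]_n => x 0 i).
Proof.
have := @pwls_affine n (delta_mx i 0) 0; apply: eq_pwl => x; congr (_ %:M).
rewrite addr0 mxE (bigD1 i)//= big1 ?addr0 ?mxE ?eqxx ?mulr1//.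
by move=> j /negPf ji; rewrite mxE ji mulr0.
Qed.

Lemma pwls_add n (f g : 'rV[R]_n -> R) :
  pwls f -> pwls g -> pwls (fun x => f x + g x).
Proof.
move=> pf pg; have := pwl_add pf pg.
by apply: eq_pwl => x; rewrite raddfD.
Qed.

Lemma pwls_mull n (c : R) (f : 'rV[R]_n -> R) :
  pwls f -> pwls (fun x => c * f x).
Proof.
move=> pf; have := pwl_scale (c%:M : 'rV[R]_1) pf.
by apply: eq_pwl => x; rewrite scale_scalar_mx mulrC.
Qed.

Lemma pwls_opp n (f : 'rV[R]_n -> R) : pwls f -> pwls (fun x => - f x).
Proof.
by move=> /(pwls_mull (-1)); apply: eq_pwl => x; rewrite mulN1r.
Qed.

(** On the intersection of a cell of [f] with a cell of [g] both are affine, and the hyperplane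
    where the two forms agree separates the part where [f] is the maximum from the part where [g]
    is. *)
Lemma pwls_max n (f g : 'rV[R]_n -> R) :
  pwls f -> pwls g -> pwls (fun x => Num.max (f x) (g x)).
Proof.
case=> cs [cov aff] [cs' [cov' aff']].
have sc (h : 'rV[R]_n -> R) (C : cell n) : (exists (M : 'M[R]_(n, 1)) (b : 'rV[R]_1),
    forall x, in_cell C x -> (h x)%:M = x *m M + b) ->
  exists (c : 'cV[R]_n) (b : R), forall x, in_cell C x -> h x = (x *m c) 0 0 + b.
  move=> [M [b H]]; exists M, (b 0 0) => x /H /matrixP/(_ 0 0).
  by rewrite !mxE eqxx.
have {aff} aff C := fun hC => sc f C (aff C hC).
have {aff'} aff' C := fun hC => sc g C (aff' C hC).
have /choice[F HF] C : exists cb : 'cV[R]_n * R, C \in cs -> forall x, in_cell C x ->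
    f x = (x *m cb.1) 0 0 + cb.2.
  have [/aff[c [b H]]|//] := boolP (C \in cs); first by exists (c, b).
  by exists (0, 0).
have /choice[G HG] C : exists cb : 'cV[R]_n * R, C \in cs' -> forall x, in_cell C x ->
    g x = (x *m cb.1) 0 0 + cb.2.
  have [/aff'[c [b H]]|//] := boolP (C \in cs'); first by exists (c, b).
  by exists (0, 0).
pose fg C C' : 'cV[R]_n * R := ((F C).1 - (G C').1, (G C').2 - (F C).2).
pose gf C C' : 'cV[R]_n * R := ((G C').1 - (F C).1, (F C).2 - (G C').2).
exists ([seq fg C C' :: (C ++ C') | C <- cs, C' <- cs'] ++
        [seq gf C C' :: (C ++ C') | C <- cs, C' <- cs']); split=> [x|D].
  have [C Ccs Cx] := cov x; have [C' Ccs' Cx'] := cov' x.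
  have [le|/ltW le] := leP (g x) (f x).
    exists (fg C C' :: (C ++ C')).
      by rewrite mem_cat; apply/orP; left; apply/allpairsP; exists (C, C').
    move=> h; rewrite inE => /orP[/eqP->|]; last by apply/in_cell_cat: h.
    by rewrite /= mulmxBr !mxE; move: le; rewrite (HF C)// (HG C')// !mxE; lra.
  exists (gf C C' :: (C ++ C')).
    by rewrite mem_cat; apply/orP; right; apply/allpairsP; exists (C, C').
  move=> h; rewrite inE => /orP[/eqP->|]; last by apply/in_cell_cat: h.
  by rewrite /= mulmxBr !mxE; move: le; rewrite (HF C)// (HG C')// !mxE; lra.
rewrite mem_cat => /orP[] /allpairsP[[C C'] /= [Ccs Ccs' ->]].
  exists (F C).1, ((F C).2)%:M => x Hx.
  have /in_cell_cat[Cx Cx'] : in_cell (C ++ C') x.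
    by move=> h hC; apply: Hx; rewrite inE hC orbT.
  have := Hx _ (mem_head _ _); rewrite /= mulmxBr !mxE => le.
  rewrite max_l; first by rewrite (HF C)// raddfD/= -rV1P.
  by rewrite (HF C)// (HG C')// !mxE; lra.
exists (G C').1, ((G C').2)%:M => x Hx.
have /in_cell_cat[Cx Cx'] : in_cell (C ++ C') x.
  by move=> h hC; apply: Hx; rewrite inE hC orbT.
have := Hx _ (mem_head _ _); rewrite /= mulmxBr !mxE => le.
rewrite max_r; first by rewrite (HG C')// raddfD/= -rV1P.
by rewrite (HF C)// (HG C')// !mxE; lra.
Qed.

Lemma pwls_min n (f g : 'rV[R]_n -> R) :
  pwls f -> pwls g -> pwls (fun x => Num.min (f x) (g x)).
Proof.
move=> pf pg; have := pwls_opp (pwls_max (pwls_opp pf) (pwls_opp pg)).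
by apply: eq_pwl => x; rewrite -oppr_min opprK.
Qed.

Lemma pwl_coords n q (f : 'rV[R]_n -> 'rV[R]_q) :
  (forall j, pwls (fun x => f x 0 j)) -> pwl f.
Proof.
move=> H; suff S (s : seq 'I_q) : pwl (fun x => \sum_(j <- s) f x 0 j *: delta_mx 0 j).
  by have := S (enum 'I_q); apply: eq_pwl => x; rewrite big_enum/= -row_sum_delta.
elim: s => [|j s IH].
  have := @pwl_affine n q 0 0; apply: eq_pwl => x.
  by rewrite big_nil mulmx0 addr0.
have := pwl_add (pwl_scale (delta_mx 0 j) (H j)) IH.
by apply: eq_pwl => x; rewrite big_cons.
Qed.

Lemma continuous_row_form n (c : 'cV[R]_n) (b : 'rV[R]_1) :
  continuous (fun x : 'rV[R]_n => (x *m c + b) 0 0).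
Proof.
move=> x; apply: (@continuous_comp _ _ _ (fun x : 'rV[R]_n => x *m c + b)
  (fun M : 'rV[R]_1 => M 0 0)); first exact: continuous_mulmx_row.
exact: coord_continuous.
Qed.

Lemma closed_in_cell n (C : cell n) : closed (in_cell C).
Proof.
have -> : in_cell C = \bigcap_(h in [set` C]) [set x | h.2 <= (x *m h.1) 0 0].
  by apply/seteqP; split=> x H h; exact: H.
apply: closed_bigI => h _.
have cn : continuous (fun x : 'rV[R]_n => (x *m h.1 + 0) 0 0).
  exact: continuous_row_form.
have -> : [set x : 'rV[R]_n | h.2 <= (x *m h.1) 0 0] =
    (fun x => (x *m h.1 + 0) 0 0) @^-1` [set r | h.2 <= r].
  by apply/seteqP; split=> x /=; rewrite addr0.
by apply: preimage_closed => [x _|]; [exact: cn|exact: closed_ge].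
Qed.

Lemma pwl_continuous n q (D : set 'rV[R]_n) (f : 'rV[R]_n -> 'rV[R]_q) :
  pwl f -> {within D, continuous f}.
Proof.
case=> cs [cov aff].
have /choice[M /choice[b H]] C : exists M b, C \in cs -> forall x, in_cell C x ->
    f x = x *m M + b.
  have [/aff[c [b H]]|//] := boolP (C \in cs); first by exists c, b.
  by exists 0, 0.
apply: (@finite_paste _ _ _ _ _ _ cs (@in_cell n) (fun C x => x *m M C + b C)).
- by move=> x _; exact: cov.
- by move=> C _; exact: closed_in_cell.
- by move=> C _; exact: continuous_mulmx_row.
- by move=> C x Ccs _; exact: H.
Qed.

Lemma hull_cell n (s : seq 'rV[R]_n) (C : cell n) :
  exists s', hull s `&` in_cell C = hull s'.
Proof.
elim: C s => [|h C IH] s; first by exists s; rewrite setIidl.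
have [s1 e1] := hull_cut s h.1 h.2; have [s2 e2] := IH s1; exists s2.
rewrite -e2 -e1; apply/seteqP; split=> x.
  move=> [hx Hx]; split.
    by split=> //; apply: Hx; rewrite mem_head.
  by move=> k kC; apply: Hx; rewrite inE kC orbT.
move=> [[hx Hx] Hx']; split=> // k; rewrite inE => /orP[/eqP->//|].
exact: Hx'.
Qed.

Lemma eq_pl n q (D : set 'rV[R]_n) (f g : 'rV[R]_n -> 'rV[R]_q) :
  (forall x, D x -> f x = g x) -> pl D f -> pl D g.
Proof.
move=> fg [F DF aff]; exists F => // s sF; have [M [b H]] := aff s sF.
by exists M, b => x hx; rewrite -fg ?H// DF; exists s.
Qed.

Lemma pl_set0 n q (f : 'rV[R]_n -> 'rV[R]_q) : pl set0 f.
Proof. by exists [::] => //; apply/seteqP; split=> x // -[]. Qed.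

Lemma pl_setU n q (D1 D2 : set 'rV[R]_n) (f : 'rV[R]_n -> 'rV[R]_q) :
  pl D1 f -> pl D2 f -> pl (D1 `|` D2) f.
Proof.
move=> [F1 -> aff1] [F2 -> aff2]; exists (F1 ++ F2); last first.
  by move=> s; rewrite mem_cat => /orP[/aff1|/aff2].
apply/seteqP; split=> x.
  by case=> -[s sF hx]; exists s => //=; rewrite mem_cat sF ?orbT.
by case=> s /=; rewrite mem_cat => /orP[] sF hx; [left|right]; exists s.
Qed.

Lemma pl_bigcup n q (I : eqType) (F : seq I) (C : I -> set 'rV[R]_n)
    (f : 'rV[R]_n -> 'rV[R]_q) :
  (forall i, i \in F -> pl (C i) f) -> pl (\bigcup_(i in [set` F]) C i) f.
Proof.
elim: F => [|i F IH] H.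
  by rewrite (_ : \bigcup_(_ in _) _ = set0); [exact: pl_set0|
    apply/seteqP; split=> x // -[]].
rewrite (_ : \bigcup_(_ in _) _ = C i `|` \bigcup_(i in [set` F]) C i).
  apply: pl_setU; first by apply: H; rewrite mem_head.
  by apply: IH => j jF; apply: H; rewrite inE jF orbT.
apply/seteqP; split=> x.
  by case=> t /=; rewrite inE => /orP[/eqP->|tF] hx; [left|right; exists t].
by case=> [hx|[t /= tF hx]]; [exists i|exists t] => //=; rewrite inE ?eqxx ?tF ?orbT.
Qed.

(** Passage from inequalities to vertices: by [hull_cell], every cell of [g] cuts the polytope in a
    polytope. *)
Lemma pl_hull n q (s : seq 'rV[R]_n) (f g : 'rV[R]_n -> 'rV[R]_q) :
  pwl g -> (forall x, hull s x -> f x = g x) -> pl (hull s) f.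
Proof.
move=> [cs [cov aff]] fg; apply: (@eq_pl _ _ _ g) => [x /fg//|].
have /choice[cut Hcut] C := hull_cell s C.
exists [seq cut C | C <- cs]; last first.
  move=> _ /mapP[C /aff[M [b H]] ->]; exists M, b => x.
  by rewrite -Hcut => -[_ /H].
apply/seteqP; split=> x.
  move=> hx; have [C Ccs Cx] := cov x; exists (cut C).
    by apply/mapP; exists C.
  by rewrite -Hcut.
by case=> _ /= /mapP[C _ ->]; rewrite -Hcut => -[].
Qed.

Lemma pl_comp n p q (D : set 'rV[R]_n) (f : 'rV[R]_n -> 'rV[R]_p)
    (g : 'rV[R]_p -> 'rV[R]_q) : pl D f -> pwl g -> pl D (g \o f).
Proof.
move=> [F DF aff] pg.
rewrite DF; apply: pl_bigcup => s /aff[M [b H]].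
by apply: (pl_hull (pwl_comp_affine M b pg)) => x /H /= ->.
Qed.

Lemma hull_image n p (M : 'M[R]_(n, p)) b (s : seq 'rV[R]_n) :
  hull [seq x *m M + b | x <- s] = (fun x => x *m M + b) @` hull s.
Proof.
have sumE (w : 'I_(size s) -> R) : \sum_i w i = 1 ->
    (\sum_i w i *: s`_i) *m M + b =
    \sum_i w i *: [seq x *m M + b | x <- s]`_i.
  move=> w1; rewrite mulmx_suml -[X in _ + X]scale1r -w1 scaler_suml -big_split/=.
  by apply: eq_bigr => i _; rewrite -scalemxAl -scalerDr (nth_map 0).
apply/seteqP; split=> y.
  case=> w [w0 w1 ->]; move: w w0 w1; rewrite size_map => w w0 w1.
  by exists (\sum_i w i *: s`_i); [exists w|exact: sumE].
case=> x [w [w0 w1 ->]] <-; rewrite sumE//.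
by rewrite /hull/= size_map; exists w.
Qed.

Lemma pl_affine_image n p q (D : set 'rV[R]_n) (f : 'rV[R]_n -> 'rV[R]_q)
    (M : 'M[R]_(n, p)) (b : 'rV[R]_p) (N : 'M[R]_(p, n)) (c : 'rV[R]_n) :
  (forall x, (x *m M + b) *m N + c = x) -> pl D f ->
  pl ((fun x => x *m M + b) @` D) (fun y => f (y *m N + c)).
Proof.
move=> K [F DF aff]; exists [seq [seq x *m M + b | x <- s] | s <- F]; last first.
  move=> _ /mapP[s sF ->]; have [A [d H]] := aff s sF.
  exists (N *m A), (c *m A + d) => y; rewrite hull_image => -[x hx <-].
  by rewrite K H// -[in LHS](K x) mulmxDl mulmxA addrA.
rewrite DF; apply/seteqP; split=> y.
  case=> x [s sF hx] <-; exists [seq x *m M + b | x <- s].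
    by apply/mapP; exists s.
  by rewrite hull_image; exists x.
by case=> _ /mapP[s sF ->]; rewrite hull_image => -[x hx <-]; exists x => //; exists s.
Qed.

(** Two opposite half-spaces cut the slice out of the cylinder, so that it is a finite union of
    polytopes, and forgetting the time is affine. *)
Lemma pl_slice n q (D : set 'rV[R]_n) (H : R -> 'rV[R]_n -> 'rV[R]_q) t :
  0 <= t <= 1 -> pl (cylinder D) (on_cylinder H) -> pl D (H t).
Proof.
move=> t01 [F FE aff].
pose u : 'cV[R]_(n + 1) := col_mx 0 1%:M.
have uE (z : 'rV[R]_(n + 1)) : (z *m u) 0 0 = rsubmx z 0 0.
  by rewrite -{1}[z]hsubmxK mul_row_col mulmx0 mulmx1 add0r.
have nuE (z : 'rV[R]_(n + 1)) : (z *m (- u)) 0 0 = - rsubmx z 0 0.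
  by rewrite mulmxN mxE uE.
pose C : cell (n + 1) := [:: (u, t); (- u, - t)].
have CP z : in_cell C z <-> rsubmx z 0 0 = t.
  split=> [H0|zt h].
    have := H0 _ (mem_head _ _); have := H0 (- u, - t); rewrite !inE eqxx orbT.
    by move=> /(_ isT); rewrite /= nuE uE; lra.
  by rewrite !inE => /orP[] /eqP -> /=; rewrite ?nuE ?uE zt.
have /choice[cut Hcut] s := hull_cell s C.
pose M : 'M[R]_(n + 1, n) := col_mx 1%:M 0.
have ME (z : 'rV[R]_(n + 1)) : z *m M + 0 = lsubmx z.
  by rewrite -{1}[z]hsubmxK mul_row_col mulmx0 mulmx1 !addr0.
have key s x : hull [seq z *m M + 0 | z <- cut s] x <-> hull s (row_mx x t%:M).
  rewrite hull_image -Hcut; split.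
    move=> [z [hz /CP zt] <-]; rewrite ME -zt -rV1P hsubmxK//.
  move=> hx; exists (row_mx x t%:M); last by rewrite ME row_mxKl.
  by split=> //; apply/CP; rewrite row_mxKr mxE eqxx.
exists [seq [seq z *m M + 0 | z <- cut s] | s <- F]; last first.
  move=> _ /mapP[s /aff[N [b HN]] ->].
  exists (row_mx 1%:M 0 *m N), (row_mx 0 t%:M *m N + b) => x /key /HN.
  rewrite /on_cylinder row_mxKl row_mxKr mxE eqxx mulr1n => ->.
  by rewrite addrA mulmxA -mulmxDl mul_mx_row mulmx1 mulmx0 add_row_mx addr0 add0r.
have DE x : D x <-> cylinder D (row_mx x t%:M).
  by rewrite /cylinder/= row_mxKl row_mxKr mxE eqxx mulr1n; split=> // -[].
apply/seteqP; split=> x.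
  move=> /DE; rewrite FE => -[s sF hs]; exists [seq z *m M + 0 | z <- cut s].
    by apply/mapP; exists s.
  exact/key.
by case=> _ /mapP[s sF ->] /key hs; apply/DE; rewrite FE; exists s.
Qed.

Lemma compact_hull n (s : seq 'rV[R]_n) : compact (hull s).
Proof.
pose N := size s; pose M : 'M[R]_(N, n) := \matrix_(i < N) s`_i.
pose S := [set w : 'rV[R]_N | (forall i, w 0 i \in `[0, 1]) /\ (w *m const_mx 1 : 'rV[R]_1) 0 0 = 1].
have mulE (w : 'rV[R]_N) : w *m M + 0 = \sum_i w 0 i *: s`_i.
  rewrite addr0 mulmx_sum_row; apply: eq_bigr => i _; congr (_ *: _).
  by apply/rowP => j; rewrite !mxE.
have sumE (w : 'rV[R]_N) : (w *m const_mx 1 : 'rV[R]_1) 0 0 = \sum_i w 0 i.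
  by rewrite mxE; apply: eq_bigr => i _; rewrite mxE mulr1.
have -> : hull s = (fun w => w *m M + 0) @` S.
  apply/seteqP; split=> x.
    case=> w [w0 w1 ->]; exists (\row_i w i).
      split=> [i|].
        rewrite mxE in_itv/= w0/= -w1 (bigD1 i)//= lerDl sumr_ge0//.
      by rewrite sumE -w1; apply: eq_bigr => i _; rewrite mxE.
    by rewrite mulE; apply: eq_bigr => i _; rewrite mxE.
  case=> w [w01 w1] <-; exists (w 0); rewrite mulE -sumE; split=> // i.
  by have := w01 i; rewrite in_itv/= => /andP[].
apply: continuous_compact.
  by apply: continuous_subspaceT; exact: continuous_mulmx_row.
have -> : S = [set w : 'rV[R]_N | forall i, w 0 i \in `[0, 1]] `&`
    (fun w => (w *m const_mx 1 + 0 : 'rV[R]_1) 0 0) @^-1` [set 1].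
  by apply/seteqP; split=> w /= []; rewrite addr0.
apply: compact_closedI.
  have cI : compact [set w : 'rV[R]_N | forall i, w ord0 i \in `[0, 1]].
    by apply: (@rV_compact _ _ (fun=> `[(0 : R), 1]%classic)) => _;
      exact: segment_compact.
  exact: cI.
by apply: preimage_closed => [x _|]; [exact: continuous_row_form|exact: closed_eq].
Qed.

Lemma closed_hull n (s : seq 'rV[R]_n) : closed (hull s).
Proof. by apply: compact_closed; [exact: norm_hausdorff|exact: compact_hull]. Qed.

Lemma pl_compact n q (D : set 'rV[R]_n) (f : 'rV[R]_n -> 'rV[R]_q) :
  pl D f -> compact D.
Proof.
move=> [F -> _]; elim: F => [|s F IH].
  by rewrite (_ : \bigcup_(_ in _) _ = set0); [exact: compact0|
    apply/seteqP; split=> x // -[]].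
rewrite (_ : \bigcup_(_ in _) _ = hull s `|` \bigcup_(s in [set` F]) hull s).
  by apply: compactU => //; exact: compact_hull.
apply/seteqP; split=> x.
  by case=> t /=; rewrite inE => /orP[/eqP->|tF] hx; [left|right; exists t].
by case=> [hx|[t /= tF hx]]; [exists s|exists t] => //=; rewrite inE ?eqxx ?tF ?orbT.
Qed.

Lemma pl_continuous n q (D : set 'rV[R]_n) (f : 'rV[R]_n -> 'rV[R]_q) :
  pl D f -> {within D, continuous f}.
Proof.
case=> F DF aff.
have /choice[M /choice[b H]] s : exists M b, s \in F -> forall x, hull s x ->
    f x = x *m M + b.
  have [/aff[c [b H]]|//] := boolP (s \in F); first by exists c, b.
  by exists 0, 0.
apply: (@finite_paste _ _ _ _ _ _ F (@hull R n) (fun s x => x *m M s + b s)).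
- by move=> x; rewrite DF => -[s sF hx]; exists s.
- by move=> s _; exact: closed_hull.
- by move=> s _; exact: continuous_mulmx_row.
- by move=> s x sF _; exact: H.
Qed.

End piecewise_linear.

(** * One-dimensional complexes *)

Section complexes.
Variables (R : realType) (n : nat).
Implicit Types (a b v x y : 'rV[R]_n) (e : 'rV[R]_n * 'rV[R]_n) (s r : R).
Implicit Types E : seq ('rV[R]_n * 'rV[R]_n).

Definition edge_pt e s : 'rV[R]_n := (1 - s) *: e.1 + s *: e.2.

(** Two different edges meet at most in end points of both. In particular no edge is listed with
    both orientations. *)
Definition complex E : Prop :=
  (forall e, e \in E -> e.1 <> e.2) /\
  forall e e' s r, e \in E -> e' \in E -> 0 <= s <= 1 -> 0 <= r <= 1 ->
    edge_pt e s = edge_pt e' r ->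
    e = e' \/ (s = 0 \/ s = 1) /\ (r = 0 \/ r = 1).

Definition body E : set 'rV[R]_n :=
  [set x | exists e s, [/\ e \in E, 0 <= s <= 1 & x = edge_pt e s]].

Definition verts E := [seq e.1 | e <- E] ++ [seq e.2 | e <- E].

Lemma edge_pt0 e : edge_pt e 0 = e.1.
Proof. by rewrite /edge_pt subr0 scale1r scale0r addr0. Qed.

Lemma edge_pt1 e : edge_pt e 1 = e.2.
Proof. by rewrite /edge_pt subrr scale1r scale0r add0r. Qed.

Lemma edge_ptB e s r : edge_pt e s - edge_pt e r = (s - r) *: (e.2 - e.1).
Proof.
rewrite /edge_pt; apply/rowP => i; rewrite !mxE; ring.
Qed.

Lemma edge_pt_inj e s r : e.1 <> e.2 -> edge_pt e s = edge_pt e r -> s = r.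
Proof.
move=> e12 /eqP; rewrite -subr_eq0 edge_ptB scaler_eq0 !subr_eq0.
by case/orP => /eqP // e21; case: e12.
Qed.

Lemma sub_interval_in01 (s1 s2 r : R) : 0 <= s1 -> s1 < s2 -> s2 <= 1 ->
  0 <= r <= 1 -> 0 <= s1 + r * (s2 - s1) <= 1.
Proof.
move=> s10 s12 s21 /andP[r0 r1].
have : 0 <= r * (s2 - s1) by rewrite mulr_ge0// subr_ge0 ltW.
have : r * (s2 - s1) <= 1 * (s2 - s1) by rewrite ler_wpM2r// subr_ge0 ltW.
lra.
Qed.

Lemma edge_pt_sub e (s1 s2 r : R) :
  edge_pt (edge_pt e s1, edge_pt e s2) r = edge_pt e (s1 + r * (s2 - s1)).
Proof. by rewrite /edge_pt/=; apply/rowP => i; rewrite !mxE; ring. Qed.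

Lemma vertsP E x : complex E -> x \in verts E <->
  exists e s, [/\ e \in E, s = 0 \/ s = 1 & x = edge_pt e s].
Proof.
move=> _; rewrite mem_cat; split.
  case/orP => /mapP[e eE ->]; first by exists e, 0; rewrite edge_pt0; split=> //; left.
  by exists e, 1; rewrite edge_pt1; split=> //; right.
move=> [e [s [eE [->|->] ->]]]; rewrite ?edge_pt0 ?edge_pt1.
  by rewrite (map_f fst).
by rewrite (map_f snd)// orbT.
Qed.

Lemma verts_body E x : x \in verts E -> body E x.
Proof.
rewrite mem_cat => /orP[] /mapP[e eE ->].
  by exists e, 0; rewrite edge_pt0 lexx ler01.
by exists e, 1; rewrite edge_pt1 lexx ler01.
Qed.

Lemma verts_endpoint E x e s : complex E -> x \in verts E -> e \in E ->
  0 <= s <= 1 -> x = edge_pt e s -> s = 0 \/ s = 1.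
Proof.
move=> cE /(vertsP _ cE)[e' [r [e'E r01 ->]]] eE s01 ee'.
have r01' : 0 <= r <= 1 by case: r01 => ->; rewrite lexx ler01.
have [h|[_ ?]//] := cE.2 e' e r s e'E eE r01' s01 ee'.
by move: ee'; rewrite h => /(edge_pt_inj (cE.1 e eE)) <-.
Qed.

(* [interp E P] is the map that is affine on the edges of [E] and equal to [P]
   at the vertices. *)
Definition interp (W : lmodType R) E (P : 'rV[R]_n -> W) x : W :=
  let es := xget ((0, 0), 0)
    [set es | [/\ es.1 \in E, 0 <= es.2 <= 1 & x = edge_pt es.1 es.2]] in
  (1 - es.2) *: P es.1.1 + es.2 *: P es.1.2.

(** A vertex lies on several edges and [xget] may pick any of them; the value is that of [P] at the
    vertex in all cases. At other points the edge and the parameter are determined. *)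
Lemma interpE (W : lmodType R) E (P : 'rV[R]_n -> W) e s :
  complex E -> e \in E -> 0 <= s <= 1 ->
  interp E P (edge_pt e s) = (1 - s) *: P e.1 + s *: P e.2.
Proof.
move=> cE eE s01; rewrite /interp; case: xgetP => /= [[e' r] _ /= [e'E r01 ee']|].
  have [h|[s_ r_]] := cE.2 e e' s r eE e'E s01 r01 ee'.
    by move: ee'; rewrite -h => /(edge_pt_inj (cE.1 e eE)) <-.
  move: ee'; case: s_ => ->; case: r_ => ->; rewrite ?edge_pt0 ?edge_pt1 => ->;
  by rewrite ?subr0 ?subrr ?scale1r ?scale0r ?addr0 ?add0r.
by move=> /(_ (e, s)) /= [].
Qed.

Lemma interp_vert (W : lmodType R) E (P : 'rV[R]_n -> W) x :
  complex E -> x \in verts E -> interp E P x = P x.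
Proof.
move=> cE /(vertsP _ cE)[e [s [eE s01 ->]]]; rewrite interpE//; last first.
  by case: s01 => ->; rewrite lexx ler01.
by case: s01 => ->; rewrite ?edge_pt0 ?edge_pt1 ?subr0 ?subrr ?scale1r ?scale0r
  ?addr0 ?add0r.
Qed.

Lemma eq_interp (W : lmodType R) E (P Q : 'rV[R]_n -> W) x : complex E ->
  (forall v, v \in verts E -> P v = Q v) -> body E x ->
  interp E P x = interp E Q x.
Proof.
move=> cE PQ [e [s [eE s01 ->]]]; rewrite !interpE// !PQ//.
  by rewrite mem_cat (map_f snd) ?orbT.
by rewrite mem_cat (map_f fst).
Qed.

Definition affine_on E q (f : 'rV[R]_n -> 'rV[R]_q) : Prop :=
  forall e s, e \in E -> 0 <= s <= 1 ->
    f (edge_pt e s) = (1 - s) *: f e.1 + s *: f e.2.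

Lemma affine_on_interp E q (f : 'rV[R]_n -> 'rV[R]_q) x :
  complex E -> affine_on E f -> body E x -> interp E f x = f x.
Proof. by move=> cE fE [e [s [eE s01 ->]]]; rewrite interpE// fE. Qed.

Definition refines E E' : Prop :=
  [/\ complex E', body E' = body E, {subset verts E <= verts E'} &
    forall e', e' \in E' -> exists e s1 s2,
      [/\ e \in E, 0 <= s1, s1 < s2, s2 <= 1 &
          e' = (edge_pt e s1, edge_pt e s2)]].

Lemma refines_refl E : complex E -> refines E E.
Proof.
move=> cE; split=> // e eE; exists e, 0, 1; rewrite edge_pt0 edge_pt1.
by split=> //; case: e eE.
Qed.

Lemma refines_trans E1 E2 E3 : refines E1 E2 -> refines E2 E3 -> refines E1 E3.
Proof.
move=> [c2 b2 v2 e2] [c3 b3 v3 e3]; split=> //; first by rewrite b3.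
  by move=> x /v2/v3.
move=> e' /e3[e [s1 [s2 [/e2[d [r1 [r2 [dE r10 r12 r21 ->]]]] s10 s12 s21 ->]]]].
rewrite !edge_pt_sub; exists d, (r1 + s1 * (r2 - r1)), (r1 + s2 * (r2 - r1)).
split=> //.
- by rewrite addr_ge0// mulr_ge0// subr_ge0 ltW.
- by rewrite ltrD2l ltr_pM2r// subr_gt0.
- have : s2 * (r2 - r1) <= 1 * (r2 - r1) by rewrite ler_wpM2r// subr_ge0 ltW.
  by lra.
Qed.

Lemma affine_on_refines E E' q (f : 'rV[R]_n -> 'rV[R]_q) :
  refines E E' -> affine_on E f -> affine_on E' f.
Proof.
move=> [_ _ _ H] fE e' s /H[e [s1 [s2 [eE s10 s12 s21 ->]]]] s01.
have h := sub_interval_in01 s10 s12 s21 s01.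
rewrite edge_pt_sub/= !fE//; last 2 first.
  by lra.
  by lra.
by apply/rowP => i; rewrite !mxE; ring.
Qed.

Lemma subdiv_point E x : complex E -> body E x ->
  exists2 E', refines E E' & x \in verts E'.
Proof.
move=> cE [e [s [eE s01 xe]]].
have [xV|xV] := boolP (x \in verts E); first by exists E => //; exact: refines_refl.
have s0 : 0 < s.
  rewrite lt_def; case/andP: s01 => -> _; rewrite andbT; apply: contraNneq xV => s0.
  by rewrite xe s0 edge_pt0 mem_cat (map_f fst).
have s1 : s < 1.
  rewrite lt_def; case/andP: s01 => _ ->; rewrite andbT; apply: contraNneq xV => s1.
  by rewrite xe -s1 edge_pt1 mem_cat (map_f snd) ?orbT.
have H0 (r : R) : 0 + r * (1 - 0) = r by ring.
have z1 (r : R) : 0 + r * (s - 0) = 0 -> r = 0.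
  by rewrite add0r subr0 => /eqP; rewrite mulf_eq0 (gt_eqF s0) orbF => /eqP.
have z2 (r : R) : s + r * (1 - s) = 1 -> r = 1.
  move=> h; have /eqP : (r - 1) * (1 - s) = 0 by rewrite mulrBl; lra.
  by rewrite mulf_eq0 !subr_eq0 (gt_eqF s1) orbF => /eqP.
have mul_le (r q : R) : 0 <= r <= 1 -> 0 < q -> 0 <= r * q <= q.
  by move=> /andP[r0 r1] q0; rewrite mulr_ge0 ?(ltW q0)// ger_pMl.
have nz1 (r : R) : 0 <= r <= 1 -> 0 + r * (s - 0) = 1 -> False.
  by move=> /mul_le/(_ s0); lra.
have nz2 (r : R) : 0 <= r <= 1 -> s + r * (1 - s) = 0 -> False.
  by rewrite -subr_gt0 in s1; move=> /mul_le/(_ s1); lra.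
have z3 (r q : R) : 0 <= r <= 1 -> 0 <= q <= 1 ->
    0 + r * (s - 0) = s + q * (1 - s) -> r = 1 /\ q = 0.
  move=> r01 q01; have s1' : 0 < 1 - s by rewrite subr_gt0.
  move=> h; have [h1 h2] : (r - 1) * s = 0 /\ q * (1 - s) = 0.
    by have := mul_le _ _ r01 s0; have := mul_le _ _ q01 s1'; split; lra.
  move/eqP: h1; move/eqP: h2; rewrite !mulf_eq0 !(gt_eqF s0, gt_eqF s1') !orbF.
  by rewrite subr_eq0 => /eqP-> /eqP->.
pose E1 := [seq e' <- E | e' != e].
pose E' := (e.1, x) :: (x, e.2) :: E1.
(* Every new edge is a parameter interval [[t1, t2]] of an old one. A common point of two new edges
   is therefore a common point of old ones, and all cases reduce to arithmetic of parameters. *)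
have sub e' : e' \in E' -> exists d t1 t2,
    [/\ d \in E, 0 <= t1, t1 < t2, t2 <= 1 & e' = (edge_pt d t1, edge_pt d t2)] /\
    [\/ [/\ d = e, t1 = 0, t2 = s & e' = (e.1, x)],
        [/\ d = e, t1 = s, t2 = 1 & e' = (x, e.2)] |
        [/\ d != e, t1 = 0, t2 = 1 & e' = d]].
  rewrite !inE => /orP[/eqP->|/orP[/eqP->|]].
  - exists e, 0, s; split; first by rewrite edge_pt0 -xe; split=> //; exact: ltW.
    by constructor 1.
  - exists e, s, 1; split; first by rewrite edge_pt1 -xe; split=> //; exact: ltW.
    by constructor 2.
  - rewrite mem_filter => /andP[ne e'E]; exists e', 0, 1; split; last by constructor 3.
    by rewrite edge_pt0 edge_pt1; split=> //; case: (e').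
have cE' : complex E'.
  split=> [e' /sub[d [t1 [t2 [[dE _ t12 _ ->] _]]]]|e1 e2 r1 r2].
    by move=> /= /(edge_pt_inj (cE.1 d dE)) t; rewrite t ltxx in t12.
  move=> /sub[d1 [t1 [t2 [[dE t10 t12 t21 E1E] c1]]]].
  move=> /sub[d2 [u1 [u2 [[d2E u10 u12 u21 E2E] c2]]]].
  move=> r1_01 r2_01; rewrite {1}E1E {1}E2E !edge_pt_sub => ee.
  have := cE.2 _ _ _ _ dE d2E (sub_interval_in01 t10 t12 t21 r1_01)
    (sub_interval_in01 u10 u12 u21 r2_01) ee.
  case: c1 => -[d1e t1e t2e e1E]; case: c2 => -[d2e u1e u2e e2E];
    move: ee; rewrite e1E e2E t1e t2e u1e u2e ?d1e ?d2e.
  - by left.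
  - move=> /(edge_pt_inj (cE.1 e eE))/(z3 _ _ r1_01 r2_01)[-> ->] _.
    by right; split; [right|left].
  - move=> _ [h|[h1 h2]]; first by rewrite -h eqxx in d2e.
    right; split; last by move: h2; rewrite !H0.
    by case: h1 => [/z1|/(nz1 _ r1_01)[]]; left.
  - move=> /(edge_pt_inj (cE.1 e eE))/esym/(z3 _ _ r2_01 r1_01)[-> ->] _.
    by right; split; [left|right].
  - by left.
  - move=> _ [h|[h1 h2]]; first by rewrite -h eqxx in d2e.
    right; split; last by move: h2; rewrite !H0.
    by case: h1 => [/(nz2 _ r1_01)[]|/z2]; right.
  - move=> _ [h|[h1 h2]]; first by rewrite h eqxx in d1e.
    right; split; first by move: h1; rewrite !H0.
    by case: h2 => [/z1|/(nz1 _ r2_01)[]]; left.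
  - move=> _ [h|[h1 h2]]; first by rewrite h eqxx in d1e.
    right; split; first by move: h1; rewrite !H0.
    by case: h2 => [/(nz2 _ r2_01)[]|/z2]; right.
  - by move=> _; rewrite !H0.
exists E'; last by rewrite mem_cat !inE eqxx orbT.
split=> //.
- apply/seteqP; split=> y.
    move=> [e' [r [/sub[d [t1 [t2 [[dE t10 t12 t21 ->] _]]]] r01 ->]]].
    rewrite edge_pt_sub; exists d, (t1 + r * (t2 - t1)); split=> //.
    exact: sub_interval_in01.
  move=> [d [r [dE /andP[r0 r1] ->]]]; have [de|de] := eqVneq d e; last first.
    by exists d, r; rewrite !inE mem_filter de dE !orbT r0 r1.
  rewrite de; have [rs|sr] := leP r s.
    exists (e.1, x), (r / s); rewrite mem_head; split=> //.
      by rewrite divr_ge0 ?(ltW s0)//= ler_pdivrMr// mul1r.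
    rewrite xe -(edge_pt0 e) edge_pt_sub subr0 add0r divfK//.
    by rewrite gt_eqF.
  exists (x, e.2), ((r - s) / (1 - s)); rewrite !inE eqxx orbT; split=> //.
    rewrite divr_ge0 ?ler_pdivrMr ?subr_gt0 ?subr_ge0 ?(ltW sr) ?(ltW s1)//=.
    by rewrite mul1r; lra.
  rewrite xe -(edge_pt1 e) edge_pt_sub divfK; first by rewrite addrC subrK.
  by rewrite subr_eq0 gt_eqF.
- move=> v; rewrite !mem_cat => /orP[] /mapP[d dE ->].
    have [->|de] := eqVneq d e; first by rewrite mem_head.
    by rewrite (map_f fst) ?orTb// !inE mem_filter de dE !orbT.
  have [->|de] := eqVneq d e; first by rewrite !inE eqxx !orbT.
  by rewrite (map_f snd) ?orbT// !inE mem_filter de dE !orbT.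
- by move=> e' /sub[d [t1 [t2 [H _]]]]; exists d, t1, t2.
Qed.

Lemma subdiv_points E (B : seq 'rV[R]_n) : complex E ->
  (forall x, x \in B -> body E x) ->
  exists2 E', refines E E' & {subset B <= verts E'}.
Proof.
move=> cE; elim: B => [|x B IH] H; first by exists E => //; exact: refines_refl.
have [|E1 r1 B1] := IH; first by move=> y yB; apply: H; rewrite inE yB orbT.
have [c1 b1 _ _] := r1.
have [|E2 r2 xE2] := @subdiv_point E1 x c1; first by rewrite b1; apply/H/mem_head.
exists E2; first exact: refines_trans r2.
have [_ _ v2 _] := r2.
by move=> y; rewrite inE => /orP[/eqP->//|/B1/v2].
Qed.

(** This is how prescribed subdivision points restrict the edges: a vertex is never interior to an
    edge, so the parameter interval of a new edge has no point of [B] inside. *)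
Lemma refines_edge E E' (B : seq 'rV[R]_n) e' : refines E E' ->
  {subset B <= verts E'} -> e' \in E' -> exists e s1 s2,
  [/\ e \in E, 0 <= s1, s1 < s2, s2 <= 1 & e' = (edge_pt e s1, edge_pt e s2)] /\
  (forall r, s1 < r < s2 -> edge_pt e r \notin B).
Proof.
move=> [cE' _ _ H] BE' e'E; have [e [s1 [s2 [eE s10 s12 s21 e'E']]]] := H _ e'E.
exists e, s1, s2; split=> // r /andP[s1r rs2]; apply/negP => /BE' rV.
have s12' : 0 < s2 - s1 by rewrite subr_gt0.
pose t := (r - s1) / (s2 - s1).
have tE : edge_pt e r = edge_pt e' t.
  rewrite e'E' edge_pt_sub /t divfK ?gt_eqF//; congr edge_pt; ring.
have t01 : 0 < t < 1.
  by rewrite /t divr_gt0 ?ltr_pdivrMr//=; lra.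
have [||] := verts_endpoint cE' rV e'E _ tE; lra.
Qed.

End complexes.

(** * Subdivisions adapted to a mesh size and to a PL map *)

Section refinement.
Variables (R : realType) (n : nat).
Implicit Types E : seq ('rV[R]_n * 'rV[R]_n).

Lemma mesh_refinement E (d : R) : complex E -> 0 < d ->
  exists2 E', refines E E' & forall e, e \in E' -> `|e.1 - e.2| < d.
Proof.
move=> cE d0.
pose C := \sum_(e <- E) `|e.2 - e.1|.
have HC e : e \in E -> `|e.2 - e.1| <= C.
  by move=> eE; rewrite /C (big_rem e)//= lerDl sumr_ge0.
have C0 : 0 <= C by rewrite sumr_ge0.
pose M := (Num.truncn (C / d)).+1.
have M0 : 0 < M%:R :> R by rewrite ltr0n.
have CM : C / M%:R < d.
  rewrite ltr_pdivrMr// mulrC -ltr_pdivrMr//.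
  by have /truncn_itv/andP[] : 0 <= C / d by rewrite divr_ge0// ltW.
have [L HL] : exists L : seq nat, forall k, (k \in L) = (k <= M)%N.
  by exists (iota 0 M.+1) => k; rewrite mem_iota.
pose B := [seq edge_pt e (k%:R / M%:R) | e <- E, k <- L].
have [|E' rE BE'] := @subdiv_points R n E B cE.
  move=> _ /allpairsP[[e k] /= [eE + ->]]; rewrite HL => kM.
  exists e, (k%:R / M%:R); split=> //.
  by rewrite divr_ge0//= ler_pdivrMr// mul1r ler_nat.
exists E' => // _ /(refines_edge rE BE')[e [s1 [s2 [[eE s10 s12 s21 ->] HB]]]] /=.
rewrite edge_ptB normrZ distrC gtr0_norm ?subr_gt0//.
rewrite (le_lt_trans _ CM)// mulrC ler_pM ?HC ?subr_ge0 ?(ltW s12)//.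
rewrite leNgt; apply/negP => lt.
(* The first multiple of [1 / M] beyond [s1] would lie strictly inside an edge that is too long,
   although it is a subdivision point. *)
have Ms0 : 0 <= s1 * M%:R by rewrite mulr_ge0// ltW.
have /andP[t1 t2] := truncn_itv Ms0.
set k := Num.truncn (s1 * M%:R) in t1 t2.
have k1 : s1 < k.+1%:R / M%:R by rewrite ltr_pdivlMr.
have k2 : k.+1%:R / M%:R < s2.
  have : k.+1%:R / M%:R <= s1 + M%:R^-1.
    rewrite ler_pdivrMr// mulrDl mulVf ?gt_eqF// -natr1; lra.
  by lra.
move: (HB (k.+1%:R / M%:R)); rewrite k1 k2 => /(_ isT)/negP; apply.
apply/allpairsP; exists (e, k.+1); split=> //=.
rewrite HL.
have : k.+1%:R / M%:R <= 1 :> R by lra.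
by rewrite ler_pdivrMr// mul1r ler_nat.
Qed.

(** The parameters at which an edge lies in a given polytope form a compact interval, whose ends
    become vertices. The midpoint of a new edge lies in some polytope; as the ends of the interval
    of this polytope are not inside the new edge, the whole new edge lies in it. *)
Lemma pl_refinement E q (f : 'rV[R]_n -> 'rV[R]_q) : complex E ->
  pl (body E) f -> exists2 E', refines E E' & affine_on E' f.
Proof.
move=> cE [F EF aff].
pose I (es : ('rV[R]_n * 'rV[R]_n) * seq 'rV[R]_n) : set R :=
  `[0, 1]%classic `&` (edge_pt es.1 @^-1` hull es.2).
have /choice[lu Hlu] es : exists lu : R * R, [/\ 0 <= lu.1 <= 1, 0 <= lu.2 <= 1 &
    I es !=set0 -> [/\ I es lu.1, I es lu.2 & forall r, I es r -> lu.1 <= r <= lu.2]].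
  have [ne|] := pselect (I es !=set0); last first.
    by move=> ne; exists (0, 0); rewrite lexx ler01; split.
  have cI : compact (I es).
    apply: compact_closedI; first exact: segment_compact.
    apply: preimage_closed => [x _|]; last exact: closed_hull.
    rewrite /edge_pt; apply: cvgD; apply: cvgZr_tmp => //.
      by apply: cvgB; [exact: cvg_cst|exact: cvg_id].
  have ci : {within I es, continuous (id : R -> R)}.
    by apply: continuous_subspaceT => x.
  have [l lI Hl] := compact_EVT_min ne cI ci.
  have [u uI Hu] := compact_EVT_max ne cI ci.
  rewrite !inE in lI uI.
  have I01 r : I es r -> 0 <= r <= 1 by case; rewrite /= in_itv.
  exists (l, u); split; [exact: I01|exact: I01|move=> _; split=> // r rI].
  by rewrite /= Hl ?Hu// inE.
pose B := [seq edge_pt es.1 (lu es).1 | es <- [seq (e, s) | e <- E, s <- F]] ++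
          [seq edge_pt es.1 (lu es).2 | es <- [seq (e, s) | e <- E, s <- F]].
have [|E' rE BE'] := @subdiv_points R n E B cE.
  move=> x; rewrite mem_cat => /orP[] /mapP[_ /allpairsP[[e s] /= [eE sF ->]] ->].
    by exists e, (lu (e, s)).1; split=> //; have [] := Hlu (e, s).
  by exists e, (lu (e, s)).2; split=> //; have [] := Hlu (e, s).
exists E' => // e' r /(refines_edge rE BE')[e [s1 [s2 [[eE s10 s12 s21 ->] HB]]]] /andP[r0 r1].
rewrite edge_pt_sub /=.
pose mid := (s1 + s2) / 2.
have : body E (edge_pt e mid) by exists e, mid; split=> //; rewrite /mid; lra.
rewrite EF => -[s sF Hmid].
have Imid : I (e, s) mid by split=> //=; rewrite in_itv/= /mid; lra.
have [_ _ /(_ (ex_intro _ mid Imid))[[/= l01 Il] [/= u01 Iu] Hr]] := Hlu (e, s).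
have /andP[lm mu] := Hr mid Imid.
set l := (lu (e, s)).1 in l01 Il lm Hr; set u := (lu (e, s)).2 in u01 Iu mu Hr.
have l1 : l <= s1.
  rewrite leNgt; apply/negP => lt.
  have /HB/negP : s1 < l < s2 by rewrite lt/= /mid in lm *; lra.
  apply; rewrite mem_cat; apply/orP; left; apply/mapP; exists (e, s) => //.
  by apply/allpairsP; exists (e, s).
have u2 : s2 <= u.
  rewrite leNgt; apply/negP => lt.
  have /HB/negP : s1 < u < s2 by rewrite lt andbT; move: mu; rewrite /mid; lra.
  apply; rewrite mem_cat; apply/orP; right; apply/mapP; exists (e, s) => //.
  by apply/allpairsP; exists (e, s).
have ul : 0 < u - l by lra.
have inh t : s1 <= t -> t <= s2 -> hull s (edge_pt e t).
  move=> t1 t2; have -> : edge_pt e t = edge_pt (edge_pt e l, edge_pt e u) ((t - l) / (u - l)).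
    by rewrite edge_pt_sub divfK ?gt_eqF// addrC subrK.
  apply: hull_segment => //.
  - by rewrite subr_ge0 ler_pdivrMr// mul1r; lra.
  - by rewrite divr_ge0//; lra.
  - by rewrite subrK.
have [M [b H]] := aff s sF.
have rs : 0 <= r * (s2 - s1) <= s2 - s1.
  have s12' : 0 <= s2 - s1 by lra.
  by rewrite mulr_ge0//= -[leRHS]mul1r ler_wpM2r.
have [t1 t2] : s1 <= s1 + r * (s2 - s1) /\ s1 + r * (s2 - s1) <= s2 by split; lra.
rewrite !H; try by apply: inh; rewrite ?lexx// ltW.
rewrite -edge_pt_sub {1}/edge_pt/= mulmxDl -!scalemxAl.
by apply/rowP => i; rewrite !mxE; ring.
Qed.

End refinement.

(** * Moving one vertex *)

Section slide.
Variables (R : realType) (n q : nat).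
Implicit Types (E : seq ('rV[R]_n * 'rV[R]_n)) (P : 'rV[R]_n -> 'rV[R]_q).

(* The points move in the direction [w]: [x] starts at time [theta x], moves at
   unit speed and stops after it has covered [h x]. *)
Definition slide E P (theta h : 'rV[R]_n -> R^o) (w : 'rV[R]_q) (t : R)
    (x : 'rV[R]_n) : 'rV[R]_q :=
  interp E P x +
  (Num.max 0 (Num.min (t - interp E theta x) (interp E h x)) : R) *: w.

(** Orthogonal projection to the line of the edge: [c] is the direction divided by its squared
    Euclidean length [N]. It turns formulas in the edge parameter into functions of the point. *)
Lemma edge_param (e : 'rV[R]_n * 'rV[R]_n) : e.1 <> e.2 ->
  exists (c : 'cV[R]_n) (b : R), forall s, (edge_pt e s *m c) 0 0 + b = s.
Proof.
move=> e12; pose u := e.2 - e.1; pose N := (u *m u^T) 0 0.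
have N0 : N != 0.
  rewrite /N mxE; under eq_bigr do rewrite [u^T _ _]mxE -expr2.
  rewrite psumr_eq0; last by move=> i _; exact: sqr_ge0.
  apply/negP => /allP H; apply: e12; apply/esym/eqP; rewrite -subr_eq0.
  apply/eqP/rowP => i; rewrite [RHS]mxE; apply/eqP; rewrite -sqrf_eq0.
  by have := H i; rewrite mem_index_enum => /(_ isT).
exists (N^-1 *: u^T), (- (e.1 *m (N^-1 *: u^T)) 0 0) => s.
have -> : edge_pt e s = e.1 + s *: u.
  by rewrite /edge_pt /u; apply/rowP => i; rewrite !mxE; ring.
rewrite mulmxDl mxE addrAC subrr add0r -scalemxAl -scalemxAr scalerA mxE.
by rewrite -/N -mulrA mulVf// mulr1.
Qed.

Lemma hull_edge_cylinder (e : 'rV[R]_n * 'rV[R]_n) :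
  hull [:: row_mx e.1 0; row_mx e.2 0; row_mx e.1 1%:M; row_mx e.2 1%:M] =
  [set z : 'rV[R]_(n + 1) | exists s t : R,
    [/\ 0 <= s <= 1, 0 <= t <= 1 & z = row_mx (edge_pt e s) t%:M]].
Proof.
set l := [:: _; _; _; _].
apply/seteqP; split=> z.
  case=> w [w0 w1 ->]; move: w1.
  rewrite !big_ord_recl !big_ord0 /= !addr0.
  set a := w _; set b := w _; set c := w _; set d := w _ => w1.
  have a0 : 0 <= a by exact: w0.
  have b0 : 0 <= b by exact: w0.
  have c0 : 0 <= c by exact: w0.
  have d0 : 0 <= d by exact: w0.
  exists (b + d), (c + d); split; [lra|lra|].
  have -> : (c + d)%:M = c *: 1%:M + d *: 1%:M :> 'rV[R]_1.
    by rewrite -scalerDl scale_scalar_mx mulr1.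
  rewrite !scale_row_mx !add_row_mx !scaler0 !add0r; congr row_mx.
  have -> : b + d = 1 - (a + c) by lra.
  rewrite /edge_pt (_ : 1 - (1 - (a + c)) = a + c); last by ring.
  rewrite (_ : 1 - (a + c) = b + d); last by lra.
  by apply/rowP => i; rewrite !mxE; ring.
move=> [s [t [s01 t01 ->]]].
have -> : row_mx (edge_pt e s) t%:M =
    (1 - t) *: ((1 - s) *: row_mx e.1 0 + s *: row_mx e.2 0) +
    t *: ((1 - s) *: row_mx e.1 1%:M + s *: row_mx e.2 1%:M) :> 'rV[R]_(n + 1).
  rewrite !scale_row_mx !add_row_mx !scale_row_mx !add_row_mx; congr row_mx.
    by rewrite /edge_pt; apply/rowP => i; rewrite !mxE; ring.
  by apply/rowP => i; rewrite ord1 !mxE eqxx; ring.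
apply: hull_segment; try lra; apply: hull_segment; try lra.
all: by apply: hull_mem; rewrite !inE eqxx ?orbT.
Qed.

(** On the prism over an edge, the starting time and the total distance are affine in the edge
    parameter, so the position arises from affine functions of point and time by linear operations,
    minimum and maximum. *)
Lemma pl_slide E P theta h w : complex E ->
  pl (cylinder (body E)) (on_cylinder (slide E P theta h w)).
Proof.
move=> cE.
have -> : cylinder (body E) = \bigcup_(e in [set` E])
    hull [:: row_mx e.1 0; row_mx e.2 0; row_mx e.1 1%:M; row_mx e.2 1%:M].
  apply/seteqP; split=> z.
    case=> -[e [s [eE s01 zs]]] t01; exists e => //; rewrite hull_edge_cylinder.
    exists s, (rsubmx z 0 0); split=> //.
    by rewrite -zs -rV1P hsubmxK.
  case=> e /= eE; rewrite hull_edge_cylinder => -[s [t [s01 t01 ->]]].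
  rewrite /cylinder/= row_mxKl row_mxKr mxE eqxx mulr1n; split=> //.
  by exists e, s.
apply: pl_bigcup => e /= eE; have [c [b Hcb]] := edge_param (cE.1 e eE).
pose s (z : 'rV[R]_(n + 1)) : R := (z *m col_mx c 0) 0 0 + b.
have ps : pwls s by exact: pwls_affine.
have pt : pwls (fun z : 'rV[R]_(n + 1) => z 0 (rshift n 0)) by exact: pwls_coord.
pose lin (u : 'rV[R]_n -> R^o) z : R := (u e.2 - u e.1) * s z + u e.1.
have plin u : pwls (lin u).
  by apply: pwls_add; [exact: pwls_mull|exact: pwls_cst].
pose g z := s z *: (P e.2 - P e.1) + (P e.1 +
  Num.max 0 (Num.min (z 0 (rshift n 0) - lin theta z) (lin h z)) *: w).
apply: (@pl_hull _ _ _ _ _ g).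
  apply: pwl_add; first exact: pwl_scale.
  apply: pwl_add.
    by have := pwl_affine (0 : 'M[R]_(n + 1, q)) (P e.1);
      apply: eq_pwl => z; rewrite mulmx0 add0r.
  apply/pwl_scale/pwls_max; first exact: pwls_cst.
  by apply: pwls_min => //; apply: pwls_add => //; exact: pwls_opp.
move=> z; rewrite hull_edge_cylinder => -[r [t [r01 t01 ->]]].
rewrite /on_cylinder row_mxKl row_mxKr /g /slide mxE eqxx mulr1n.
have sz : s (row_mx (edge_pt e r) t%:M) = r.
  by rewrite /s mul_row_col mulmx0 addr0 Hcb.
rewrite /lin !sz row_mxEr mxE eqxx mulr1n !interpE// addrA; congr (_ + _ *: _).
  by apply/rowP => i; rewrite !mxE; ring.
congr (Num.max 0 (Num.min (t - _) _)); rewrite /GRing.scale/=; ring.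
Qed.

End slide.

(** * General position *)

Lemma real_notin (R : realType) (s : seq R) (e : R) : 0 < e ->
  exists2 d, 0 < d < e & d \notin s.
Proof.
elim: s e => [|r s IH] e e0; first by exists (e / 2) => //; lra.
have [d /andP[d0 de] ds] := IH e e0.
have [rd|rd] := eqVneq r d; last by exists d; rewrite ?d0// inE negb_or eq_sym rd.
have [d' /andP[d'0 d'd] d's] := IH d d0.
exists d'; first by rewrite d'0 (lt_trans d'd).
by rewrite inE negb_or d's rd lt_eqF.
Qed.

(** An affine function that is not identically zero on a line has at most one zero there. From [x],
    a small step towards a witness [y] for [i] keeps the earlier functions nonzero and makes [f i]
    nonzero, with finitely many exceptions. Openness of [N] is expressed along segments, since [V]
    has no topology: the lemma serves for points of R^3 and for the delays, which form a space of
    functions. *)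
Lemma avoid_zeros (R : realType) (V : lmodType R) (I : eqType) (s : seq I)
    (f : I -> V -> R) (N : V -> Prop) (x0 : V) :
  (forall i, i \in s -> forall x y d,
    f i (x + d *: (y - x)) = f i x + d * (f i y - f i x)) ->
  (forall i, i \in s -> exists y, f i y != 0) ->
  (forall x y, N x -> exists2 e : R, 0 < e & forall d, 0 < d < e ->
    N (x + d *: (y - x))) ->
  N x0 -> exists2 x, N x & forall i, i \in s -> f i x != 0.
Proof.
move=> + + Nopen Nx0; elim: s => [|i s IH] aff wit; first by exists x0.
have [j js|j js|x Nx Hx] := IH; first by apply: aff; rewrite inE js orbT.
  by apply: wit; rewrite inE js orbT.
have [y fy] := wit i (mem_head _ _).
have [e e0 He] := Nopen x y Nx.
pose bad j := - f j x / (f j y - f j x).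
have key j (d : R) : j \in i :: s -> f j x != 0 \/ f j y != 0 -> d != 0 ->
    d != bad j -> f j (x + d *: (y - x)) != 0.
  move=> js xy d0 db; rewrite aff//; have [fxy|fxy] := eqVneq (f j y) (f j x).
    by rewrite fxy subrr mulr0 addr0; move: xy; rewrite fxy; case.
  apply: contraNneq db => h; rewrite /bad.
  have E : d * (f j y - f j x) = - f j x.
    by apply/eqP; rewrite -addr_eq0 addrC h.
  by apply/eqP/(canRL (mulfK _) E); rewrite subr_eq0.
have [d /andP[d0 de] dbad] := real_notin [seq bad j | j <- i :: s] e0.
exists (x + d *: (y - x)); first by apply: He; rewrite d0.
move=> j js; apply: key => //; last 2 first.
- by rewrite gt_eqF.
- by apply: contraNneq dbad => ->; exact: map_f.
by move: js; rewrite inE => /orP[/eqP->|/Hx]; [right|left].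
Qed.

Lemma common_kernel_form (R : fieldType) (u v : 'rV[R]_3) :
  exists l : 'cV[R]_3, [/\ l != 0, u *m l = 0 & v *m l = 0].
Proof.
pose A := col_mx u v.
have /rowV0Pn[r /sub_kermxP rA r0] : kermx A^T != 0.
  rewrite -mxrank_eq0 mxrank_ker mxrank_tr subn_eq0 -ltnNge.
  by rewrite (leq_ltn_trans (rank_leq_row A)).
exists r^T; split; first by rewrite -(inj_eq (@trmx_inj _ _ _)) trmxK trmx0.
  have := congr1 trmx rA; rewrite trmx_mul trmxK trmx0 mul_col_mx.
  by move/(congr1 usubmx); rewrite col_mxKu linear0.
have := congr1 trmx rA; rewrite trmx_mul trmxK trmx0 mul_col_mx.
by move/(congr1 dsubmx); rewrite col_mxKd linear0.
Qed.

(* The position [y] of a moved vertex is off the planes spanned by the other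
   vertices and off the planes that contain a vertex and the directions of two
   segments between vertices. *)
Definition generic_position (R : realType) (n : nat) (S : seq 'rV[R]_n)
    (P : 'rV[R]_n -> 'rV[R]_3) (y : 'rV[R]_3) : Prop :=
  forall a b c d, a \in S -> b \in S -> c \in S -> d \in S ->
  exists l : 'cV[R]_3, [/\ (P b - P a) *m l = 0, (P c - P d) *m l = 0 &
    ((y - P a) *m l) 0 0 != 0].

(** The conditions for both maps are that finitely many affine forms do not vanish, so one [y]
    serves [P0] and [P1]. Each form is nonzero at [P a] plus a basis vector on which its linear part
    is nonzero. *)
Lemma exists_generic_position (R : realType) (n : nat) (S : seq 'rV[R]_n)
    (P0 P1 : 'rV[R]_n -> 'rV[R]_3) (y0 : 'rV[R]_3) (e : R) :
  `|y0| <= 1 -> 0 < e ->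
  exists y, [/\ `|y - y0| < e, `|y| < 1,
    generic_position S P0 y & generic_position S P1 y].
Proof.
move=> y01 e0.
pose I := (bool * (('rV[R]_n * 'rV[R]_n) * ('rV[R]_n * 'rV[R]_n)))%type.
pose P (b : bool) := if b then P0 else P1.
have /choice[l Hl] (i : I) := common_kernel_form
  (P i.1 i.2.1.2 - P i.1 i.2.1.1) (P i.1 i.2.2.1 - P i.1 i.2.2.2).
pose SS := [seq (a, b) | a <- S, b <- S].
pose s : seq I := [seq (b, abcd) | b <- [:: true; false],
  abcd <- [seq (ab, cd) | ab <- SS, cd <- SS]].
pose N y := `|y - y0| < e /\ `|y| < 1.
have Nopen x y : N x -> exists2 e : R, 0 < e & forall d, 0 < d < e ->
    N (x + d *: (y - x)).
  move=> [x1 x2]; pose c := 1 + `|y - x|.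
  have c0 : 0 < c by rewrite ltr_pwDl.
  have yxc : `|y - x| < c by rewrite /c; lra.
  exists (Num.min ((e - `|x - y0|) / c) ((1 - `|x|) / c)).
    by rewrite lt_min !divr_gt0// subr_gt0.
  move=> d /andP[d0]; rewrite lt_min !ltr_pdivlMr// => /andP[h1 h2].
  have dn : `|d *: (y - x)| <= d * c.
    by rewrite normrZ gtr0_norm// ler_wpM2l// ltW.
  split; last by have := ler_normD x (d *: (y - x)); lra.
  have := ler_normD (x - y0) (d *: (y - x)); rewrite addrAC; lra.
(* The point [y0] may lie on the boundary of the cube. It is first pulled towards the centre, by
   less than [e], to meet the strict bound on the norm. *)
pose y1 := (1 - Num.min (e / 2) (1 / 2)) *: y0.
have Ny1 : N y1.
  have m0 : 0 < Num.min (e / 2) (1 / 2) by rewrite lt_min; apply/andP; split; lra.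
  have m1 : Num.min (e / 2) (1 / 2) <= e / 2 by rewrite ge_min lexx.
  have m2 : Num.min (e / 2) (1 / 2) <= 1 / 2 by rewrite ge_min lexx orbT.
  rewrite /y1; set mm := Num.min _ _ in m0 m1 m2 *; split.
    rewrite scalerBl scale1r addrAC subrr add0r normrN normrZ gtr0_norm//.
    by rewrite (@le_lt_trans _ _ (e / 2 * 1))//; [apply: ler_pM => //; lra|lra].
  rewrite normrZ gtr0_norm; last by lra.
  rewrite (@le_lt_trans _ _ ((1 - mm) * 1))//; last by lra.
  by apply: ler_pM => //; lra.
have [||y [yy0 y1'] Hy] := @avoid_zeros R _ _ s
  (fun i y => ((y - P i.1 i.2.1.1) *m l i) 0 0) N y1 _ _ Nopen Ny1.
- move=> i _ x y d; rewrite !mulmxBl mulmxDl -scalemxAl mulmxBl !mxE; ring.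
- move=> i _; have [+ _ _] := Hl i; move: (l i) => li li0.
  have [j lj] : exists j, li j 0 != 0.
    apply/existsP; apply: contraNT li0 => /existsPn H.
    apply/eqP/colP => j; rewrite [RHS]mxE; have := H j; rewrite negbK.
    by move/eqP.
  exists (P i.1 i.2.1.1 + delta_mx 0 j).
  by rewrite addrAC subrr add0r -rowE mxE.
have gen b : generic_position S (P b) y.
  move=> a a' c c' aS a'S cS c'S; pose i : I := (b, ((a, a'), (c, c'))).
  have [_ l1 l2] := Hl i; exists (l i); split => //; apply: (Hy i).
  apply/allpairsP; exists (b, ((a, a'), (c, c'))); split=> //=.
    by case: b {i l1 l2}; rewrite !inE.
  by apply/allpairsP; exists ((a, a'), (c, c')); split=> //=;
    [apply/allpairsP; exists (a, a')|apply/allpairsP; exists (c, c')].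
by exists y; split=> //; [exact: (gen true)|exact: (gen false)].
Qed.

(** * The crossings of one move *)

Definition hat (R : realType) (n : nat) (v u : 'rV[R]_n) : R^o := (u == v)%:R.

(** The moving vertex starts at once, and each neighbour [a] contributes a delay of its own: the
    point of parameter [s] on the edge from [a] to [v] starts at time [(1 - s) * tau a]. *)
Definition delay (R : realType) (n : nat) (v : 'rV[R]_n) (tau : 'rV[R]_n -> R)
    (u : 'rV[R]_n) : R^o := if u == v then 0 else tau u.

Section one_vertex_move.
Variables (R : realType) (n : nat) (E : seq ('rV[R]_n * 'rV[R]_n)).
Variables (P : 'rV[R]_n -> 'rV[R]_3) (v : 'rV[R]_n) (y : 'rV[R]_3).
Variable tau : 'rV[R]_n -> R.
Implicit Types (a b c d x u : 'rV[R]_n) (s r t g : R).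

Hypothesis complexE : complex E.
Hypothesis injP : set_inj (body E) (interp E P).
Hypothesis genericy : generic_position (verts E) P y.

Let w := y - P v.
Let hatv := hat v.
Let start := delay v tau.

Definition vertex_move : R -> 'rV[R]_n -> 'rV[R]_3 := slide E P start hatv w.

Definition covered t x : R :=
  Num.max 0 (Num.min (t - interp E start x) (interp E hatv x)).

Lemma vertex_moveE t x : vertex_move t x = interp E P x + covered t x *: w.
Proof. by []. Qed.

Definition adjacent a b : Prop := (a, b) \in E \/ (b, a) \in E.

Lemma edge_pt_swap a b s : edge_pt (a, b) s = edge_pt (b, a) (1 - s).
Proof. by rewrite /edge_pt/= opprB addrC subrKC addrC. Qed.

Lemma adjacent_verts a b : adjacent a b -> a \in verts E /\ b \in verts E.
Proof.
by move=> [] ab; have := map_f fst ab; have := map_f snd ab;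
  rewrite !mem_cat /= => -> ->; rewrite orbT.
Qed.

Lemma adjacent_neq a b : adjacent a b -> a <> b.
Proof. by case=> /complexE.1 /= h; [|apply/nesym]. Qed.

Lemma interp_adjacent (W : lmodType R) (Q : 'rV[R]_n -> W) a b s :
  adjacent a b -> 0 <= s <= 1 ->
  interp E Q (edge_pt (a, b) s) = (1 - s) *: Q a + s *: Q b.
Proof.
move=> [ab|ab] s01; first by rewrite interpE.
rewrite edge_pt_swap interpE//=; last by lra.
by rewrite opprB addrC subrKC addrC.
Qed.

Lemma adjacent_body a b s : adjacent a b -> 0 <= s <= 1 ->
  body E (edge_pt (a, b) s).
Proof.
move=> [ab|ab] s01; first by exists (a, b), s.
by exists (b, a), (1 - s); rewrite edge_pt_swap; split=> //; lra.
Qed.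

Lemma body_star x : body E x ->
  (exists a s, [/\ adjacent a v, 0 <= s <= 1 & x = edge_pt (a, v) s]) \/
  (exists c d s, [/\ adjacent c d, c <> v, d <> v, 0 <= s <= 1 &
     x = edge_pt (c, d) s]).
Proof.
move=> [[a b] [s [abE s01 xE]]].
have [bv|/eqP bv] := eqVneq b v; first by left; exists a, s; rewrite -bv; split=> //; left.
have [av|/eqP av] := eqVneq a v; last by right; exists a, b, s; split=> //; left.
left; exists b, (1 - s); rewrite -av edge_pt_swap subKr; split=> //; [by right|lra].
Qed.

Lemma covered_star t a s : adjacent a v -> 0 <= s <= 1 ->
  covered t (edge_pt (a, v) s) = Num.max 0 (Num.min (t - (1 - s) * tau a) s).
Proof.
move=> av s01; rewrite /covered !interp_adjacent// /start /hatv /hat /delay  eqxx.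
have /eqP/negPf -> := adjacent_neq av.
by rewrite scaler0 addr0 [_ *: 0]scaler0 add0r; congr (Num.max 0 (Num.min _ _)); exact: mulr1.
Qed.

Lemma covered_static t c d s : adjacent c d -> c <> v -> d <> v ->
  0 <= s <= 1 -> covered t (edge_pt (c, d) s) = 0.
Proof.
move=> cd /eqP/negPf cv /eqP/negPf dv s01; rewrite /covered !interp_adjacent//.
rewrite /hatv /hat cv dv; set t0 := t - _.
have -> : (1 - s) *: (0 : R^o) + s *: (0 : R^o) = 0 by rewrite !scaler0 addr0.
by rewrite max_l// ge_min lexx orbT.
Qed.

(** Neither time nor delays occur, with [g] the distance already covered: whatever the delays are,
    the edge from [a] to [v] sweeps out the triangle of [P a], [P v] and [y]. The last clause says
    that the directions of this triangle and of the static edge are independent; it gives uniqueness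
    and transversality. *)
Definition crossing a s g c d r : Prop :=
  [/\ adjacent a v, adjacent c d /\ c <> v /\ d <> v,
      0 < g < s /\ s < 1, 0 < r < 1 &
      (1 - s) *: P a + s *: P v + g *: w = (1 - r) *: P c + r *: P d /\
      (forall k0 k1 k2 : R,
         k0 *: (P v - P a) + k1 *: w + k2 *: (P d - P c) = 0 ->
         [/\ k0 = 0, k1 = 0 & k2 = 0])].

(** The form in which [generic_position] is applied. Every degenerate coincidence below is refuted
    by evaluating such an [f] on the equation between the two positions: all terms but those with
    [y] cancel. *)
Let separating_form a b c d :
  a \in verts E -> b \in verts E -> c \in verts E -> d \in verts E ->
  exists f : 'rV[R]_3 -> R,
    [/\ {morph f : z1 z2 / z1 + z2}, forall k z, f (k *: z) = k * f z,
      f (P b) = f (P a) /\ f (P c) = f (P d), f y - f (P a) != 0 &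
      f w = f y - f (P v)].
Proof.
move=> aV bV cV dV; have [l [l1 l2 l3]] := genericy aV bV cV dV.
have lB z1 z2 : ((z1 - z2) *m l) 0 0 = (z1 *m l) 0 0 - (z2 *m l) 0 0.
  by rewrite mulmxBl mxE [X in _ + X]mxE.
exists (fun z => (z *m l) 0 0); split.
- by move=> z1 z2; rewrite mulmxDl mxE.
- by move=> k z; rewrite -scalemxAl mxE.
- move: l1 l2; rewrite !mulmxBl => /subr0_eq l1 /subr0_eq l2.
  by rewrite l1 l2.
- by rewrite -lB.
- exact: lB.
Qed.

(** A linear form that is constant on [P v], [P a] and [P b] but takes another value at [y] sees
    only the distances covered. Once equal, these cancel from the two positions, and injectivity of
    the initial map applies. *)
Lemma vertex_move_star_inj t x x' a s b r : adjacent a v -> adjacent b v ->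
  0 <= s <= 1 -> 0 <= r <= 1 -> x = edge_pt (a, v) s -> x' = edge_pt (b, v) r ->
  vertex_move t x = vertex_move t x' -> covered t x = covered t x'.
Proof.
move=> av bv s01 r01 -> ->; rewrite !vertex_moveE !interp_adjacent// => e.
have [aV vV] := adjacent_verts av; have [bV _] := adjacent_verts bv.
have [f [fD fZ [f1 f2] f3 fw]] := separating_form vV aV bV vV.
move: e; set g := covered _ _; set g' := covered _ _ => e.
apply/eqP; rewrite -subr_eq0.
suff /eqP : (g - g') * (f y - f (P v)) = 0 by rewrite mulf_eq0 (negPf f3) orbF.
by move: e => /(congr1 f); rewrite !fD !fZ f1 f2 fw; lra.
Qed.

(** Degenerate meetings put [y] in a plane spanned by vertices: that of [P v], [P c], [P d] if the
    moving vertex itself hits the edge, of [P a], [P c], [P d] if the point has already arrived on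
    the new edge, of [P a], [P v] and an end of the static edge if this end is hit. *)
Lemma vertex_move_crossing t x x' a s c d r :
  adjacent a v -> adjacent c d -> c <> v -> d <> v ->
  0 <= s <= 1 -> 0 <= r <= 1 -> x = edge_pt (a, v) s -> x' = edge_pt (c, d) r ->
  x <> x' -> vertex_move t x = vertex_move t x' ->
  crossing a s (covered t x) c d r.
Proof.
move=> av cd cv dv s01 r01 xE x'E xx'; rewrite !vertex_moveE.
have -> : covered t x' = 0 by rewrite x'E covered_static.
rewrite scale0r addr0.
have xB : body E x by rewrite xE; exact: adjacent_body.
have x'B : body E x' by rewrite x'E; exact: adjacent_body.
have g0 : 0 <= covered t x by rewrite /covered le_max lexx.
have gs : covered t x <= s.
  by rewrite xE covered_star// ge_max ge_min lexx orbT andbT; case/andP: s01.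
move: g0 gs; set g := covered t x => g0 gs e.
(* As long as nothing is covered, both points are in their initial positions, where the map is
   injective. *)
have {}g0 : 0 < g.
  rewrite lt_def g0 andbT; apply/eqP => g0'; apply: xx'.
  by apply: injP; rewrite ?inE//; move: e; rewrite g0' scale0r addr0.
move: e; rewrite xE x'E !interp_adjacent// => e.
have [aV vV] := adjacent_verts av; have [cV dV] := adjacent_verts cd.
have gl (X : R) : g * X = 0 -> X = 0.
  by move/eqP; rewrite mulf_eq0 gt_eqF// => /eqP.
have s1 : s < 1.
  rewrite lt_def; apply/andP; split; last by case/andP: s01.
  apply/eqP => s1; have [f [fD fZ [f1 f2] /eqP f3 fw]] := separating_form vV cV dV vV.
  apply/f3/gl; move: e => /(congr1 f); rewrite !fD !fZ f1 f2 fw -s1; lra.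
have g_s : g < s.
  rewrite lt_def gs andbT; apply/eqP => sg.
  have [f [fD fZ [f1 f2] /eqP f3 fw]] := separating_form aV cV dV aV.
  apply/f3/gl; move: e => /(congr1 f); rewrite !fD !fZ f1 f2 fw sg; lra.
have r0 : 0 < r.
  rewrite lt_def; apply/andP; split; last by case/andP: r01.
  apply/eqP => r0.
  have [f [fD fZ [f1 f2] /eqP f3 fw]] := separating_form aV vV cV aV.
  apply/f3/gl; move: e => /(congr1 f); rewrite !fD !fZ fw f1 f2 r0; lra.
have r1 : r < 1.
  rewrite lt_def; apply/andP; split; last by case/andP: r01.
  apply/eqP => r1.
  have [f [fD fZ [f1 f2] /eqP f3 fw]] := separating_form aV vV dV aV.
  apply/f3/gl; move: e => /(congr1 f); rewrite !fD !fZ fw f1 f2 -r1; lra.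
split=> //; first by rewrite g0.
  by rewrite r0.
split=> // k0 k1 k2 e'.
(* Here the plane through [P a] is parallel to both edges, instead of being spanned by three
   vertices. *)
have k10 : k1 = 0.
  have [f [fD fZ [f1 f2] f3 fw]] := separating_form aV vV dV cV.
  have f0 : f 0 = 0 by rewrite -(scale0r 0) fZ mul0r.
  have fN z : f (- z) = - f z by rewrite -scaleN1r fZ mulN1r.
  move: e' => /(congr1 f); rewrite !fD !fZ !fD !fN ?fw f0 f1 f2 => h.
  have /eqP : k1 * (f y - f (P a)) = 0 by lra.
  by rewrite mulf_eq0 (negPf f3) orbF => /eqP.
move: e'; rewrite k10 scale0r addr0 => e'.
(* Were [k2] nonzero, the static edge would lie in the plane of [P a], [P v], [P c]. So would the
   crossing point and, as [g > 0], also [y]. *)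
have k20 : k2 = 0.
  apply/eqP/negPn/negP => k2n.
  have [f [fD fZ [f1 f2] /eqP f3 fw]] := separating_form aV vV cV aV.
  have f0 : f 0 = 0 by rewrite -(scale0r 0) fZ mul0r.
  have fN z : f (- z) = - f z by rewrite -scaleN1r fZ mulN1r.
  apply/f3/gl; move: e => /(congr1 f); rewrite !fD !fZ fw f1 f2.
  have -> : f (P d) = f (P a).
    move: e' => /(congr1 f); rewrite !fD !fZ !fD !fN f0 f1 f2 => h.
    have /eqP : k2 * (f (P d) - f (P a)) = 0 by lra.
    by rewrite mulf_eq0 (negPf k2n)/= subr_eq0 => /eqP.
  by lra.
split=> //; move: e'; rewrite k20 scale0r addr0 => /eqP.
rewrite scaler_eq0 subr_eq0 => /orP[/eqP//|/eqP pva].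
case: (adjacent_neq av); apply: injP; rewrite ?inE; try exact: verts_body.
by rewrite !interp_vert.
Qed.

(** The difference of the two equations is a relation between the three independent directions. *)
Lemma crossing_unique a c d s g r s' g' r' :
  crossing a s g c d r -> crossing a s' g' c d r' -> [/\ s = s', g = g' & r = r'].
Proof.
move=> [_ _ _ _ [e ind]] [_ _ _ _ [e' _]].
have [|h1 h2 h3] := ind (s - s') (g - g') (- (r - r')); last by split; lra.
have : ((1 - s) *: P a + s *: P v + g *: w) - ((1 - s') *: P a + s' *: P v + g' *: w) =
  ((1 - r) *: P c + r *: P d) - ((1 - r') *: P c + r' *: P d) by rewrite e e'.
move=> /eqP; rewrite -subr_eq0 => /eqP <-.
by apply/rowP => i; rewrite !mxE; ring.
Qed.

End one_vertex_move.

(** * Finiteness and separation of the crossing times *)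

Section crossing_times.
Variables (R : realType) (n : nat) (E : seq ('rV[R]_n * 'rV[R]_n)).
Variables (P : 'rV[R]_n -> 'rV[R]_3) (v : 'rV[R]_n) (y : 'rV[R]_3).

Local Notation data := ((('rV[R]_n * 'rV[R]_n) * 'rV[R]_n) * ((R * R) * R))%type.

Let crossing_data (k : data) : Prop :=
  crossing E P v y k.1.1.1 k.2.1.1 k.2.1.2 k.1.1.2 k.1.2 k.2.2.

(** By uniqueness, a moving edge and an oriented static edge account for at most one crossing. Every
    crossing is listed twice, once for each orientation of the static edge. *)
Lemma finitely_many_crossings : exists K : seq data,
  forall k, k \in K <-> crossing_data k.
Proof.
pose OE := E ++ [seq (e.2, e.1) | e <- E].
have OEP a b : adjacent E a b -> (a, b) \in OE.
  rewrite mem_cat => -[->//|ba]; apply/orP; right.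
  by apply/mapP; exists (b, a).
have /choice[f Hf] (acd : ('rV[R]_n * 'rV[R]_n) * 'rV[R]_n) : exists sgr : (R * R) * R,
    forall sgr', crossing_data (acd, sgr') -> sgr' = sgr.
  have [[sgr H]|H] := pselect (exists sgr, crossing_data (acd, sgr)).
    exists sgr => sgr' H'; have [] := crossing_unique H H'.
    by case: sgr {H} => [[s g] r]; case: sgr' {H'} => [[s' g'] r'] /= -> -> ->.
  by exists (0, 0, 0) => sgr' H'; case: H; exists sgr'.
pose L := [seq ((av.1, cd.1, cd.2), f (av.1, cd.1, cd.2)) | av <- OE, cd <- OE].
exists [seq k <- L | `[< crossing_data k >]] => k; rewrite mem_filter; split.
  by move=> /andP[/asboolP].
move=> kc; apply/andP; split; first exact/asboolP.
case: k kc => [[[a c] d] sgr] kc; have [/OEP av [/OEP cd _] _ _ _] := kc.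
by apply/allpairsP; exists ((a, v), (c, d)); split=> //=; rewrite (Hf _ _ kc).
Qed.

(** The conclusion cannot be [k = k'], because both orientations of a static edge give the same
    crossing at the same time; it identifies the point on the moving edge and the distance covered.
    Crossing times are affine in [tau], which is treated as a vector in a space of functions. *)
Lemma exists_distinct_times (K : seq data) :
  (forall k, k \in K -> crossing_data k) ->
  exists tau : 'rV[R]_n -> R, (forall u, u \in verts E -> 0 < tau u < 1) /\
    forall k k', k \in K -> k' \in K ->
      k.2.1.2 + (1 - k.2.1.1) * tau k.1.1.1 =
      k'.2.1.2 + (1 - k'.2.1.1) * tau k'.1.1.1 ->
      (k.1.1.1, k.2.1) = (k'.1.1.1, k'.2.1).
Proof.
move=> HK.
pose s : seq (data * data) := [seq kk <- [seq (k, k') | k <- K, k' <- K] |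
  (kk.1.1.1.1, kk.1.2.1) != (kk.2.1.1.1, kk.2.2.1)].
pose T (k : data) (tau : 'rV[R]_n -> R^o) : R := k.2.1.2 + (1 - k.2.1.1) * tau k.1.1.1.
pose N (tau : 'rV[R]_n -> R^o) := exists2 eta : R, 0 < eta &
  forall u, u \in verts E -> eta <= tau u <= 1 - eta.
have [||||tau [eta eta0 Htau] Ht] := @avoid_zeros R _ _ s
  (fun kk tau => T kk.1 tau - T kk.2 tau) N (fun=> 1 / 2).
- move=> kk _ t1 t2 d; rewrite /T.
  have E0 u : (t1 + d *: (t2 - t1)) u = t1 u + d * (t2 u - t1 u) by [].
  by rewrite !E0; ring.
(* Delays that separate two data: zero if the distances covered differ, otherwise the indicator of
   the neighbour of [v] in [k]. The latter works by [s < 1] if the neighbours differ, and because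
   the parameters differ if the neighbours agree. *)
- move=> [k k']; rewrite mem_filter => /andP[/= kk' kkK].
  have [g_eq|g_neq] := eqVneq k.2.1.2 k'.2.1.2; last first.
    by exists (fun=> 0); rewrite /T !mulr0 !addr0 subr_eq0.
  exists (fun u => (u == k.1.1.1)%:R); rewrite /T g_eq eqxx.
  have [kK k'K] : k \in K /\ k' \in K.
    by move: kkK => /allpairsP[[? ?] /= [? ?]] [-> ->].
  have [_ _ [_ s1] _ _] := HK k kK.
  have [aa'|aa'] := eqVneq k'.1.1.1 k.1.1.1; last first.
    by rewrite mulr1 mulr0 addr0 addrAC subrr add0r subr_eq0 eq_sym lt_eqF.
  rewrite !mulr1; apply: contraNneq kk' => ss'; apply/eqP.
  rewrite aa' (surjective_pairing k.2.1) (surjective_pairing k'.2.1) g_eq.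
  by congr (_, (_, _)); lra.
- move=> t1 t2 [eta eta0 Ht1]; pose C := 1 + \sum_(u <- verts E) `|t2 u - t1 u|.
  have C0 : 0 < C by rewrite ltr_pwDl// sumr_ge0.
  exists (eta / (2 * C)); first by rewrite divr_gt0// mulr_gt0.
  move=> d /andP[d0]; rewrite ltr_pdivlMr ?mulr_gt0// => dC.
  exists (eta / 2) => [|u uV]; first by lra.
  have E0 : (t1 + d *: (t2 - t1)) u = t1 u + d * (t2 u - t1 u) by [].
  have : `|t2 u - t1 u| <= C.
    rewrite /C (big_rem u)//= addrCA lerDl addr_ge0// sumr_ge0//.
  move=> uC; have : `|d * (t2 u - t1 u)| <= eta / 2.
    rewrite normrM gtr0_norm// (@le_trans _ _ (d * C))//; first by rewrite ler_pM2l.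
    lra.
  by rewrite ler_norml E0; have := Ht1 u uV; lra.
- by exists (1 / 2) => [|u _]; lra.
exists tau; split.
  by move=> u /Htau; lra.
move=> k k' kK k'K e; apply/eqP/negPn/negP => ne.
have /Ht : (k, k') \in s.
  by rewrite mem_filter ne; apply/allpairsP; exists (k, k').
by rewrite /T e subrr eqxx.
Qed.

End crossing_times.

(** * Cubes and intervals as polytopes *)

Section cubes.
Variable R : realType.

(** To avoid listing corners, the cube is cut by its [2 d] half-spaces out of the cross-polytope of
    radius [d], which contains it since the absolute values of [d] coordinates, each at most 1, sum
    to at most [d]. The point 0 takes up the remaining weight, and for [d = 0] it is the whole
    hull. *)
Lemma unit_ball_hull d : exists s : seq 'rV[R]_d, @unit_ball R d = hull s.
Proof.
pose S : seq 'rV[R]_d := 0 :: [seq (d%:R * k) *: delta_mx 0 i | i <- enum 'I_d, k <- [:: 1; -1]].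
pose C : cell R d := [seq (k *: delta_mx i 0, -1) | i <- enum 'I_d, k <- [:: 1; -1]].
have Cx (x : 'rV[R]_d) : in_cell C x <-> @unit_ball R d x.
  have coordE (i : 'I_d) k : (x *m (k *: delta_mx i 0 : 'cV[R]_d)) 0 0 = k * x 0 i.
    rewrite -scalemxAr !mxE (bigD1 i)//= big1 ?addr0 ?mxE ?eqxx ?mulr1//.
    by move=> j /negPf ji; rewrite mxE ji mulr0.
  split.
    move=> H; apply/ler_mxnorm => // i.
    have h1 := H (1 *: delta_mx i 0, -1); have h2 := H (-1 *: delta_mx i 0, -1).
    rewrite ler_norml; move: h1 h2; rewrite /= !coordE => h1 h2.
    have {}h1 : -1 <= 1 * x 0 i.
      by apply: h1; apply/allpairsP; exists (i, 1); rewrite mem_enum !inE eqxx.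
    have {}h2 : -1 <= -1 * x 0 i.
      by apply: h2; apply/allpairsP; exists (i, -1); rewrite mem_enum !inE eqxx orbT.
    by lra.
  move=> /(ler_mxnorm _ ler01) H h /allpairsP[[i k] /= [_ + ->]]; rewrite coordE.
  have := H i; rewrite ler_norml => /andP[h1 h2].
  by rewrite !inE => /orP[] /eqP -> /=; lra.
have [s Hs] := hull_cell S C; exists s; rewrite -Hs; apply/seteqP; split=> x.
  move=> xB; split; last exact/Cx.
  have [d0|d0] := posnP d.
    move: x xB; rewrite /S /C {S C Cx Hs}; case: _ / (esym d0) => x _.
    rewrite (_ : x = 0); last by apply/rowP => -[].
    by apply: hull_mem; rewrite mem_head.
  have dR : 0 < d%:R :> R by rewrite ltr0n.
  have big_opt (V : nmodType) (F : unit + 'I_d -> V) :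
      \sum_o F o = F (inl tt) + \sum_i F (inr i).
    by rewrite big_sumType/= (big_pred1 tt)// => -[].
  have xE : x = \sum_(o : unit + 'I_d) (if o is inr i then `|x 0 i| / d%:R else
       1 - \sum_i `|x 0 i| / d%:R) *:
     (if o is inr i then (d%:R * (if 0 <= x 0 i then 1 else -1)) *: delta_mx 0 i else 0 : 'rV[R]_d).
    rewrite big_opt/= scaler0 add0r [LHS]row_sum_delta; apply: eq_bigr => i _.
    rewrite scalerA; congr (_ *: _); rewrite mulrA divfK ?gt_eqF//.
    by case: (leP 0 (x 0 i)) => h; [rewrite ger0_norm// mulr1|rewrite ltr0_norm// mulrN mulr1 opprK].
  rewrite xE; apply: hull_sum.
  - case=> [_|i]; last by rewrite divr_ge0// ltW.
    rewrite subr_ge0 -mulr_suml ler_pdivrMr// mul1r.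
    rewrite -[leRHS](_ : \sum_(i < d) 1 = _); last by rewrite sumr_const card_ord.
    by apply: ler_sum => i _; apply: (ler_mxnorm _ ler01).1.
  - by rewrite big_opt/= subrK.
  case=> [_|i] _; apply: hull_mem; rewrite inE; first by rewrite eqxx.
  apply/orP; right; apply/allpairsP; exists (i, if 0 <= x 0 i then 1 else -1).
  by rewrite mem_enum; split=> //=; case: ifP; rewrite !inE eqxx ?orbT.
by case=> _ /Cx.
Qed.

Lemma compact_unit_ball d : compact (@unit_ball R d).
Proof. by have [s ->] := unit_ball_hull d; exact: compact_hull. Qed.

Lemma pl_unit_ball d q (f : 'rV[R]_d -> 'rV[R]_q) : pwl f -> pl (@unit_ball R d) f.
Proof. by have [s ->] := unit_ball_hull d => pf; exact: (pl_hull pf). Qed.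

Lemma pl_embedding_affine d q (Y : set 'rV[R]_q) (M : 'M[R]_(d, q)) b :
  injective (fun x => x *m M + b) ->
  (forall x, @unit_ball R d x -> Y (x *m M + b)) ->
  pl_embedding (@unit_ball R d) Y (fun x => x *m M + b).
Proof.
move=> injM MY; split; first exact/pl_unit_ball/pwl_affine.
apply: compact_embedding; first exact: compact_unit_ball.
- by apply: continuous_subspaceT; exact: continuous_mulmx_row.
- by move=> _ [x /MY ? <-].
by move=> x y _ _; exact: injM.
Qed.

Lemma unit_interval_hull : @unit_interval R = hull [:: 0; 1%:M].
Proof.
apply/seteqP; split=> z.
  move=> z01; have -> : z = (1 - z 0 0) *: (0 : 'rV[R]_1) + z 0 0 *: 1%:M.
    by rewrite scaler0 add0r scale_scalar_mx mulr1 -rV1P.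
  have [h1 h2] := andP z01.
  by apply: hull_segment; rewrite ?subr_ge0 ?subrK//;
    apply: hull_mem; rewrite !inE eqxx ?orbT.
case=> w [w0 w1 ->]; move: w1; rewrite !big_ord_recl !big_ord0 /= !addr0 => w1.
rewrite /unit_interval/= scaler0 add0r scale_scalar_mx mulr1 mxE eqxx mulr1n.
by have := w0 ord0; have := w0 (lift ord0 ord0); lra.
Qed.

End cubes.

Section interp_maps.
Variables (R : realType) (n : nat) (E : seq ('rV[R]_n * 'rV[R]_n)).
Hypothesis complexE : complex E.

Lemma pl_interp q (P : 'rV[R]_n -> 'rV[R]_q) : pl (body E) (interp E P).
Proof.
have -> : body E = \bigcup_(e in [set` E]) hull [:: e.1; e.2].
  apply/seteqP; split=> x.
    move=> [e [s [eE /andP[s0 s1] ->]]]; exists e => //.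
    by apply: hull_segment; rewrite ?subr_ge0 ?subrK//;
      apply: hull_mem; rewrite !inE eqxx ?orbT.
  case=> e /= eE [w [w0 w1 ->]]; move: w1.
  rewrite !big_ord_recl !big_ord0 /= !addr0 => w1.
  exists e, (w (lift ord0 ord0)); split=> //.
    by have := w0 ord0; have := w0 (lift ord0 ord0); lra.
  rewrite /edge_pt; congr (_ *: _ + _); lra.
apply: pl_bigcup => e /= eE; have [c [b Hcb]] := edge_param (complexE.1 e eE).
apply: (@pl_hull _ _ _ _ _ (fun x => (1 - ((x *m c) 0 0 + b)) *: P e.1 + ((x *m c) 0 0 + b) *: P e.2)).
  apply: pwl_add; apply: pwl_scale; last exact: pwls_affine.
  by apply: pwls_add; [exact: pwls_cst|exact/pwls_opp/pwls_affine].
move=> x [w [w0 w1 ->]]; move: w1.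
rewrite !big_ord_recl !big_ord0 /= !addr0 => w1.
have -> : w ord0 *: e.1 + w (lift ord0 ord0) *: e.2 = edge_pt e (w (lift ord0 ord0)).
  by rewrite /edge_pt; congr (_ *: _ + _); lra.
rewrite Hcb interpE//.
by have := w0 ord0; have := w0 (lift ord0 ord0); lra.
Qed.

Lemma compact_body : compact (body E).
Proof. exact: pl_compact (pl_interp (fun=> (0 : 'rV[R]_0))). Qed.

End interp_maps.

Lemma near_pair (R : realType) (V : normedModType R) (x0 : V) (t0 e : R)
    (Q : V -> R -> Prop) : 0 < e ->
  (forall x t, `|x - x0| < e -> `|t - t0| < e -> Q x t) ->
  \forall x \near x0 & t \near t0, Q x t.
Proof.
move=> e0 H; exists (ball x0 e, ball t0 e); first by split; exact: nbhsx_ballx.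
move=> [x t] /= []; rewrite -!ball_normE /= => xx tt.
by apply: H; rewrite distrC.
Qed.

(** The second branch is static, so its velocity is 0 and the last column ties its coefficient to
    that of the first branch. Independence of three vectors in R^3 is all that remains. *)
Lemma double_point_charts_free (R : fieldType) (a1 b1 a2 : 'rV[R]_3) :
  (forall k0 k1 k2, k0 *: a1 + k1 *: b1 + k2 *: a2 = 0 ->
    [/\ k0 = 0, k1 = 0 & k2 = 0]) ->
  row_free (col_mx (block_mx a1 0 b1 (1%:M : 'M[R]_1))
                   (block_mx a2 0 0 (1%:M : 'M[R]_1))).
Proof.
move=> ind; apply: inj_row_free => z.
rewrite -[z]hsubmxK -[lsubmx z]hsubmxK -[rsubmx z]hsubmxK.
set k0 := lsubmx (lsubmx z); set k1 := rsubmx (lsubmx z).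
set k2 := lsubmx (rsubmx z); set k3 := rsubmx (rsubmx z).
rewrite mul_row_col !mul_row_block !mulmx0 !mulmx1 !add0r addr0.
have sc (k : 'rV[R]_1) : k = (k 0 0)%:M.
  by apply/matrixP => i j; rewrite !ord1 mxE eqxx.
rewrite add_row_mx => /eqP; rewrite -[X in _ == X]row_mx0 => /eqP/eq_row_mx[e1 e2].
move: e1; rewrite (sc k0) (sc k1) (sc k2) !mul_scalar_mx => /ind[h0 h1 h2].
have {}e2 : k3 = 0 by move: e2; rewrite (sc k1) h1 raddf0 add0r.
by rewrite e2 h0 h1 h2 !raddf0 !row_mx0.
Qed.

Lemma near_in_unit (R : realType) (s x rho : R) :
  `|x| <= rho -> rho <= s -> rho <= 1 - s -> 0 <= s + x <= 1.
Proof. by rewrite ler_norml; lra. Qed.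

(** At a crossing the distance [g] lies between the bounds 0 and [s] with a margin [m].
    Perturbations below [m / 4] do not reach the clamps, so the motion is affine nearby. *)
Lemma clamp_near (R : realType) (g s m u w x : R) :
  m <= g -> m <= s - g -> `|u| < m / 4 -> `|x| < m / 4 -> `|w| < m / 4 ->
  Num.max 0 (Num.min (g + u + w) (s + x)) = g + u + w.
Proof. by rewrite !ltr_norml => *; rewrite min_l ?max_r//; lra. Qed.

(** * One move is a generic homotopy *)

Section generic_move.
Variables (R : realType) (n : nat) (E : seq ('rV[R]_n * 'rV[R]_n)).
Variables (P : 'rV[R]_n -> 'rV[R]_3) (v : 'rV[R]_n) (y : 'rV[R]_3).
Variable tau : 'rV[R]_n -> R.
Implicit Types (a b c d x u : 'rV[R]_n) (s r t g : R).

Hypothesis complexE : complex E.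
Hypothesis injP : set_inj (body E) (interp E P).
Hypothesis genericy : generic_position (verts E) P y.
Hypothesis tau01 : forall u, u \in verts E -> 0 < tau u < 1.
Hypothesis cubeP : forall u, u \in verts E -> `|P u| <= 1.
Hypothesis cubey : `|y| < 1.

Let H := vertex_move E P v y tau.
Let cov := covered E v tau.

Lemma interp_hat_ge0 x : body E x -> 0 <= interp E (hat v) x.
Proof.
move=> [e [s [eE /andP[s0 s1] ->]]]; rewrite interpE ?s0//.
by rewrite addr_ge0// mulr_ge0 ?subr_ge0// /hat ler0n.
Qed.

Lemma covered_range t x : body E x -> 0 <= cov t x <= interp E (hat v) x.
Proof.
move=> /interp_hat_ge0 h; rewrite /cov /covered le_max lexx/=.
by rewrite ge_max ge_min lexx orbT h.
Qed.

(** Two static points, or two points in the star of [v], with the same image have covered the same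
    distance; then they coincide already under the initial map, which is injective. So one point is
    moving and the other is static. *)
Lemma vertex_move_cases t x x' : body E x -> body E x' -> x <> x' ->
  H t x = H t x' ->
  (exists a s c d r, [/\ crossing E P v y a s (cov t x) c d r,
     x = edge_pt (a, v) s & x' = edge_pt (c, d) r]) \/
  (exists a s c d r, [/\ crossing E P v y a s (cov t x') c d r,
     x' = edge_pt (a, v) s & x = edge_pt (c, d) r]).
Proof.
move=> xB x'B xx' e.
have neq : cov t x <> cov t x'.
  move=> g; apply: xx'; apply: injP; rewrite ?inE//.
  by move: e; rewrite /H !vertex_moveE -/cov g => /addIr.
case: (body_star v xB) => [[a [s [av s01 xE]]]|[c [d [s [cd cv dv s01 xE]]]]];
case: (body_star v x'B) => [[a' [s' [av' s01' xE']]]|[c' [d' [s' [cd' cv' dv' s01' xE']]]]].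
- by case: neq; exact: (vertex_move_star_inj complexE genericy av av' s01 s01' xE xE' e).
- left; exists a, s, c', d', s'; split=> //.
  exact: (vertex_move_crossing complexE injP genericy av cd' cv' dv' s01 s01' xE xE').
- right; exists a', s', c, d, s; split=> //.
  by apply: (vertex_move_crossing complexE injP genericy av' cd cv dv s01' s01 xE' xE) => //;
    exact/nesym.
by case: neq; rewrite xE xE' /cov !covered_static.
Qed.

(** At a crossing [0 < g < s], so neither clamp is active and the distance covered determines the
    time. *)
Lemma crossing_time t a s c d r :
  crossing E P v y a s (cov t (edge_pt (a, v) s)) c d r ->
  t = cov t (edge_pt (a, v) s) + (1 - s) * tau a.
Proof.
move=> [av _ [gs s1] _ _]; have s01 : 0 <= s <= 1 by lra.
move: gs; rewrite /cov covered_star//.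
set z := t - _; rewrite (_ : t = z + (1 - s) * tau a); last by rewrite subrK.
by case: (leP z s) => h1; [case: (leP 0 z)|case: (leP 0 s)] => h2; lra.
Qed.

Lemma crossing_covered t a s g c d r : crossing E P v y a s g c d r ->
  t = g + (1 - s) * tau a -> cov t (edge_pt (a, v) s) = g.
Proof.
move=> [av _ [gs s1] _ _] ->; rewrite /cov covered_star//; last by lra.
by rewrite addrK min_l ?max_r; lra.
Qed.

Lemma vertex_move_in_cube t x : body E x -> `|H t x| <= 1.
Proof.
move=> xB; have := covered_range t xB; rewrite /H vertex_moveE -/cov.
case: (body_star v xB) => [[a [s [av s01 ->]]]|[c [d [s [cd cv dv s01 ->]]]]].
  rewrite !interp_adjacent// /hat eqxx; have /eqP/negPf -> := adjacent_neq complexE av.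
  have -> : (1 - s) *: (0 : R^o) + s *: (1 : R^o) = s.
    by rewrite scaler0 add0r; exact: mulr1.
  set g := cov _ _ => /andP[g0 gs]; have [aV vV] := adjacent_verts av.
  have -> : (1 - s) *: P a + s *: P v + g *: (y - P v) =
    (1 - s) *: P a + ((s - g) *: P v + g *: y).
    by apply/rowP => i; rewrite !mxE; ring.
  apply: le_trans (ler_normD _ _) _.
  have h1 : `|(1 - s) *: P a| <= 1 - s.
    by rewrite normrZ ger0_norm ?ler_piMr ?cubeP//; lra.
  have h2 : `|(s - g) *: P v| <= s - g.
    by rewrite normrZ ger0_norm ?ler_piMr ?cubeP//; lra.
  have h3 : `|g *: y| <= g.
    by rewrite normrZ ger0_norm ?ler_piMr ?(ltW cubey).
  by have := ler_normD ((s - g) *: P v) (g *: y); lra.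
rewrite /cov covered_static// scale0r addr0 => _; have [cV dV] := adjacent_verts cd.
rewrite interp_adjacent//; apply: le_trans (ler_normD _ _) _.
have h1 : `|(1 - s) *: P c| <= 1 - s.
  by rewrite normrZ ger0_norm ?ler_piMr ?cubeP//; lra.
have h2 : `|s *: P d| <= s.
  by rewrite normrZ ger0_norm ?ler_piMr ?cubeP//; lra.
by lra.
Qed.

(** The position is a convex combination in which [y], a point strictly inside the cube, has the
    positive weight [g]. A chart of the cube around the double point requires such an interior
    point. *)
Lemma crossing_inside a s g c d r t : crossing E P v y a s g c d r ->
  t = g + (1 - s) * tau a -> `|H t (edge_pt (a, v) s)| < 1.
Proof.
move=> cr tE; have [av _ [gs s1] _ _] := cr; have [aV vV] := adjacent_verts av.
have s01 : 0 <= s <= 1 by lra.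
rewrite /H vertex_moveE -/cov (crossing_covered cr tE) interp_adjacent//.
have -> : (1 - s) *: P a + s *: P v + g *: (y - P v) =
    (1 - s) *: P a + ((s - g) *: P v + g *: y).
    by apply/rowP => i; rewrite !mxE; ring.
apply: le_lt_trans (ler_normD _ _) _.
have h1 : `|(1 - s) *: P a| <= 1 - s.
  by rewrite normrZ ger0_norm ?ler_piMr ?cubeP//; lra.
have h2 : `|(s - g) *: P v| <= s - g.
  by rewrite normrZ ger0_norm ?ler_piMr ?cubeP//; lra.
have h3 : `|g *: y| < g.
  by rewrite normrZ gtr0_norm ?gtr_pMr //; lra.
by have := ler_normD ((s - g) *: P v) (g *: y); lra.
Qed.

Lemma edge_chart a b s (rho : R) : adjacent E a b -> 0 < rho -> rho <= s ->
  rho <= 1 - s ->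
  pl_chart (body E) (edge_pt (a, b) s)
    (fun z : 'rV[R]_1 => edge_pt (a, b) (s + rho * z 0 0)).
Proof.
move=> ab r0 rs rs1.
have E1 (z : 'rV[R]_1) : z *m (rho *: (b - a)) + edge_pt (a, b) s =
    edge_pt (a, b) (s + rho * z 0 0).
  rewrite {1}(rV1P z) mul_scalar_mx /edge_pt.
  by apply/rowP => i; rewrite !mxE /=; ring.
split; last by rewrite mxE mulr0 addr0.
rewrite -(funext E1); apply: pl_embedding_affine.
  move=> z z' /=; rewrite !E1.
  have ab_neq : (a, b).1 <> (a, b).2 := adjacent_neq complexE ab.
  move=> /(edge_pt_inj ab_neq) /addrI /(mulfI (lt0r_neq0 r0)).
  by move=> h; rewrite (rV1P z) h -rV1P.
move=> z /(ler_mxnorm _ ler01)/(_ 0) z1; rewrite E1; apply: adjacent_body => //.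
have : `|rho * z 0 0| <= rho by rewrite normrM gtr0_norm// ler_piMr// ltW.
by rewrite ler_norml; lra.
Qed.

(** Near the crossing both branches are affine in edge parameter and time. The chart at [X] is a
    homothety whose factor [k] is the distance from [X] to the boundary of the cube. *)
Lemma crossing_transversal a s g c d r t : crossing E P v y a s g c d r ->
  t = g + (1 - s) * tau a ->
  transversal_double_point (body E) (@unit_ball R 3) H t
    (H t (edge_pt (a, v) s)) (edge_pt (a, v) s) (edge_pt (c, d) r).
Proof.
move=> cr tE; have [av [cd [cv dv]] [gs s1] r01 [e ind]] := cr.
have av_neq := adjacent_neq complexE av.
have [aV vV] := adjacent_verts av.
have s01 : 0 <= s <= 1 by lra.
set X := H t (edge_pt (a, v) s).
have XE : X = (1 - s) *: P a + s *: P v + g *: (y - P v).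
  by rewrite /X /H vertex_moveE -/cov (crossing_covered cr tE) interp_adjacent.
have X1 : `|X| < 1 by exact: crossing_inside cr tE.
pose rho := Num.min s (1 - s); pose rho' := Num.min r (1 - r).
have rhoP : [/\ 0 < rho, rho <= s & rho <= 1 - s].
  by rewrite /rho lt_min ge_min lexx ge_min lexx orbT; split=> //; lra.
have rhoP' : [/\ 0 < rho', rho' <= r & rho' <= 1 - r].
  by rewrite /rho' lt_min ge_min lexx ge_min lexx orbT; split=> //; lra.
have [q0 q1 q2] := rhoP; have [q0' q1' q2'] := rhoP'.
pose k := 1 - `|X|; have k0 : 0 < k by rewrite subr_gt0.
have kn : k != 0 by rewrite gt_eqF.
(* A change of [s] moves the initial position along the edge and also advances the start, by [tau a]
   times the change; this is the second summand of the first direction. Together with the velocity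
   it still spans the plane of the swept triangle. *)
exists (fun z => edge_pt (a, v) (s + rho * z 0 0)),
  (fun z => edge_pt (c, d) (r + rho' * z 0 0)), (fun z => z *m k%:M + X),
  (k^-1 *: (rho *: (P v - P a + tau a *: (y - P v)))), (k^-1 *: (y - P v)),
  (k^-1 *: (rho' *: (P d - P c))), 0; split.
- by split; apply: edge_chart.
- split; last by rewrite mul0mx add0r.
  apply: pl_embedding_affine.
    by move=> z z' /addIr; rewrite !mul_mx_scalar => /(scalerI kn).
  move=> z /= z1; rewrite mul_mx_scalar /unit_ball/=.
  apply: le_trans (ler_normD _ _) _; rewrite normrZ gtr0_norm//.
  have : k * `|z| <= k by rewrite ler_piMr// ltW.
  by rewrite /k; lra.
- pose m := Num.min g (s - g); have m0 : 0 < m by rewrite lt_min; lra.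
  have m1 : m <= g by rewrite ge_min lexx.
  have m2 : m <= s - g by rewrite ge_min lexx orbT.
  have tau1 := tau01 aV.
  apply: (@near_pair _ _ _ _ (m / 4)); first by lra.
  have g1 : g < 1 by lra.
  move=> z t'; rewrite subr0 => zm tm.
  have zM (u : 'rV[R]_3) : z *m u = z 0 0 *: u.
    by rewrite {1}(rV1P z) mul_scalar_mx.
  have z0m : `|z 0 0| < m / 4 by apply: le_lt_trans zm; exact: coord_le_norm.
  have z1 : `|z 0 0| <= 1 by lra.
  have rho1 : rho <= 1 by lra.
  have rz : `|rho * z 0 0| < m / 4.
    by apply: le_lt_trans z0m; rewrite normrM gtr0_norm// ler_piMl.
  have rz' : `|rho' * z 0 0| <= rho'.
    by rewrite normrM gtr0_norm// ler_piMr// ltW.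
  have rz2 : `|rho * z 0 0| <= rho.
    by rewrite normrM gtr0_norm// ler_piMr// ltW.
  have sz : 0 <= s + rho * z 0 0 <= 1.
    exact: near_in_unit rz2 _ _.
  have szr : 0 <= r + rho' * z 0 0 <= 1.
    exact: near_in_unit rz' _ _.
  have taurz : `|rho * z 0 0 * tau a| < m / 4.
    apply: le_lt_trans rz; rewrite normrM ler_piMr//.
    by case/andP: tau1 => tau0 /ltW; rewrite gtr0_norm.
  split.
    rewrite /H vertex_moveE interp_adjacent// covered_star//.
    have E1 : t' - (1 - (s + rho * z 0 0)) * tau a = g + (t' - t) + rho * z 0 0 * tau a.
      rewrite tE; ring.
    rewrite E1 (clamp_near m1 m2 tm rz taurz) mul_mx_scalar zM XE.
    by apply/rowP => i; rewrite !mxE; field.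
  rewrite /H vertex_moveE interp_adjacent// covered_static// scale0r addr0.
  rewrite mul_mx_scalar zM XE e scaler0 addr0.
  by apply/rowP => i; rewrite !mxE; field.
apply: double_point_charts_free => k0' k1' k2'; rewrite !scalerA => h.
have [|h0 h1 h2] := ind (k0' * k^-1 * rho) (k0' * k^-1 * rho * tau a + k1' * k^-1) (k2' * k^-1 * rho').
  by rewrite -h; apply/rowP => i; rewrite !mxE; ring.
have z0 : k0' = 0.
  move/eqP: h0; rewrite !mulf_eq0 invr_eq0 (negPf kn) (gt_eqF q0) !orbF => /eqP//.
move: h1; rewrite z0 !mul0r add0r => /eqP; rewrite mulf_eq0 invr_eq0 (negPf kn) orbF => /eqP h1.
by move/eqP: h2; rewrite !mulf_eq0 invr_eq0 (negPf kn) (gt_eqF q0') !orbF => /eqP.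
Qed.

End generic_move.

(** The exceptional times are those of the listed crossings. The last clause bounds how far each
    point gets at every stage; this later keeps all stages close to [L]. *)
Lemma move_vertex (R : realType) (n : nat) (E : seq ('rV[R]_n * 'rV[R]_n))
    (P : 'rV[R]_n -> 'rV[R]_3) (v : 'rV[R]_n) (y : 'rV[R]_3)
    (pres : set ('rV[R]_n * 'rV[R]_3)) :
  complex E -> set_inj (body E) (interp E P) ->
  generic_position (verts E) P y ->
  (forall u, u \in verts E -> `|P u| <= 1) -> `|y| < 1 ->
  (forall z, pres z -> [/\ z.1 \in verts E, z.1 <> v & P z.1 = z.2]) ->
  exists (H : R -> 'rV[R]_n -> 'rV[R]_3) (T : seq R),
    [/\ generic_pl_homotopy (Setting (body E) (@unit_ball R 3) pres) H T,
      joins (body E) H (interp E P) (interp E (fun u => if u == v then y else P u)),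
      set_inj (body E) (interp E (fun u => if u == v then y else P u)) &
      forall t x, body E x -> exists2 g : R, 0 <= g <= interp E (hat v) x &
        H t x = interp E P x + g *: (y - P v)].
Proof.
move=> cE injP gen cubeP cubey Hpres.
have [K HK] := finitely_many_crossings E P v y.
have [tau [tau01 Htau]] := exists_distinct_times (fun k => (HK k).1).
pose H := vertex_move E P v y tau.
pose time (k : ('rV[R]_n * 'rV[R]_n) * 'rV[R]_n * ((R * R) * R)) :=
  k.2.1.2 + (1 - k.2.1.1) * tau k.1.1.1.
pose T := [seq time k | k <- K].
have bodyc : compact (body E) by exact: compact_body.
have H0 x : body E x -> H 0 x = interp E P x.
  move=> xB; rewrite /H vertex_moveE.
  suff -> : covered E v tau 0 x = 0 by rewrite scale0r addr0.
  have [[a [s [av s01 ->]]]|[c [d [s [cd cv dv s01 ->]]]]] := body_star v xB;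
    last by rewrite covered_static.
  rewrite covered_star// sub0r; have [aV _] := adjacent_verts av.
  rewrite max_l// ge_min; apply/orP; left.
  have /andP[ta _] := tau01 a aV; have /andP[_ s1] := s01.
  by rewrite oppr_le0 mulr_ge0 ?subr_ge0// ltW.
have H1 x : body E x -> H 1 x = interp E (fun u => if u == v then y else P u) x.
  move=> xB; rewrite /H vertex_moveE.
  have [[a [s [av s01 ->]]]|[c [d [s [cd cv dv s01 ->]]]]] := body_star v xB.
    rewrite covered_star// !interp_adjacent//; have [aV _] := adjacent_verts av.
    have /eqP/negPf -> := adjacent_neq cE av; rewrite eqxx.
    have h : (1 - s) * tau a <= (1 - s) * 1.
      have /andP[_ ta] := tau01 a aV; have /andP[_ s1] := s01.
      by rewrite ler_wpM2l ?subr_ge0// ltW.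
    rewrite min_r; last by lra.
    rewrite max_r; last by lra.
    by apply/rowP => i; rewrite !mxE; ring.
  rewrite covered_static// !interp_adjacent// scale0r addr0.
  by move/eqP/negPf: cv => ->; move/eqP/negPf: dv => ->.
have crossT t a s c d r : crossing E P v y a s (covered E v tau t (edge_pt (a, v) s)) c d r ->
    t \in T.
  move=> cr; apply/mapP.
  exists ((a, c, d), (s, covered E v tau t (edge_pt (a, v) s), r)); first exact/HK.
  by rewrite /time/=; exact: (crossing_time cE cr).
have injH t : t \notin T -> set_inj (body E) (H t).
  move=> tT x x'; rewrite !inE => xB x'B e; apply/eqP/negPn/negP => /eqP xx'.
  have [] := vertex_move_cases cE injP gen xB x'B xx' e.
    by move=> [a [s [c [d [r [cr xE x'E]]]]]]; move: cr; rewrite xE => /crossT; apply/negP.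
  by move=> [a [s [c [d [r [cr xE x'E]]]]]]; move: cr; rewrite xE => /crossT; apply/negP.
have T01 t : t \in T -> 0 < t < 1.
  move=> /mapP[[[[a c] d] [[s g] r]] /HK cr ->]; rewrite /time/=.
  have [/= av _ [gs s1] _ _] := cr; have [aV _] := adjacent_verts av.
  have h : (1 - s) * tau a <= (1 - s) * 1.
    by have /andP[_ ta] := tau01 a aV; rewrite ler_wpM2l ?subr_ge0 ?ltW//; case/andP: s1.
  have h' : 0 <= (1 - s) * tau a.
    by have /andP[ta _] := tau01 a aV; rewrite mulr_ge0 ?subr_ge0 ?ltW//; case/andP: s1.
  by lra.
have plH : pl (cylinder (body E)) (on_cylinder H) by exact: pl_slide.
have imH t : H t @` body E `<=` @unit_ball R 3.
  by move=> _ [x xB <-]; exact: vertex_move_in_cube.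
have contH t : 0 <= t <= 1 -> {within body E, continuous H t}.
  move=> t01; have /withinP ch := pl_continuous plH; apply/withinP => x xB e e0.
  have zx x' : body E x' -> cylinder (body E) (row_mx x' (t%:M : 'rV[R]_1)).
    by move=> x'B; rewrite /cylinder/= row_mxKl row_mxKr mxE eqxx mulr1n.
  have [d d0 Hd] := ch _ (zx x xB) e e0; exists d => // x' x'B xx'.
  have := Hd _ (zx x' x'B); rewrite /on_cylinder !row_mxKl !row_mxKr mxE eqxx mulr1n.
  by apply; rewrite opp_row_mx add_row_mx subrr; apply/norm_row_mx_lt; rewrite ?normr0.
exists H, T; split.
- split.
  + by split=> //; split=> [|t _]; [exact: (pl_continuous plH)|exact: imH].
  + move=> t _ z /Hpres[zV zv zP]; rewrite /H vertex_moveE.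
    have zB := verts_body zV.
    rewrite /covered (@interp_vert _ _ _ _ (hat v))// /hat; move/eqP/negPf: zv => ->.
    rewrite (@max_l _ _ 0) ?scale0r ?addr0 ?interp_vert//.
    by rewrite ge_min lexx orbT.
  + exact: T01.
  + by move=> t t01 tT; apply: compact_embedding => //; [exact: contH|exact: injH].
  move=> t tT; have t01 := T01 t tT.
  have /mapP[[[[a c] d] [[s g] r]] kK tE] := tT; rewrite /time/= in tE.
  have /HK cr := kK; rewrite /= in cr.
  have [av [cd [cv dv]] [gs s1] r01 [e ind]] := cr.
  exists (H t (edge_pt (a, v) s)), (edge_pt (a, v) s), (edge_pt (c, d) r).
  split; last exact: (crossing_transversal cE tau01 cubeP cubey cr tE).
  have s01 : 0 <= s <= 1 by lra.
  have {}r01 : 0 <= r <= 1 by lra.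
  have sB : body E (edge_pt (a, v) s) by exact: adjacent_body.
  have rB : body E (edge_pt (c, d) r) by exact: adjacent_body.
  have cov_s := crossing_covered cE cr tE.
  have Hsr : H t (edge_pt (a, v) s) = H t (edge_pt (c, d) r).
    rewrite /H !vertex_moveE cov_s covered_static//.
    by rewrite !interp_adjacent ?scale0r ?addr0.
  split=> //.
    move=> sr; have : covered E v tau t (edge_pt (a, v) s) = 0.
      by rewrite sr covered_static.
    by rewrite cov_s; lra.
  (* By the choice of the delays, a crossing at the same time has the same moving point and the same
     distance covered. The two static points then have equal images under the injective initial
     map. *)
  have main a' s' c' d' r' :
      crossing E P v y a' s' (covered E v tau t (edge_pt (a', v) s')) c' d' r' ->
      edge_pt (a', v) s' = edge_pt (a, v) s /\ edge_pt (c', d') r' = edge_pt (c, d) r.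
    move=> cr'; have t' := crossing_time cE cr'.
    move: cr' t'; set g' := covered _ _ _ _ _ => cr' t'.
    have := Htau _ _ ((HK ((a', c', d'), (s', g', r'))).2 cr') kK.
    rewrite /= -t' -tE => /(_ erefl)[aa' ss' gg'].
    split; first by rewrite aa' ss'.
    have [_ [cd' [cv' dv']] _ r01' [e' _]] := cr'.
    have {}r01' : 0 <= r' <= 1 by lra.
    apply: injP; rewrite ?inE; try exact: adjacent_body.
    rewrite !interp_adjacent//.
    by rewrite -e -e' aa' ss' gg'.
  move=> u u' uB u'B uu' Huu'.
  have [] := vertex_move_cases cE injP gen uB u'B uu' Huu'.
    move=> [a' [s' [c' [d' [r' [+ uE u'E]]]]]]; rewrite uE => /main[h1 h2].
    by rewrite u'E h1 h2.
  move=> [a' [s' [c' [d' [r' [+ u'E uE]]]]]]; rewrite u'E => /main[h1 h2].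
  by rewrite uE h1 h2 setUC.
- by move=> x xB; rewrite H0// H1.
- have := injH 1; rewrite (_ : 1 \notin T); last first.
    by apply/negP => /T01; rewrite ltxx andbF.
  move=> /(_ isT) inj1 x x' xB x'B; have := inj1 x x' xB x'B.
  by rewrite !inE in xB x'B; rewrite !H1.
move=> t x xB; exists (covered E v tau t x); first exact: covered_range.
by rewrite /H vertex_moveE.
Qed.

(** * Composition of moves *)

Section time_changes.
Variable R : realType.

(** Velocities are multiplied by [k]. A relation between the new rows becomes one between the old
    rows when the coefficients of the two velocity rows are multiplied by [k]. Agreement near [t0']
    is enough, as needed for concatenations. *)
Lemma transversal_time_change (n q : nat) (D : set 'rV[R]_n) (Y : set 'rV[R]_q)
    (H H' : R -> 'rV[R]_n -> 'rV[R]_q) (t0 t0' k e : R) x u v :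
  k != 0 -> 0 < e ->
  (forall t, `|t - t0'| < e -> H' t = H (t0 + k * (t - t0'))) ->
  transversal_double_point D Y H t0 x u v ->
  transversal_double_point D Y H' t0' x u v.
Proof.
move=> k0 e0 HH' [phi1 [phi2 [psi [a1 [b1 [a2 [b2 [c1 c2 nr free]]]]]]]].
exists phi1, phi2, psi, a1, (k *: b1), a2, (k *: b2); split=> //.
  case: nr => -[U V] /= [U0 /nbhs_normP[d /= d0 dV] UV].
  have kp : 0 < `|k| by rewrite normr_gt0.
  exists (U, ball t0' (Num.min e (d / `|k|))) => /=.
    by split=> //; apply: nbhsx_ballx; rewrite lt_min e0 divr_gt0.
  move=> [s t] /= [Us]; rewrite -ball_normE /= lt_min distrC => /andP[te td].
  have Vt : V (t0 + k * (t - t0')).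
    apply: dV => /=; rewrite opprD addrA subrr add0r normrN normrM mulrC.
    by rewrite -ltr_pdivlMr.
  have [h1 h2] := UV (s, t0 + k * (t - t0')) (conj Us Vt).
  rewrite HH'// h1 h2 [t0 + _]addrC addrK.
  by split; congr (psi (_ + _)); rewrite scalerA mulrC.
apply: inj_row_free => z.
rewrite -[z]hsubmxK -[lsubmx z]hsubmxK -[rsubmx z]hsubmxK.
set k0' := lsubmx (lsubmx z); set k1 := rsubmx (lsubmx z).
set k2 := lsubmx (rsubmx z); set k3 := rsubmx (rsubmx z).
rewrite mul_row_col !mul_row_block !mulmx0 !mulmx1 !add0r.
rewrite add_row_mx => /eqP; rewrite -[X in _ == X]row_mx0 => /eqP/eq_row_mx[e1 e2].
have : row_mx (row_mx k0' (k *: k1)) (row_mx k2 (k *: k3)) *m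
    col_mx (block_mx a1 0 b1 (1%:M : 'M[R]_1)) (block_mx a2 0 b2 (1%:M : 'M[R]_1)) = 0.
  rewrite mul_row_col !mul_row_block !mulmx0 !mulmx1 !add0r add_row_mx.
  rewrite -scalerDr e2 scaler0 -[RHS]row_mx0; congr row_mx.
  by rewrite -!scalemxAl !scalemxAr.
rewrite -[X in _ = X](mul0mx _ (col_mx (block_mx a1 0 b1 (1%:M : 'M[R]_1)) (block_mx a2 0 b2 (1%:M : 'M[R]_1)))).
move=> /(row_free_inj free)/eqP.
rewrite -[X in _ == X]row_mx0 => /eqP/eq_row_mx[].
move=> /eqP; rewrite -[X in _ == X]row_mx0 => /eqP/eq_row_mx[-> /eqP].
rewrite scaler_eq0 (negPf k0)/= => /eqP ->.
move=> /eqP; rewrite -[X in _ == X]row_mx0 => /eqP/eq_row_mx[-> /eqP].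
by rewrite scaler_eq0 (negPf k0)/= => /eqP ->; rewrite !row_mx0.
Qed.

Lemma pl_time_change (n q : nat) (D : set 'rV[R]_n)
    (H : R -> 'rV[R]_n -> 'rV[R]_q) (k c : R) : k != 0 ->
  pl (cylinder D) (on_cylinder H) ->
  pl [set z : 'rV[R]_(n + 1) | D (lsubmx z) /\ 0 <= (rsubmx z 0 0 - c) / k <= 1]
     (on_cylinder (fun t => H ((t - c) / k))).
Proof.
move=> k0 plH.
pose M : 'M[R]_(n + 1) := block_mx 1%:M 0 0 (k%:M : 'M[R]_1).
pose N : 'M[R]_(n + 1) := block_mx 1%:M 0 0 (k^-1%:M : 'M[R]_1).
pose b : 'rV[R]_(n + 1) := row_mx 0 (c%:M : 'rV[R]_1).
pose d : 'rV[R]_(n + 1) := row_mx 0 ((- c / k)%:M : 'rV[R]_1).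
have ME (z : 'rV[R]_(n + 1)) : z *m M + b = row_mx (lsubmx z) ((rsubmx z 0 0 * k + c)%:M).
  rewrite -{1}[z]hsubmxK mul_row_block !mulmx0 mulmx1 addr0 add0r add_row_mx addr0.
  by rewrite mul_mx_scalar {1}(rV1P (rsubmx z)) scale_scalar_mx -raddfD/= mulrC.
have NE (z : 'rV[R]_(n + 1)) : z *m N + d = row_mx (lsubmx z) (((rsubmx z 0 0 - c) / k)%:M).
  rewrite -{1}[z]hsubmxK mul_row_block !mulmx0 mulmx1 addr0 add0r add_row_mx addr0.
  rewrite mul_mx_scalar {1}(rV1P (rsubmx z)) scale_scalar_mx -raddfD/= mulrC.
  by rewrite mulNr mulrBl.
have MN (z : 'rV[R]_(n + 1)) : (z *m M + b) *m N + d = z.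
  rewrite NE ME row_mxKl row_mxKr mxE eqxx mulr1n addrK mulfK//.
  by rewrite -rV1P hsubmxK.
have := pl_affine_image MN plH.
have -> : (fun x => x *m M + b) @` cylinder D =
   [set z : 'rV[R]_(n + 1) | D (lsubmx z) /\ 0 <= (rsubmx z 0 0 - c) / k <= 1].
  apply/seteqP; split=> z.
    case=> x [xD x01] <-; rewrite ME /= row_mxKl row_mxKr mxE eqxx mulr1n addrK mulfK//.
  move=> [zD z01]; exists (z *m N + d).
    by rewrite NE /cylinder/= row_mxKl row_mxKr mxE eqxx mulr1n.
  rewrite ME NE row_mxKl row_mxKr mxE eqxx mulr1n divfK// subrK.
  by rewrite -rV1P hsubmxK.
apply: eq_pl => z _; rewrite NE /on_cylinder row_mxKl row_mxKr mxE eqxx mulr1n//.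
Qed.

Lemma sqi_sym (n q : nat) (A : setting R n q) (k : nat)
    (f g : 'rV[R]_n -> 'rV[R]_q) :
  strongly_quasi_isotopic A k f g -> strongly_quasi_isotopic A k g f.
Proof.
move=> [H [T [[[plH [cH imH]] pH T01 eH dH] jH qH]]].
have flip (t : R) : 0 <= t <= 1 -> 0 <= 1 - t <= 1 by lra.
have TP t : t \in [seq 1 - t | t <- T] -> 1 - t \in T.
  by move=> /mapP[s sT ->]; rewrite subKr.
exists (fun t => H (1 - t)), [seq 1 - t | t <- T]; split.
- split.
  + have plH' : pl (cylinder (source A)) (on_cylinder (fun t => H (1 - t))).
      have := @pl_time_change _ _ _ _ (-1) 1 _ plH; rewrite oppr_eq0 oner_neq0 => /(_ isT).
      rewrite (_ : [set z | _] = cylinder (source A)).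
        by apply: eq_pl => z _; rewrite /on_cylinder invrN invr1 mulrN1 opprB.
      apply/seteqP; split=> z; rewrite /cylinder/= invrN invr1 mulrN1 opprB => -[? ?];
        by split=> //; lra.
    split; first exact: plH'.
    split; first exact: (pl_continuous plH').
    by move=> t /flip; exact: imH.
  + by move=> t /flip; exact: pH.
  + by move=> t /TP /T01; lra.
  + move=> t t01 tT; apply: eH; first exact: flip.
    by apply: contraNN tT => tT; apply/mapP; exists (1 - t) => //; rewrite subKr.
  + move=> t /TP tT; have [x [u [v [h1 h2]]]] := dH _ tT; exists x, u, v; split=> //.
    apply: (transversal_time_change (k := -1) _ ltr01 _ h2).
      by rewrite oppr_eq0 oner_neq0.
    by move=> t' _; congr H; ring.
- by move=> x xD; have [h0 h1] := jH x xD; rewrite subr0 subrr.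
by move=> t /TP; exact: qH.
Qed.

(** Both homotopies run at double speed. Exceptional times are interior, so none falls on the seam
    [t = 1 / 2], and each has a neighbourhood within its half. *)
Lemma sqi_trans (n q : nat) (A : setting R n q) (k : nat)
    (f g h : 'rV[R]_n -> 'rV[R]_q) :
  strongly_quasi_isotopic A k f g -> strongly_quasi_isotopic A k g h ->
  strongly_quasi_isotopic A k f h.
Proof.
move=> [H1 [T1 [[[plH1 [cH1 imH1]] pH1 T101 eH1 dH1] jH1 qH1]]].
move=> [H2 [T2 [[[plH2 [cH2 imH2]] pH2 T201 eH2 dH2] jH2 qH2]]].
pose H t := if t <= 2^-1 then H1 (2 * t) else H2 (2 * t - 1).
have HE1 t : t <= 2^-1 -> H t = H1 (2 * t) by rewrite /H => ->.
have HE2 t : 2^-1 < t -> H t = H2 (2 * t - 1) by rewrite /H ltNge => /negPf ->.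
pose T := [seq t / 2 | t <- T1] ++ [seq (t + 1) / 2 | t <- T2].
have TP t : t \in T -> (t < 2^-1 /\ 2 * t \in T1) \/ (2^-1 < t /\ 2 * t - 1 \in T2).
  rewrite mem_cat => /orP[] /mapP[s sT ->].
    have := T101 _ sT; left; split; first by lra.
    by rewrite mulrC divfK.
  have := T201 _ sT; right; split; first by lra.
  by rewrite mulrC divfK// addrK.
have TP1 t : 2 * t \in T1 -> t \in T.
  move=> tT; rewrite mem_cat; apply/orP; left; apply/mapP; exists (2 * t) => //.
  lra.
have TP2 t : 2 * t - 1 \in T2 -> t \in T.
  move=> tT; rewrite mem_cat; apply/orP; right; apply/mapP; exists (2 * t - 1) => //.
  lra.
exists H, T; split.
- split.
  + have plH : pl (cylinder (source A)) (on_cylinder H).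
      have p1 := @pl_time_change _ _ _ _ (2^-1) 0 _ plH1.
      have p2 := @pl_time_change _ _ _ _ (2^-1) (2^-1) _ plH2.
      have /p1 {}p1 : 2^-1 != 0 :> R by rewrite invr_eq0.
      have /p2 {}p2 : 2^-1 != 0 :> R by rewrite invr_eq0.
      have -> : cylinder (source A) = [set z | source A (lsubmx z) /\
          0 <= (rsubmx z 0 0 - 0) / 2^-1 <= 1] `|` [set z | source A (lsubmx z) /\
          0 <= (rsubmx z 0 0 - 2^-1) / 2^-1 <= 1].
        rewrite invrK; apply/seteqP; split=> z /=.
          move=> [zD z01]; have [zh|zh] := leP (rsubmx z 0 0) 2^-1; [left|right];
            by split=> //; lra.
        by case=> -[zD zz]; split=> //; lra.
      apply: pl_setU.
        apply: eq_pl p1 => z [zD zz]; rewrite /on_cylinder subr0 invrK HE1 ?[2 * _]mulrC//.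
        by move: zz; rewrite invrK; lra.
      apply: eq_pl p2 => z [zD zz]; rewrite /on_cylinder invrK.
      have [zh|zh] := leP (rsubmx z 0 0) 2^-1.
        rewrite HE1//; have -> : rsubmx z 0 0 = 2^-1 by move: zz; rewrite invrK; lra.
        by rewrite subrr mul0r mulfV// (jH1 _ zD).2 (jH2 _ zD).1.
      by rewrite HE2//; congr (H2 _ _); rewrite mulrBl mulVf// mulrC.
    split=> //; split; first exact: pl_continuous plH.
    move=> t t01; have [th|th] := leP t 2^-1.
      by rewrite HE1//; apply: imH1; lra.
    by rewrite HE2//; apply: imH2; lra.
  + move=> t t01; have [th|th] := leP t 2^-1.
      by rewrite HE1//; apply: pH1; lra.
    by rewrite HE2//; apply: pH2; lra.
  + by move=> t /TP[[th /T101]|[th /T201]]; lra.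
  + move=> t t01 tT; have [th|th] := leP t 2^-1.
      by rewrite HE1//; apply: eH1; [lra|apply: contraNN tT => /TP1].
    by rewrite HE2//; apply: eH2; [lra|apply: contraNN tT => /TP2].
  + move=> t /TP[[th tT]|[th tT]].
      have [x [u [v [h1 h2]]]] := dH1 _ tT; exists x, u, v.
      rewrite HE1; last by lra.
      split=> //; apply: (transversal_time_change (k := 2) (e := 2^-1 - t) _ _ _ h2).
      * by [].
      * by lra.
      * by move=> t'; rewrite ltr_norml => tt; rewrite HE1; [congr H1; ring|lra].
    have [x [u [v [h1 h2]]]] := dH2 _ tT; exists x, u, v.
    rewrite HE2; last by lra.
    split=> //; apply: (transversal_time_change (k := 2) (e := t - 2^-1) _ _ _ h2).
    * by [].
    * by lra.
    * by move=> t'; rewrite ltr_norml => tt; rewrite HE2; [congr H2; ring|lra].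
- move=> x xD; have [a1 a2] := jH1 x xD; have [b1 b2] := jH2 x xD.
  rewrite HE1; last by lra.
  rewrite mulr0 HE2; last by lra.
  by rewrite mulr1 (_ : 2 - 1 = 1 :> R); [split|lra].
move=> t /TP[[th tT]|[th tT]].
  by rewrite HE1; [exact: qH1|lra].
by rewrite HE2; [exact: qH2|lra].
Qed.

Lemma eq_sqi (n q : nat) (A : setting R n q) (k : nat)
    (f f' g g' : 'rV[R]_n -> 'rV[R]_q) :
  (forall x, source A x -> f x = f' x) -> (forall x, source A x -> g x = g' x) ->
  strongly_quasi_isotopic A k f g -> strongly_quasi_isotopic A k f' g'.
Proof.
move=> ff gg [H [T [gH jH qH]]]; exists H, T; split=> // x xD.
by rewrite -ff// -gg//; exact: jH.
Qed.

End time_changes.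

(** * Moving all vertices *)

Section sequence_of_moves.
Variables (R : realType) (n : nat) (E : seq ('rV[R]_n * 'rV[R]_n)).
Variables (pres : set ('rV[R]_n * 'rV[R]_3)) (k : nat).
Variables (L : 'rV[R]_n -> 'rV[R]_3) (eta : R).
Implicit Types P Q : 'rV[R]_n -> 'rV[R]_3.

Let A := Setting (body E) (@unit_ball R 3) pres.

Hypothesis complexE : complex E.
Hypothesis pres_vertex : forall z, pres z -> z.1 \in verts E.
Hypothesis smallE : forall e s, e \in E -> 0 <= s <= 1 ->
  `|L (edge_pt e s) - L e.1| < eta / 2 /\ `|L (edge_pt e s) - L e.2| < eta / 2.
Hypothesis quasi : forall (f : 'rV[R]_n -> 'rV[R]_3) x u v,
  pl (body E) f -> f @` body E `<=` @unit_ball R 3 ->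
  (forall z, body E z -> `|f z - L z| < eta) ->
  only_double_point (body E) f x u v -> strong_quasi_embedding A k f.

(** Half of [eta] is spent at the vertices; the other half is for the variation of [L] along an
    edge, bounded by [smallE]. *)
Definition good_position P : Prop :=
  [/\ set_inj (body E) (interp E P), forall u, u \in verts E -> `|P u| <= 1,
      forall u, u \in verts E -> `|P u - L u| < eta / 2 &
      forall z, pres z -> P z.1 = z.2].

Lemma good_position_link P : good_position P -> pl_link A (interp E P).
Proof.
move=> [injP cubeP _ presP]; split; last first.
  by move=> z zp; rewrite interp_vert ?presP//; exact: pres_vertex.
have plP := pl_interp complexE P.
split=> //; apply: compact_embedding => //.
- exact: compact_body.
- exact: pl_continuous plP.
move=> _ [_ [e [s [eE s01 ->]]] <-]; rewrite interpE//= /unit_ball/=.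
have e1 : e.1 \in verts E by rewrite mem_cat (map_f fst).
have e2 : e.2 \in verts E by rewrite mem_cat (map_f snd) ?orbT.
apply: le_trans (ler_normD _ _) _; rewrite !normrZ.
rewrite ger0_norm ?subr_ge0; last by lra.
rewrite (@ger0_norm _ s); last by lra.
have h1 : (1 - s) * `|P e.1| <= 1 - s by rewrite ler_piMr ?cubeP//; lra.
have h2 : s * `|P e.2| <= s by rewrite ler_piMr ?cubeP//; lra.
lra.
Qed.

Lemma convex_combination_lt q (a b c z : 'rV[R]_q) (r k1 k2 k3 : R) :
  0 <= k1 -> 0 <= k2 -> 0 <= k3 -> k1 + k2 + k3 = 1 ->
  `|a - z| < r -> `|b - z| < r -> `|c - z| < r ->
  `|k1 *: a + k2 *: b + k3 *: c - z| < r.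
Proof.
move=> k10 k20 k30 k1231 ha hb hc.
have -> : k1 *: a + k2 *: b + k3 *: c - z =
    k1 *: (a - z) + k2 *: (b - z) + k3 *: (c - z).
  have -> : k3 = 1 - k1 - k2 by lra.
  by apply/rowP => i; rewrite !mxE; ring.
pose M := Num.max `|a - z| (Num.max `|b - z| `|c - z|).
have Ma : `|a - z| <= M by rewrite /M le_max lexx.
have Mb : `|b - z| <= M by rewrite /M !le_max lexx orbT.
have Mc : `|c - z| <= M by rewrite /M !le_max lexx !orbT.
have Mr : M < r by rewrite /M !gt_max ha hb.
apply: le_lt_trans Mr.
apply: le_trans (ler_normD _ _) _; apply: le_trans (lerD (ler_normD _ _) (lexx _)) _.
rewrite !normrZ !ger0_norm//.
have := ler_wpM2l k10 Ma; have := ler_wpM2l k20 Mb; have := ler_wpM2l k30 Mc.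
by have : (k1 + k2 + k3) * M = M; [rewrite k1231 mul1r|lra].
Qed.

(** A point of a moving edge is a convex combination of [P a], [P v] and [y]. Each of these is
    within [eta / 2] of the value of [L] at an end of the edge, which in turn is within [eta / 2] of
    [L x]. *)
Lemma stage_close P v y x (g : R) : good_position P -> `|y - L v| < eta / 2 ->
  body E x -> 0 <= g <= interp E (hat v) x ->
  `|interp E P x + g *: (y - P v) - L x| < eta.
Proof.
move=> [_ _ closeP _] yv xB.
have [[a [s [av s01 xE]]]|[c [d [s [cd cv dv s01 xE]]]]] := body_star v xB.
  rewrite xE !interp_adjacent// /hat eqxx; have /eqP/negPf -> := adjacent_neq complexE av.
  have -> : (1 - s) *: (0 : R^o) + s *: (1 : R^o) = s.
    by rewrite scaler0 add0r; exact: mulr1.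
  move=> /andP[g0 gs]; have [aV vV] := adjacent_verts av.
  have -> : (1 - s) *: P a + s *: P v + g *: (y - P v) =
    (1 - s) *: P a + (s - g) *: P v + g *: y.
    by apply/rowP => i; rewrite !mxE; ring.
  have [la lv] : `|L (edge_pt (a, v) s) - L a| < eta / 2 /\
                 `|L (edge_pt (a, v) s) - L v| < eta / 2.
    case: av => [av|va]; first exact: (smallE av s01).
    rewrite edge_pt_swap; have s01' : 0 <= 1 - s <= 1 by lra.
    by have [] := smallE va s01'.
  have tri (u p : 'rV[R]_3) z : `|p - u| < eta / 2 -> `|z - u| < eta / 2 -> `|p - z| < eta.
    by move=> h1 h2; have := ler_distD u p z; rewrite (distrC u z); lra.
  apply: convex_combination_lt; try lra.
  - exact: tri (closeP a aV) la.
  - exact: tri (closeP v vV) lv.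
  - exact: tri yv lv.
rewrite xE !interp_adjacent// /hat; move/eqP/negPf: cv => ->; move/eqP/negPf: dv => ->.
rewrite !scaler0 addr0 -eq_le => /eqP <-; rewrite scale0r.
(* A third point of weight 0 brings static edges under the same lemma. *)
have -> : (0 : 'rV[R]_3) = 0 *: P c by rewrite scale0r.
have [cV dV] := adjacent_verts cd.
have [lc ld] : `|L (edge_pt (c, d) s) - L c| < eta / 2 /\
               `|L (edge_pt (c, d) s) - L d| < eta / 2.
  case: cd => [cd|dc]; first exact: (smallE cd s01).
  rewrite edge_pt_swap; have s01' : 0 <= 1 - s <= 1 by lra.
  by have [] := smallE dc s01'.
have tri (u p : 'rV[R]_3) z : `|p - u| < eta / 2 -> `|z - u| < eta / 2 -> `|p - z| < eta.
  by move=> h1 h2; have := ler_distD u p z; rewrite (distrC u z); lra.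
apply: convex_combination_lt; try lra.
- exact: tri (closeP c cV) lc.
- exact: tri (closeP d dV) ld.
- exact: tri (closeP c cV) lc.
Qed.

Definition moved P v y u := if u == v then y else P u.

Lemma good_move P v y : good_position P -> v \in verts E ->
  (forall z, pres z -> z.1 <> v) -> generic_position (verts E) P y ->
  `|y| < 1 -> `|y - L v| < eta / 2 ->
  good_position (moved P v y) /\
  strongly_quasi_isotopic A k (interp E P) (interp E (moved P v y)).
Proof.
move=> goodP vV presv gen cubey yv; have [injP cubeP closeP presP] := goodP.
have [|H [T [gH jH injQ HP]]] := @move_vertex R n E P v y pres complexE injP gen cubeP cubey.
  by move=> z zp; split; [exact: pres_vertex|exact: presv|exact: presP].
split.
  split=> //.
  - by move=> u uV; rewrite /moved; case: eqP => _; [exact: ltW|exact: cubeP].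
  - by move=> u uV; rewrite /moved; case: eqP => [->|_]; [|exact: closeP].
  - by move=> z zp; rewrite /moved; case: eqP => [/(presv _ zp)//|_]; exact: presP.
exists H, T; split=> // t tT; have [[plH [_ imH]] _ T01 _ dH] := gH.
have t01 : 0 <= t <= 1 by have := T01 t tT; lra.
have [x [u [w [dp _]]]] := dH t tT.
apply: quasi dp; first exact: pl_slice plH.
  exact: imH.
by move=> z zB; have [g g01 ->] := HP t z zB; exact: stage_close.
Qed.

(** The constant homotopy is the slide in direction 0, which is known to be PL. *)
Lemma sqi_refl P : good_position P ->
  strongly_quasi_isotopic A k (interp E P) (interp E P).
Proof.
move=> goodP; have [[plP embP] presP] := good_position_link goodP.
exists (fun=> interp E P), [::]; split=> //.
have plH : pl (cylinder (body E)) (on_cylinder (fun=> interp E P)).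
  have := pl_slide P (fun=> 0) (fun=> 0) 0 complexE; apply: eq_pl => z _.
  by rewrite /on_cylinder /slide scaler0 addr0.
split=> //; split=> //; split; first exact: pl_continuous plH.
by move=> t _; case: embP.
Qed.

(** One new position per vertex is generic for both links at once. Each link is moved there by
    itself, and afterwards the two agree on [S]. The map [Q] says where the vertices should go
    approximately. *)
Lemma moves_to_common_position (S : seq 'rV[R]_n) P0 P1 Q (e : R) : 0 < e ->
  (forall v, v \in S -> v \in verts E /\ forall z, pres z -> z.1 <> v) ->
  (forall v, v \in S -> `|Q v| <= 1 /\ `|Q v - L v| < eta / 2) ->
  good_position P0 -> good_position P1 ->
  exists P0' P1', [/\ good_position P0', good_position P1',
    strongly_quasi_isotopic A k (interp E P0) (interp E P0') /\
    strongly_quasi_isotopic A k (interp E P1) (interp E P1'),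
    forall v, v \in S -> P0' v = P1' v /\ `|P0' v - Q v| < e &
    forall v, v \notin S -> P0' v = P0 v /\ P1' v = P1 v].
Proof.
move=> e0; elim: S => [|v S IH] HS HQ good0 good1.
  by exists P0, P1; split=> //; split; exact: sqi_refl.
have [w wS|w wS|//|//|P0' [P1' [g0 g1 [s0 s1] same diff]]] := IH.
- by apply: HS; rewrite inE wS orbT.
- by apply: HQ; rewrite inE wS orbT.
(* The list may repeat a vertex, which is then already in place. *)
have [vS|vS] := boolP (v \in S).
  exists P0', P1'; split=> //.
    by move=> w; rewrite inE => /orP[/eqP->|]; exact: same.
  by move=> w; rewrite inE negb_or => /andP[_]; exact: diff.
have [vV presv] := HS v (mem_head _ _).
have [Qv1 QvL] := HQ v (mem_head _ _).
(* This radius keeps the new position within [eta / 2] of [L v] as well as within [e] of [Q v]. *)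
have m0 : 0 < Num.min e (eta / 2 - `|Q v - L v|) by rewrite lt_min e0 subr_gt0.
have [y [yQ y1 gen0 gen1]] := exists_generic_position (verts E) P0' P1' Qv1 m0.
move: yQ; rewrite lt_min => /andP[ye yL].
have yv : `|y - L v| < eta / 2 by have := ler_distD (Q v) y (L v); lra.
have [g0' s0'] := good_move g0 vV presv gen0 y1 yv.
have [g1' s1'] := good_move g1 vV presv gen1 y1 yv.
exists (moved P0' v y), (moved P1' v y); split=> //.
- by split; [exact: sqi_trans s0'|exact: sqi_trans s1'].
- move=> w; rewrite /moved inE; case: eqP => [->//|_ /= wS].
  exact: same.
move=> w; rewrite /moved inE; case: eqP => [->//|_ /= wS].
exact: diff.
Qed.

End sequence_of_moves.

(** The map [T] is where the vertices are sent. Applied with [L] as [T] it gives (a); applied with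
    another embedding near [L] it yields PL approximations of that embedding, which (b) requires.
    That [K] is embedded comes from the moves. *)
Theorem common_approximation (R : realType) (n : nat)
    (E0 : seq ('rV[R]_n * 'rV[R]_n)) (pres : set ('rV[R]_n * 'rV[R]_3)) (k : nat)
    (L L0 L1 T : 'rV[R]_n -> 'rV[R]_3) (eta e : R) :
  let A := Setting (body E0) (@unit_ball R 3) pres in
  complex E0 -> (forall z, pres z -> z.1 \in verts E0) -> 0 < eta ->
  {within body E0, continuous L} ->
  (forall (f : 'rV[R]_n -> 'rV[R]_3) x u v,
    pl (body E0) f -> f @` body E0 `<=` @unit_ball R 3 ->
    (forall z, body E0 z -> `|f z - L z| < eta) ->
    only_double_point (body E0) f x u v -> strong_quasi_embedding A k f) ->
  pl_link A L0 -> pl_link A L1 ->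
  c0_close A (eta / 2) L L0 -> c0_close A (eta / 2) L L1 ->
  {within body E0, continuous T} -> T @` body E0 `<=` @unit_ball R 3 ->
  respects_prescribed A T -> c0_close A (eta / 2) L T -> 0 < e ->
  exists K, [/\ pl_link A K, c0_close A e T K,
    strongly_quasi_isotopic A k L0 K & strongly_quasi_isotopic A k L1 K].
Proof.
move=> A cE0 presV eta0 cL quasi l0 l1 c0 c1 cT imT presT closeT e0.
have cpt : compact (body E0) by exact: compact_body.
have [[pl0 emb0] pres0] := l0; have [[pl1 emb1] pres1] := l1.
have [E1 r1 aff0] := pl_refinement cE0 pl0.
have [cE1 bE1 _ _] := r1.
have [|E2 r2 aff1] := @pl_refinement _ _ E1 _ L1 cE1; first by rewrite bE1.
have [cE2 bE2 _ _] := r2.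
have [d1 d10 HL] := compact_unif_continuous cpt cL (divr_gt0 eta0 (ltr0Sn _ 1)).
have [d2 d20 HT] := compact_unif_continuous cpt cT (divr_gt0 e0 (ltr0Sn _ 1)).
have [|E r3 mesh] := @mesh_refinement _ _ E2 (Num.min d1 d2) cE2.
  by rewrite lt_min d10.
have rE : refines E0 E := refines_trans (refines_trans r1 r2) r3.
have [cE bE vE _] := rE.
have {}aff0 : affine_on E L0.
  exact: affine_on_refines r3 (affine_on_refines r2 aff0).
have {}aff1 : affine_on E L1 by exact: affine_on_refines r3 aff1.
have edge_in x s : x \in E -> 0 <= s <= 1 -> body E0 (edge_pt x s).
  by move=> xE s01; rewrite -bE; exists x, s.
have edge_small x s : x \in E -> 0 <= s <= 1 ->
    `|edge_pt x s - x.1| < Num.min d1 d2 /\ `|edge_pt x s - x.2| < Num.min d1 d2.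
  move=> xE s01; have := mesh x xE; rewrite distrC => xm.
  have := edge_ptB x s 0; have := edge_ptB x s 1.
  rewrite edge_pt0 edge_pt1 subr0 => -> ->; rewrite !normrZ.
  have [sn sn1] : `|s| <= 1 /\ `|s - 1| <= 1 by rewrite !ler_norml; split; lra.
  by split; apply: le_lt_trans xm; rewrite ler_piMl.
have e1B x : x \in E -> body E0 x.1.
  by move=> xE; rewrite -(edge_pt0 x); apply: edge_in => //; rewrite lexx ler01.
have e2B x : x \in E -> body E0 x.2.
  by move=> xE; rewrite -(edge_pt1 x); apply: edge_in => //; rewrite lexx ler01.
have smallE x s : x \in E -> 0 <= s <= 1 ->
  `|L (edge_pt x s) - L x.1| < eta / 2 /\ `|L (edge_pt x s) - L x.2| < eta / 2.
  move=> xE s01; have := edge_small x s xE s01; rewrite !lt_min.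
  move=> [/andP[h1 _] /andP[h2 _]].
  by split; apply: HL => //; auto.
have smallT x s : x \in E -> 0 <= s <= 1 ->
  `|T (edge_pt x s) - T x.1| < e / 2 /\ `|T (edge_pt x s) - T x.2| < e / 2.
  move=> xE s01; have := edge_small x s xE s01; rewrite !lt_min.
  move=> [/andP[_ h1] /andP[_ h2]].
  by split; apply: HT => //; auto.
have AE : A = Setting (body E) (@unit_ball R 3) pres by rewrite /A bE.
have vB u : u \in verts E -> body E0 u by move=> /verts_body; rewrite bE.
have presVE z : pres z -> z.1 \in verts E by move=> /presV/vE.
have good f : affine_on E f -> pl_link A f -> c0_close A (eta / 2) L f ->
    good_position E pres L eta f.
  move=> aff [[plf embf] presf] cf; split.
  - move=> x x'; rewrite !inE => xB x'B; rewrite !affine_on_interp//.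
    have := embedding_inj embf (x := x) (y := x'); rewrite /= !inE -bE; exact.
  - by move=> u /vB uB; have [+ _ _] := embf; apply; exists u.
  - by move=> u /vB uB; rewrite distrC; exact: cf.
  - exact: presf.
have good0 := good _ aff0 l0 c0; have good1 := good _ aff1 l1 c1.
pose S := [seq u <- verts E | `[< forall z, pres z -> z.1 <> u >]].
have quasiE (f : 'rV[R]_n -> 'rV[R]_3) x u v : pl (body E) f ->
    f @` body E `<=` @unit_ball R 3 ->
    (forall z, body E z -> `|f z - L z| < eta) ->
    only_double_point (body E) f x u v ->
    strong_quasi_embedding (Setting (body E) (@unit_ball R 3) pres) k f.
  by rewrite bE; exact: quasi.
have e20 : 0 < e / 2 by rewrite divr_gt0.
have [||K0 [K1 [g0 g1 [s0 s1] same diff]]] := @moves_to_common_position R n E pres k L eta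
  cE presVE smallE quasiE S L0 L1 T (e / 2) e20 _ _ good0 good1.
- by move=> v; rewrite mem_filter => /andP[/asboolP].
- move=> v; rewrite mem_filter => /andP[_ /vB vB0]; split.
    by apply: imT; exists v.
  by rewrite distrC; exact: closeT.
(* The vertices outside [S] carry prescribed values, which both links share. *)
have eqK x : body E x -> interp E K1 x = interp E K0 x.
  apply: eq_interp => // v vV; have [vS|vS] := boolP (v \in S).
    by have [->] := same v vS.
  have [-> ->] := diff v vS; move: vS; rewrite mem_filter vV andbT => /asboolPn.
  move=> /existsNP[z /not_implyP[zp /contrapT <-]].
  by rewrite (pres0 _ zp) (pres1 _ zp).
have KT v : v \in verts E -> `|K0 v - T v| < e / 2.
  move=> vV; have [vS|vS] := boolP (v \in S).
    by have [_] := same v vS.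
  have [-> _] := diff v vS; move: vS; rewrite mem_filter vV andbT => /asboolPn.
  move=> /existsNP[z /not_implyP[zp /contrapT <-]].
  by rewrite (pres0 _ zp) (presT _ zp) subrr normr0.
exists (interp E K0); rewrite AE; split.
- exact: good_position_link g0.
- move=> x [a [s [aE s01 ->]]]; rewrite interpE// distrC.
  have a1 : a.1 \in verts E by rewrite mem_cat (map_f fst).
  have a2 : a.2 \in verts E by rewrite mem_cat (map_f snd) ?orbT.
  have [t1 t2] := smallT a s aE s01.
  have h1 : `|K0 a.1 - T (edge_pt a s)| < e.
    have := ler_distD (T a.1) (K0 a.1) (T (edge_pt a s)); have := KT _ a1.
    by rewrite (distrC (T a.1)); lra.
  have h2 : `|K0 a.2 - T (edge_pt a s)| < e.
    have := ler_distD (T a.2) (K0 a.2) (T (edge_pt a s)); have := KT _ a2.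
    by rewrite (distrC (T a.2)); lra.
  rewrite -[(1 - s) *: _ + _]addr0 -(scale0r (K0 a.1)).
  have /andP[sa sb] := s01.
  by apply: convex_combination_lt; rewrite ?subr_ge0 ?addr0 ?subrK.
- by apply: eq_sqi s0 => // x xB; exact: affine_on_interp.
- by apply: eq_sqi s1 => x xB; [exact: affine_on_interp|exact: eqK].
Qed.

(** * Maps close to an embedding *)

Lemma continuous_lsubmx (R : realType) (n1 n2 : nat) :
  continuous (lsubmx : 'rV[R]_(n1 + n2) -> 'rV[R]_n1).
Proof.
have -> : (lsubmx : 'rV[R]_(n1 + n2) -> 'rV[R]_n1) = fun z => z *m col_mx 1%:M 0 + 0.
  by apply/funext => z; rewrite -{2}[z]hsubmxK mul_row_col mulmx1 mulmx0 !addr0.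
exact: continuous_mulmx_row.
Qed.

Lemma continuous_rsubmx_coord (R : realType) (n : nat) :
  continuous (fun z : 'rV[R]_(n + 1) => rsubmx z 0 0).
Proof.
have -> : (fun z : 'rV[R]_(n + 1) => rsubmx z 0 0) =
    fun z => (z *m col_mx 0 1%:M + 0) 0 0.
  by apply/funext => z; rewrite -{2}[z]hsubmxK mul_row_col mulmx1 mulmx0 addr0 add0r.
exact: continuous_row_form.
Qed.

Lemma null_homotopic_in_convex (R : realType) (q : nat) (B C : set 'rV[R]_q) c :
  B `<=` C -> C c ->
  (forall (t : R) z, 0 <= t <= 1 -> C z -> C ((1 - t) *: z + t *: c)) ->
  null_homotopic_inclusion B C.
Proof.
move=> BC Cc convC; split=> //.
exists (fun t z => (1 - t) *: z + t *: c), c; split=> //.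
  split; last by move=> t t01 _ [z /BC Cz <-]; exact: convC.
  apply: continuous_subspaceT => z; rewrite /on_cylinder.
  have c1 : {for z, continuous (fun z : 'rV[R]_(q + 1) => rsubmx z 0 0)}.
    exact: continuous_rsubmx_coord.
  have c2 : {for z, continuous (lsubmx : 'rV[R]_(q + 1) -> 'rV[R]_q)}.
    exact: continuous_lsubmx.
  have h1 : {for z, continuous (fun z : 'rV[R]_(q + 1) => 1 - rsubmx z 0 0)}.
    by apply: continuousB => //; exact: cst_continuous.
  have h2 : {for z, continuous (fun z : 'rV[R]_(q + 1) => rsubmx z 0 0 *: c)}.
    by apply: continuousZr_tmp.
  have h3 : {for z, continuous (fun z : 'rV[R]_(q + 1) =>
      (1 - rsubmx z 0 0) *: (lsubmx z : 'rV[R]_q))}.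
    exact: (continuousZ h1 c2).
  exact: continuousD h3 h2.
by move=> z _; rewrite subr0 scale1r scale0r addr0 subrr scale0r add0r scale1r.
Qed.

(** In the sup norm both cubes are products of intervals, hence so is their intersection. Its sides
    have positive length because [x] is in the unit cube. *)
Lemma pl_ball_cubes (R : realType) (q : nat) (x : 'rV[R]_q) (rho : R) :
  `|x| <= 1 -> 0 < rho ->
  pl_ball q (@unit_ball R q) [set z | `|z - x| <= rho /\ `|z| <= 1].
Proof.
move=> /(ler_mxnorm _ ler01) x1 rho0.
pose lo i := Num.max (-1) (x 0 i - rho); pose hi i := Num.min 1 (x 0 i + rho).
have lohi i : lo i < hi i.
  rewrite gt_max !lt_min; have := x1 i; rewrite ler_norml => /andP[h1 h2].
  by apply/andP; split; apply/andP; split; lra.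
pose c : 'rV[R]_q := \row_i ((lo i + hi i) / 2).
pose h : 'rV[R]_q := \row_i ((hi i - lo i) / 2).
have h0 i : 0 < h 0 i by rewrite mxE; have := lohi i; lra.
have gE (z : 'rV[R]_q) i : (z *m diag_mx h + c) 0 i = z 0 i * h 0 i + c 0 i.
  by rewrite mul_mx_diag !mxE.
have boxP z : [set z | `|z - x| <= rho /\ `|z| <= 1] z <-> forall i, lo i <= z 0 i <= hi i.
  split.
    move=> [/(ler_mxnorm _ (ltW rho0)) zx /(ler_mxnorm _ ler01) z1] i.
    have := zx i; have := z1 i; rewrite !mxE !ler_norml => /andP[? ?] /andP[? ?].
    by rewrite ge_max le_min; apply/andP; split; apply/andP; split; lra.
  move=> H; split; [apply/(ler_mxnorm _ (ltW rho0)) => i|apply/(ler_mxnorm _ ler01) => i];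
  have := H i; rewrite ge_max le_min ?mxE ler_norml => /andP[/andP[? ?] /andP[? ?]]; lra.
have gbox (z : 'rV[R]_q) : `|z| <= 1 -> forall i, lo i <= (z *m diag_mx h + c) 0 i <= hi i.
  move=> /(ler_mxnorm _ ler01) z1 i; rewrite gE; have := z1 i; rewrite ler_norml.
  move=> /andP[z1' z2'].
  have a1 : -1 * h 0 i <= z 0 i * h 0 i by rewrite ler_pM2r.
  have a2 : z 0 i * h 0 i <= 1 * h 0 i by rewrite ler_pM2r.
  by move: a1 a2; rewrite !mxE; lra.
exists (fun z => z *m diag_mx h + c).
  apply: pl_embedding_affine.
    move=> z z' /= e; apply/rowP => i; have := congr1 (fun M : 'rV_q => M 0 i) e.
    rewrite /= !gE => /addIr; apply: mulIf; rewrite gt_eqF//; exact: h0.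
  by move=> z z1; have [] := (boxP (z *m diag_mx h + c)).2 (gbox z z1).
apply/seteqP; split=> z.
  by move=> [z' z1 <-]; apply/boxP; exact: gbox.
move=> /boxP zb; exists (\row_i ((z 0 i - c 0 i) / h 0 i)).
  apply/(ler_mxnorm _ ler01) => i; rewrite mxE ler_norml.
  rewrite ler_pdivlMr ?ler_pdivrMr ?h0//; have := zb i; rewrite !mxE; lra.
apply/rowP => i; rewrite gE !mxE divfK; first by rewrite subrK.
by rewrite gt_eqF//; have := h0 i; rewrite mxE.
Qed.

(** A uniform version of being a compact 1-manifold: all points within [d] of [u] lie in one arc of
    size [e]. The last clause provides the arc [J_0] that joins the two preimages of a double
    point. *)
Definition locally_arc (R : realType) (n : nat) (D : set 'rV[R]_n) : Prop :=
  forall e : R, 0 < e -> exists2 d : R, 0 < d & forall u, D u -> exists J,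
    [/\ exists a b, pl_arc D J a b,
        forall y, D y -> `|y - u| < d -> J y,
        forall y, J y -> D y /\ `|y - u| < e &
        forall a b, J a -> J b -> a <> b ->
          exists2 J0, J0 `<=` J & pl_arc D J0 a b].

Section quasi_embeddings.
Variables (R : realType) (n : nat) (D : set 'rV[R]_n).
Variables (L : 'rV[R]_n -> 'rV[R]_3).
Hypothesis compactD : compact D.
Hypothesis embL : embedding D setT L.
Hypothesis arcD : locally_arc D.

(** One stage in the construction of a strong quasi-embedding, with [r'] the radius of one cube and
    [r] that of the next. The radius [r'] also bounds the distance from [f] to [L], so it is chosen
    before [f]. *)
Let step (r r' : R) : Prop := forall (f : 'rV[R]_n -> 'rV[R]_3) u,
  (forall z, D z -> `|f z - L z| < r') -> D u -> exists J,
    [/\ exists a b, pl_arc D J a b,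
        forall z, D z -> `|f z - f u| <= r' -> J z,
        forall z, J z -> D z /\ `|f z - f u| <= r &
        forall a b, J a -> J b -> a <> b ->
          exists2 J0, J0 `<=` J & pl_arc D J0 a b].

Let exists_step r : 0 < r -> exists2 r', 0 < r' <= r & step r r'.
Proof.
move=> r0; have [_ cL [g gL cg]] := embL.
have r20 : 0 < r / 2 by rewrite divr_gt0.
have [e e0 He] := compact_unif_continuous compactD cL r20.
have [d d0 Hd] := arcD e0.
have [m m0 Hm] := compact_unif_continuous (continuous_compact cL compactD) cg d0.
have mr0 : 0 < Num.min r m by rewrite lt_min r0.
have mr : Num.min r m <= r by rewrite ge_min lexx.
have mm : Num.min r m <= m by rewrite ge_min lexx orbT.
(* Passing from [f] to [L] at two points costs [2 r']. With a quarter, [3 r'] stays below [m], the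
   modulus for the inverse of [L], and [r / 2 + 2 r'] is at most [r]. *)
exists (Num.min r m / 4); first by lra.
move: mr0 mr mm; set r' := Num.min r m => mr0 mr mm f u fL Du.
have [J [J1 J2 J3 J4]] := Hd u Du; exists J; split=> //.
  move=> z Dz zu; apply: J2 => //; rewrite -(gL z)// -(gL u)//.
  apply: Hm; [by exists z|by exists u|].
  have := ler_distD (f z) (L z) (L u); have := ler_distD (f u) (f z) (L u).
  by have := fL z Dz; have := fL u Du; rewrite (distrC (f z) (L z)); lra.
move=> z /J3[Dz zu]; split=> //; have Lzu := He z u Dz Du zu.
have := ler_distD (L z) (f z) (f u); have := ler_distD (L u) (L z) (f u).
by have := fL z Dz; have := fL u Du; rewrite (distrC (f u) (L u)); lra.
Qed.

(** The radii are computed downwards from 1 in [k + 1] steps, one for each of the arcs [J_0], ...,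
    [J_k], and the smallest one is [eta]. The arc of index [j] contains the preimage of the cube of
    radius [rho j] and is mapped into that of radius [rho j.+1]; convexity of the cubes gives the
    null-homotopies. *)
Lemma close_strong_quasi_embedding (pres : set ('rV[R]_n * 'rV[R]_3)) (k : nat) :
  exists2 eta : R, 0 < eta & forall (f : 'rV[R]_n -> 'rV[R]_3) x u v,
    pl D f -> f @` D `<=` @unit_ball R 3 ->
    (forall z, D z -> `|f z - L z| < eta) -> only_double_point D f x u v ->
    strong_quasi_embedding (Setting D (@unit_ball R 3) pres) k f.
Proof.
have /choice[nxt Hnxt] r : exists r', 0 < r -> 0 < r' <= r /\ step r r'.
  have [r0|//] := pselect (0 < r); last by exists 0.
  by have [r' h1 h2] := exists_step r0; exists r'.
pose rad i := iter i nxt 1.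
have rad0 i : 0 < rad i.
  by elim: i => [|i IH] //=; have [/andP[]] := Hnxt _ IH.
have radS i : 0 < rad i.+1 <= rad i /\ step (rad i) (rad i.+1) by exact: Hnxt.
(* The index is reversed: [rad] decreases, while the balls grow with their index. *)
pose rho j := rad (k.+1 - j)%N.
have rho0 j : 0 < rho j by exact: rad0.
have rhoS j : (j <= k)%N -> rho j <= rho j.+1 /\ step (rho j.+1) (rho j).
  by move=> jk; rewrite /rho subSS subSn//; have [/andP[]] := radS (k - j)%N.
have rho_ge j : (j <= k.+1)%N -> rho 0%N <= rho j.
  elim: j => [//|j IH] jk; apply: le_trans (IH (ltnW jk)) _.
  by have [] := rhoS j jk.
exists (rho 0%N); first exact: rho0.
move=> f x u v plf fB fL dp; have [[Du Dv] uv [fu fv] only] := dp.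
have /choice[J HJ] j : exists J : set 'rV[R]_n, (j <= k)%N ->
    [/\ exists a b, pl_arc D J a b,
        forall z, D z -> `|f z - f u| <= rho j -> J z,
        forall z, J z -> D z /\ `|f z - f u| <= rho j.+1 &
        forall a b, J a -> J b -> a <> b ->
          exists2 J0, J0 `<=` J & pl_arc D J0 a b].
  have [jk|jk] := leqP j k; last by exists set0.
  have [_ /(_ f u)[||J HJ]] := rhoS j jk => //; last by exists J.
  by move=> z Dz; apply: lt_le_trans (fL z Dz) (rho_ge j (leqW jk)).
have [_ J0in J0out J0sub] := HJ 0%N (leq0n k).
(* As [P_0] is a single point, the first arc can be cut down to its part between [u] and [v]. *)
have [J0 J0J arcJ0] : exists2 J0, J0 `<=` J 0%N & pl_arc D J0 u v.
  by apply: J0sub => //; apply: J0in => //; rewrite ?fu ?fv subrr normr0 ltW.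
pose P j := if j == 0%N then [set x] else [set z | `|z - x| <= rho j /\ `|z| <= 1].
pose J' j := if j == 0%N then J0 else J j.
have xB : `|x| <= 1 by rewrite -fu; apply: fB; exists u.
have J'D j : (j <= k)%N -> forall z, J' j z -> D z /\ `|f z - x| <= rho j.+1.
  rewrite /J' -fu => jk z; case: eqP => [->|_]; first by move=> /J0J /J0out.
  by have [_ _ + _] := HJ j jk; exact.
split=> //; exists x, u, v, P, J'; split=> //.
- by split=> // -[//|j] _; rewrite /P /=; exact: pl_ball_cubes.
- split=> // -[|j] jk; first by exists u, v.
  by have [+ _ _ _] := HJ _ jk.
- move=> [|j] jk z [/= Dz]; rewrite /P /J' /=.
    have [g [_ gJ g0 g1]] := arcJ0.
    move=> /= fz; have [zu|/eqP zu] := eqVneq z u.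
      by rewrite zu -g0 -gJ; exists 0 => //; rewrite /unit_interval/= mxE lexx ler01.
    have fzu : f z = f u by rewrite fz fu.
    have := only z u Dz Du zu fzu => e.
    have : [set u; v] z by rewrite -e; left.
    move=> [//|/= ->]; rewrite -g1 -gJ; exists 1%:M => //.
    by rewrite /unit_interval/= mxE eqxx ler01 lexx.
  by move=> [fz _]; have [_ + _ _] := HJ _ jk; apply; rewrite ?fu.
move=> j jk; apply: (@null_homotopic_in_convex _ _ _ _ x).
- move=> z; rewrite {2}/P /=; case=> [|[w Jw <-]].
    have [rj _] := rhoS j (ltnW jk).
    rewrite /P; case: eqP => [_ /= ->|_ /= [zx z1]]; first by rewrite subrr normr0 ltW.
    by split=> //; exact: le_trans rj.
  have [Dw fw] := J'D j (ltnW jk) w Jw.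
  by split=> //; apply: fB; exists w.
- by rewrite /P /= subrr normr0 ltW.
move=> t z /andP[t0 t1]; rewrite /P /= => -[zx z1].
have t1' : 0 <= 1 - t by lra.
split.
  have -> : (1 - t) *: z + t *: x - x = (1 - t) *: (z - x).
    by apply/rowP => i; rewrite !mxE; ring.
  rewrite normrZ ger0_norm//; apply: le_trans zx; rewrite ler_piMl//; lra.
apply: le_trans (ler_normD _ _) _; rewrite !normrZ !ger0_norm//.
have h1 : (1 - t) * `|z| <= 1 - t by rewrite ler_piMr.
have h2 : t * `|x| <= t by rewrite ler_piMr.
lra.
Qed.

End quasi_embeddings.

(** * Passage to a cube *)

Section transfer.
Variables (R : realType) (n q : nat) (A : setting R n q).
Variables (h : 'rV[R]_3 -> 'rV[R]_q) (g : 'rV[R]_q -> 'rV[R]_3).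

Let D := source A.
Let Y := target A.
Let B := @unit_ball R 3.

Hypothesis pwlh : pwl h.
Hypothesis pwlg : pwl g.
Hypothesis hY : forall z, B z -> Y (h z).
Hypothesis hK : forall z, B z -> g (h z) = z.
Hypothesis presK : forall z, prescribed A z -> h (g z.2) = z.2.

Definition cube_setting : setting R n 3 :=
  Setting D B [set (z.1, g z.2) | z in prescribed A].

Let h_inj z z' : B z -> B z' -> h z = h z' -> z = z'.
Proof. by move=> Bz Bz' e; rewrite -(hK Bz) -(hK Bz') e. Qed.

Lemma respects_transfer f : respects_prescribed cube_setting f ->
  respects_prescribed A (h \o f).
Proof.
move=> pf z zp; rewrite /= (pf (z.1, g z.2)); first exact: presK.
by exists z.
Qed.

Lemma embedding_transfer p (C : set 'rV[R]_p) f : embedding C B f ->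
  embedding C Y (h \o f).
Proof.
move=> [fB cf [i fi ci]]; split.
- by move=> _ [x Cx <-]; apply/hY/fB; exists x.
- apply: (within_comp cf fB); exact: pwl_continuous.
exists (i \o g).
  by move=> x Cx /=; rewrite hK ?fi//; apply: fB; exists x.
apply: (@within_comp _ _ _ _ _ (f @` C)) ci; first exact: pwl_continuous.
by move=> _ [_ [x Cx <-] <-] /=; rewrite hK; [exists x|apply: fB; exists x].
Qed.

Lemma pl_embedding_transfer p (C : set 'rV[R]_p) f : pl_embedding C B f ->
  pl_embedding C Y (h \o f).
Proof. by move=> [/pl_comp/(_ pwlh) ? /embedding_transfer]. Qed.

Lemma only_double_point_transfer f x u v : f @` D `<=` B ->
  only_double_point D f x u v -> only_double_point D (h \o f) (h x) u v.
Proof.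
move=> fB [Duv uv [fu fv] H]; split=> //; first by rewrite /= fu fv.
move=> u' v' Du' Dv' uv' e; apply: H => //.
by apply: h_inj => //; apply: fB; [exists u'|exists v'].
Qed.

(** The homotopy is conjugated by the chart: inside the cube, [g] inverts [h]. *)
Lemma null_homotopic_transfer C C' : C' `<=` B ->
  null_homotopic_inclusion C C' -> null_homotopic_inclusion (h @` C) (h @` C').
Proof.
move=> C'B [CC' [H [c [C'c [cH imH] jH]]]]; split.
  by move=> _ [z /CC' zC' <-]; exists z.
exists (fun t => h \o H t \o g), (h c); split.
- by exists c.
- split; last first.
    move=> t t01 _ [_ [z Cz <-] <-] /=; rewrite hK; last exact/C'B/CC'.
    by exists (H t z) => //; apply: (imH t t01); exists z.
  pose F (z : 'rV[R]_(q + 1)) : 'rV[R]_(3 + 1) := row_mx (g (lsubmx z)) (rsubmx z).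
  have cF : {within cylinder (h @` C), continuous F}.
    apply/withinP => z _ e e0; have /withinP cg := @pwl_continuous _ _ _ setT g pwlg.
    have [d d0 Hd] := cg (lsubmx z) I e e0.
    have de0 : 0 < Num.min d e by rewrite lt_min d0.
    exists (Num.min d e) => // y _; rewrite -{1}[z]hsubmxK -{1}[y]hsubmxK.
    rewrite opp_row_mx add_row_mx => /(norm_row_mx_lt _ _ de0).
    rewrite !lt_min => -[/andP[zy1 _] /andP[_ zy2]].
    rewrite /F opp_row_mx add_row_mx; apply/norm_row_mx_lt => //.
    by split=> //; exact: Hd.
  have Fim : F @` cylinder (h @` C) `<=` cylinder C.
    move=> _ [z [[x Cx hx] t01] <-]; rewrite /cylinder/= row_mxKl row_mxKr -hx.
    by rewrite hK//; exact/C'B/CC'.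
  have c1 := within_comp cF Fim cH.
  have c2 := @within_comp _ _ _ _ _ setT _ h c1 (@subsetT _ _) (pwl_continuous pwlh).
  rewrite (_ : on_cylinder _ = h \o (on_cylinder H \o F)) //.
  by apply/funext => z; rewrite /on_cylinder /F /= row_mxKl row_mxKr.
move=> _ [z Cz <-] /=; rewrite hK; last exact/C'B/CC'.
by have [-> ->] := jH z Cz.
Qed.

Lemma quasi_embedding_transfer k f :
  strong_quasi_embedding cube_setting k f -> strong_quasi_embedding A k (h \o f).
Proof.
move=> [plf fB [x [u [v [P [J [dp [P0 Pball] [J0 Jarc] PJ PP]]]]]]]; split.
- exact: pl_comp.
- by move=> _ [z Dz <-]; apply/hY/fB; exists z.
have [[Du Dv] uv [fu fv] only] := dp.
have xB : B x by rewrite -fu; apply: fB; exists u.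
have PB j : (j <= k)%N -> P j `<=` B.
  case: j => [|j] jk; first by rewrite P0 => _ ->.
  by have [e [_ [+ _ _]] <-] := Pball j.+1 jk.
exists (h x), u, v, (fun j => h @` P j), J; split=> //.
- exact: only_double_point_transfer.
- split; first by rewrite P0 image_set1.
  move=> j jk; have [e embe eP] := Pball j jk.
  by exists (h \o e); [exact: pl_embedding_transfer|rewrite -eP image_comp].
- move=> j jk z [Dz [y Py /= hy]]; apply: (PJ j jk); split=> //=.
  rewrite (_ : f z = y)//; apply: h_inj => //; first by apply: fB; exists z.
  exact: PB Py.
move=> j jk; have := null_homotopic_transfer (PB _ jk) (PP j jk).
by rewrite image_setU image_comp.
Qed.

(** The chart [psi] of the cube is followed by [h], so the affine descriptions of the two branches
    do not change. *)
Lemma transversal_transfer H t x u v :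
  transversal_double_point D B H t x u v ->
  transversal_double_point D Y (fun t => h \o H t) t (h x) u v.
Proof.
move=> [phi1 [phi2 [psi [a1 [b1 [a2 [b2 [c [embpsi psi0] nr free]]]]]]]].
exists phi1, phi2, (h \o psi), a1, b1, a2, b2; split=> //.
  by split; [exact: pl_embedding_transfer|rewrite /= psi0].
case: nr => UV nUV sUV; exists UV => // -[s t'] /sUV /= [-> ->] //.
Qed.

Lemma sqi_transfer k f0 f1 : strongly_quasi_isotopic cube_setting k f0 f1 ->
  strongly_quasi_isotopic A k (h \o f0) (h \o f1).
Proof.
move=> [H [T [[[plH [cH imH]] pH T01 eH dH] jH qH]]].
exists (fun t => h \o H t), T; split.
- have plhH : pl (cylinder D) (on_cylinder (fun t => h \o H t)).
    exact: (pl_comp plH pwlh).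
  split.
  + split=> //; split; first exact: pl_continuous plhH.
    by move=> t t01 _ [z Dz <-]; apply/hY/(imH t t01); exists z.
  + by move=> t t01; apply/respects_transfer/pH.
  + exact: T01.
  + by move=> t t01 tT; apply/embedding_transfer/eH.
  + move=> t tT; have [x [u [v [dp tr]]]] := dH t tT.
    exists (h x), u, v; split; last exact: transversal_transfer.
    apply: only_double_point_transfer => //; apply: imH.
    by have := T01 t tT; lra.
- by move=> x Dx /=; have [-> ->] := jH x Dx.
by move=> t tT; apply/quasi_embedding_transfer/qH.
Qed.

End transfer.

(** At the supremum of the times where [S] holds, the local hypothesis carries [S] from a time
    shortly before it to a later one, or to 1. *)
Lemma unit_interval_propagation (R : realType) (S : R -> Prop) :
  S 0 ->
  (forall t : R, 0 <= t <= 1 -> exists2 d : R, 0 < d & forall s s', 0 <= s <= 1 ->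
    0 <= s' <= 1 -> `|s - t| < d -> `|s' - t| < d -> S s -> S s') ->
  S 1.
Proof.
move=> S0 loc; pose X := [set t : R | 0 <= t <= 1 /\ S t].
have X0 : X 0 by split=> //; rewrite lexx ler01.
have supX : has_sup X by split; [exists 0|exists 1 => t [/andP[]]].
have sup01 : 0 <= sup X <= 1.
  apply/andP; split; first by apply: ub_le_sup X0; case: supX.
  by apply: ge_sup; [exists 0|move=> t [/andP[]]].
have [d d0 Hd] := loc _ sup01.
have [s [s01 Ss] sX] := sup_adherent d0 supX.
have ssup : s <= sup X by apply: ub_le_sup => //; case: supX.
have sd : `|s - sup X| < d by rewrite ltr_norml; lra.
have [sup1|sup1] := ltP (sup X) 1; last first.
  by apply: (Hd s 1) => //; rewrite ?lexx ?ler01// ltr_norml; lra.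
pose s' := Num.min 1 (sup X + d / 2).
have s'1 : s' <= 1 by rewrite /s' ge_min lexx.
have s'd : s' <= sup X + d / 2 by rewrite /s' ge_min lexx orbT.
have s's : sup X < s' by rewrite /s' lt_min; apply/andP; split; lra.
have : X s'.
  have s'01 : 0 <= s' <= 1 by lra.
  split=> //; apply: (Hd s s') => //; rewrite ltr_norml; lra.
move=> /(ub_le_sup supX.2); lra.
Qed.

(** * From local constancy to isotopies *)

Section local_to_global.
Variables (R : realType) (n q : nat) (A : setting R n q) (k : nat).

(** The first part is (a) for [L]. The second turns one PL link near [L] into PL approximations of
    any embedding [L'] near [L], within the same class; this is what travels along an isotopy. *)
Definition locally_quasi_constant (L : 'rV[R]_n -> 'rV[R]_q) : Prop :=
  exists2 e : R, 0 < e &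
    (forall L0 L1, pl_link A L0 -> pl_link A L1 ->
       c0_close A e L L0 -> c0_close A e L L1 ->
       strongly_quasi_isotopic A k L0 L1) /\
    (forall L0 L', pl_link A L0 -> top_link A L' ->
       c0_close A e L L0 -> c0_close A e L L' ->
       forall e', 0 < e' -> exists K, [/\ pl_link A K, c0_close A e' L' K &
         strongly_quasi_isotopic A k L0 K]).

Hypothesis compact_source : compact (source A).
Hypothesis compact_cyl : compact (cylinder (source A)).
Hypothesis local : forall L, top_link A L -> locally_quasi_constant L.

(** The property that is propagated is [S t]: the class of [L0] contains PL links arbitrarily close
    to stage [t]. At time 1 they are close to [L1], and the first part of local constancy
    finishes. *)
Lemma isotopic_quasi_isotopic L0 L1 : pl_link A L0 -> pl_link A L1 ->
  top_isotopic A L0 L1 -> strongly_quasi_isotopic A k L0 L1.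
Proof.
move=> l0 l1 [H [[cH imH] injH jH]].
have zD t x : source A x -> 0 <= t <= 1 -> cylinder (source A) (row_mx x t%:M).
  by move=> Dx t01; rewrite /cylinder/= row_mxKl row_mxKr mxE eqxx.
have onc t x : on_cylinder H (row_mx x t%:M) = H t x.
  by rewrite /on_cylinder row_mxKl row_mxKr mxE eqxx mulr1n.
have unif e : 0 < e -> exists2 d, 0 < d & forall s t x y, 0 <= s <= 1 -> 0 <= t <= 1 ->
    source A x -> source A y -> `|s - t| < d -> `|x - y| < d -> `|H s x - H t y| < e.
  move=> e0; have [d d0 Hd] := compact_unif_continuous compact_cyl cH e0.
  exists d => // s t x y s01 t01 Dx Dy st xy; rewrite -!onc.
  apply: Hd; [exact: zD|exact: zD|rewrite opp_row_mx add_row_mx].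
  by apply/norm_row_mx_lt => //; rewrite -raddfB/= norm_scalar_mx1.
have topH t : 0 <= t <= 1 -> top_link A (H t).
  move=> t01; have [inj pres] := injH t t01; split=> //.
  apply: compact_embedding => //; last exact: imH.
  apply/withinP => x Dx e e0; have [d d0 Hd] := unif e e0.
  by exists d => // y Dy xy; apply: Hd => //; rewrite subrr normr0.
have [jH0 jH1] : (forall x, source A x -> H 0 x = L0 x) /\
    (forall x, source A x -> H 1 x = L1 x).
  by split=> x Dx; have [] := jH x Dx.
pose S t := forall e, 0 < e -> exists K, [/\ pl_link A K, c0_close A e (H t) K &
  strongly_quasi_isotopic A k L0 K].
have t00 : (0 : R) <= (0 : R) <= 1 by rewrite lexx ler01.
have t11 : (0 : R) <= (1 : R) <= 1 by rewrite lexx ler01.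
have S0 : S 0.
  move=> e e0; have [e1 e10 [loc _]] := local (topH 0 t00).
  have c0 d : 0 < d -> c0_close A d (H 0) L0.
    by move=> d0 x Dx; rewrite jH0// subrr normr0.
  (* Reflexivity for [L0] is local constancy applied to [L0] twice. *)
  by exists L0; split; [|exact: c0|apply: loc; try exact: c0].
have S1 : S 1.
  apply: (unit_interval_propagation S0) => t t01.
  have [e e0 [_ loc]] := local (topH t t01).
  have [d d0 Hd] := unif _ (divr_gt0 e0 (ltr0Sn _ 1)).
  exists d => // s s' s01 s'01 st s't Ss e' e'0.
  have [K [lK cK sK]] := Ss _ (divr_gt0 e0 (ltr0Sn _ 1)).
  have close r x : 0 <= r <= 1 -> `|r - t| < d -> source A x -> `|H t x - H r x| < e / 2.
    by move=> r01 rt Dx; apply: Hd => //; rewrite ?subrr ?normr0// distrC.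
  have [||K' [lK' cK' sK']] := loc K (H s') lK (topH s' s'01) _ _ e' e'0.
  - move=> x Dx; have := ler_distD (H s x) (H t x) (K x).
    by have := cK x Dx; have := close s x s01 st Dx; lra.
  - by move=> x Dx; have := close s' x s'01 s't Dx; lra.
  by exists K'; split=> //; exact: sqi_trans sK'.
have [e e0 [loc _]] := local (topH 1 t11).
have [K [lK cK sK]] := S1 e e0.
apply: (sqi_trans sK); apply: loc => //.
by move=> x Dx; rewrite jH1// subrr normr0.
Qed.

End local_to_global.

(** The links and the embedding to be approximated are pulled into the cube by [g], handled there by
    [common_approximation], and returned by [h]. Closeness survives since [g] is uniformly
    continuous around the image of [L], and [h] on the cube. *)
Lemma chart_locally_quasi_constant (R : realType) (n q : nat) (A : setting R n q)
    (k : nat) (E0 : seq ('rV[R]_n * 'rV[R]_n)) (h : 'rV[R]_3 -> 'rV[R]_q)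
    (g : 'rV[R]_q -> 'rV[R]_3) (L : 'rV[R]_n -> 'rV[R]_q) (e1 : R) :
  complex E0 -> body E0 = source A -> locally_arc (source A) ->
  (forall z, prescribed A z -> z.1 \in verts E0) ->
  pwl h -> pwl g ->
  (forall z, @unit_ball R 3 z -> target A (h z) /\ g (h z) = z) ->
  top_link A L -> 0 < e1 ->
  (forall x y, source A x -> target A y -> `|L x - y| < e1 ->
    @unit_ball R 3 (g y) /\ h (g y) = y) ->
  locally_quasi_constant A k L.
Proof.
move=> cE0 bE0 arcD presV pwlh pwlg hP [embL presL] e10 near.
have cpt : compact (source A) by rewrite -bE0; exact: compact_body.
have hY z : @unit_ball R 3 z -> target A (h z) by move=> /hP[].
have hK z : @unit_ball R 3 z -> g (h z) = z by move=> /hP[].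
have srcP z : prescribed A z -> source A z.1.
  by move=> /presV/verts_body; rewrite bE0.
have nearA f x : embedding (source A) (target A) f -> source A x ->
    `|L x - f x| < e1 -> @unit_ball R 3 (g (f x)) /\ h (g (f x)) = f x.
  by move=> [fY _ _] Dx c; apply: (near x) => //; apply: fY; exists x.
have nearL x : source A x -> @unit_ball R 3 (g (L x)) /\ h (g (L x)) = L x.
  by move=> Dx; apply: nearA => //; rewrite subrr normr0.
have presK z : prescribed A z -> h (g z.2) = z.2.
  by move=> zp; rewrite -(presL z zp); have [_] := nearL _ (srcP z zp).
have gcont f : embedding (source A) (target A) f ->
    {within source A, continuous (g \o f)}.
  move=> [_ cf _]; apply: (within_comp cf (@subsetT _ _)).
  exact: pwl_continuous.
have gemb f : embedding (source A) (target A) f -> c0_close A e1 L f ->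
    embedding (source A) (@unit_ball R 3) (g \o f).
  move=> embf cf; apply: compact_embedding => //; first exact: gcont.
    by move=> _ [x Dx <-]; have [] := nearA f x embf Dx (cf x Dx).
  move=> x y; rewrite !inE => Dx Dy /= e.
  have [_ ex] := nearA f x embf Dx (cf x Dx).
  have [_ ey] := nearA f y embf Dy (cf y Dy).
  by apply: (embedding_inj embf); rewrite ?inE// -ex e.
have closeLL d : 0 < d -> c0_close A d L L by move=> d0 x _; rewrite subrr normr0.
have [_ cgL gLi] := gemb L embL (closeLL _ e10).
have embgL : embedding (source A) setT (g \o L) by [].
pose pres := [set (z.1, g z.2) | z in prescribed A].
have [eta eta0 quasi] := close_strong_quasi_embedding cpt embgL arcD pres k.
have [_ cL _] := embL.
have gT : {within setT, continuous g} by exact: pwl_continuous.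
have cimL : compact (L @` source A) := continuous_compact cL cpt.
have [d d0 Hd] := compact_unif_continuous_at cimL (@subsetT _ _) gT (divr_gt0 eta0 (ltr0Sn _ 1)).
pose e := Num.min d e1.
have e0 : 0 < e by rewrite lt_min d0.
have ed : e <= d by rewrite ge_min lexx.
have ee1 : e <= e1 by rewrite ge_min lexx orbT.
have close1 f : c0_close A e L f -> c0_close A e1 L f.
  by move=> cf x Dx; exact: lt_le_trans (cf x Dx) ee1.
have gclose f : c0_close A e L f -> c0_close (cube_setting A g) (eta / 2) (g \o L) (g \o f).
  move=> cf x Dx; apply: Hd; [by exists x|by []|exact: lt_le_trans (cf x Dx) ed].
have gres f : respects_prescribed A f -> respects_prescribed (cube_setting A g) (g \o f).
  by move=> pf _ [z zp <-] /=; rewrite pf.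
have glink f : pl_link A f -> c0_close A e L f -> pl_link (cube_setting A g) (g \o f).
  move=> [[plf embf] pf] cf; split; last exact: gres.
  by split; [exact: pl_comp|apply: gemb => //; exact: close1].
have main L0 L1 T e' : pl_link A L0 -> pl_link A L1 -> top_link A T ->
    c0_close A e L L0 -> c0_close A e L L1 -> c0_close A e L T -> 0 < e' ->
    exists K, [/\ pl_link A K, c0_close A e' T K,
      strongly_quasi_isotopic A k L0 K & strongly_quasi_isotopic A k L1 K].
  move=> l0 l1 [embT presT] c0 c1 cT e'0.
  have hcont : {within @unit_ball R 3, continuous h} by exact: pwl_continuous.
  have [d' d'0 Hd'] := compact_unif_continuous (@compact_unit_ball R 3) hcont e'0.
  have presV' z : pres z -> z.1 \in verts E0.
    by move=> [z' zp <-] /=; exact: presV.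
  have imT : (g \o T) @` source A `<=` @unit_ball R 3.
    by move=> _ [x Dx <-]; have [] := nearA T x embT Dx (close1 T cT x Dx).
  have := @common_approximation R n E0 pres k (g \o L) (g \o L0) (g \o L1) (g \o T) eta d'.
  rewrite bE0 => /(_ cE0 presV' eta0 cgL quasi (glink _ l0 c0) (glink _ l1 c1)
    (gclose _ c0) (gclose _ c1) (gcont _ embT) imT (gres _ presT) (gclose _ cT) d'0).
  move=> [K [[[plK embK] presK'] cK s0 s1]].
  have back f x : embedding (source A) (target A) f -> c0_close A e1 L f ->
      source A x -> (h \o (g \o f)) x = f x.
    by move=> embf cf Dx; have [_] := nearA f x embf Dx (cf x Dx).
  exists (h \o K); split.
  - split; last exact: (respects_transfer presK presK').
    by split; [exact: pl_comp|exact: (embedding_transfer pwlh pwlg hY hK embK)].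
  - move=> x Dx; rewrite -(back T)//; last exact: close1.
    apply: Hd'; [by apply: imT; exists x| |exact: cK].
    by have [+ _ _] := embK; apply; exists x.
  - apply: eq_sqi (sqi_transfer pwlh pwlg hY hK presK s0) => // x Dx.
    by apply: back => //; [have [[_]] := l0|exact: close1].
  - apply: eq_sqi (sqi_transfer pwlh pwlg hY hK presK s1) => // x Dx.
    by apply: back => //; [have [[_]] := l1|exact: close1].
exists e => //; split.
  move=> L0 L1 l0 l1 c0 c1.
  have [K [_ _ s0 s1]] := main L0 L1 L e l0 l1 (conj embL presL) c0 c1 (closeLL _ e0) e0.
  exact: sqi_trans s0 (sqi_sym s1).
move=> L0 L' l0 top' c0 c' e' e'0.
by have [K [lK cK s0 _]] := main L0 L0 L' e' l0 l0 top' c0 c0 c' e'0; exists K.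
Qed.

(** * Copies of the interval and of the circle *)

Section arcs.
Variables (R : realType) (n : nat) (D : set 'rV[R]_n).
Variables (c : R -> 'rV[R]_n) (l r : R).
Hypothesis pwlc : pwl (fun z : 'rV[R]_1 => c (z 0 0)).
Hypothesis cD : forall s, l <= s <= r -> D (c s).
Hypothesis injc : forall s s', l <= s <= r -> l <= s' <= r -> c s = c s' -> s = s'.

Definition subpath s s' (z : 'rV[R]_1) : 'rV[R]_n := c (s + z 0 0 * (s' - s)).

Lemma path_arc s s' : l <= s <= r -> l <= s' <= r -> s <> s' ->
  subpath s s' @` @unit_interval R `<=` c @` [set t | l <= t <= r] /\
  pl_arc D (subpath s s' @` @unit_interval R) (c s) (c s').
Proof.
move=> sl s'l ss'.
pose a (z : 'rV[R]_1) : R := s + z 0 0 * (s' - s).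
have a01 z : @unit_interval R z -> l <= a z <= r.
  rewrite /unit_interval/= => /andP[z0 z1]; rewrite /a.
  have [h|h] := leP s s'.
    have : 0 <= z 0 0 * (s' - s) by rewrite mulr_ge0// subr_ge0.
    have : z 0 0 * (s' - s) <= 1 * (s' - s) by rewrite ler_wpM2r// subr_ge0.
    by lra.
  have : 0 <= z 0 0 * (s - s') by rewrite mulr_ge0// subr_ge0 ltW.
  have : z 0 0 * (s - s') <= 1 * (s - s') by rewrite ler_wpM2r// subr_ge0 ltW.
  by lra.
pose g z := c (a z).
have pg : pl (@unit_interval R) g.
  rewrite unit_interval_hull.
  apply: (pl_hull (pwl_comp_affine ((s' - s)%:M) (s%:M) pwlc)) => z _.
  by rewrite /g /a mul_mx_scalar !mxE eqxx mulr1n addrC mulrC.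
split.
  by move=> _ [z z01 <-]; exists (a z) => //; exact: a01.
exists g; split=> //.
- split=> //; apply: compact_embedding.
  + by rewrite unit_interval_hull; exact: compact_hull.
  + exact: pl_continuous pg.
  + by move=> _ [z z01 <-]; apply/cD/a01.
  move=> z z'; rewrite !inE => z01 z'01 /(injc (a01 z z01) (a01 z' z'01)).
  move=> /addrI /mulIf e; rewrite (rV1P z) e -?rV1P// subr_eq0.
  by apply/eqP => /esym.
- by rewrite /g /a mxE mul0r addr0.
by rewrite /g /a mxE eqxx mulr1n mul1r addrCA subrr addr0.
Qed.

End arcs.

(** All arcs near [u] are taken from one injective PL path: the arc between two of its points is the
    path between their parameters, run in either direction. *)
Lemma locally_arc_paths (R : realType) (n : nat) (D : set 'rV[R]_n) :
  (forall e : R, 0 < e -> exists2 d : R, 0 < d & forall u, D u ->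
    exists (c : R -> 'rV[R]_n) (l r : R),
    [/\ l < r /\ pwl (fun z : 'rV[R]_1 => c (z 0 0)),
        forall s, l <= s <= r -> D (c s),
        forall s s', l <= s <= r -> l <= s' <= r -> c s = c s' -> s = s',
        forall y, D y -> `|y - u| < d -> exists2 s, l <= s <= r & y = c s &
        forall s, l <= s <= r -> `|c s - u| < e]) ->
  locally_arc D.
Proof.
move=> H e e0; have [d d0 Hd] := H e e0; exists d => // u Du.
have [c [l [r [[lr pc] cD injc near small]]]] := Hd u Du.
pose I := [set t : R | l <= t <= r].
have lI : l <= l <= r by rewrite lexx ltW.
have rI : l <= r <= r by rewrite lexx ltW.
have lr' : l <> r by apply/eqP; rewrite lt_eqF.
exists (c @` I); split.
- exists (c l), (c r).
  have [JI arc] := path_arc pc cD injc lI rI lr'.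
  suff -> : c @` I = subpath c l r @` @unit_interval R by [].
  apply/seteqP; split; last exact: JI.
  move=> _ [t /andP[lt tr] <-]; exists (((t - l) / (r - l))%:M).
    rewrite /unit_interval/= mxE eqxx mulr1n.
    by rewrite divr_ge0 ?ler_pdivrMr ?subr_gt0 ?subr_ge0 ?(ltW lr)//=; lra.
  rewrite /subpath mxE eqxx mulr1n divfK ?subr_eq0 ?gt_eqF//.
  by rewrite addrC subrK.
- by move=> y Dy yu; have [s sI ->] := near y Dy yu; exists s.
- by move=> _ [s sI <-]; split; [exact: cD|exact: small].
move=> _ _ [s sI <-] [s' s'I <-] ss'.
have neq : s <> s' by move=> e'; apply: ss'; rewrite e'.
have [J1 J2] := path_arc pc cD injc sI s'I neq.
by exists (subpath c s s' @` @unit_interval R).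
Qed.

Section interval_copies.
Variables (R : realType) (m : nat).

Definition interval_edge (j : 'I_m) : 'rV[R]_(1 + 1) * 'rV[R]_(1 + 1) :=
  (row_mx (j%:R%:M : 'rV[R]_1) (0%:M : 'rV[R]_1),
   row_mx (j%:R%:M : 'rV[R]_1) (1%:M : 'rV[R]_1)).

Definition interval_edges := [seq interval_edge j | j <- enum 'I_m].

Lemma interval_edge_pt j s : edge_pt (interval_edge j) s =
  row_mx (j%:R%:M : 'rV[R]_1) (s%:M : 'rV[R]_1).
Proof.
rewrite /edge_pt/= !scale_row_mx add_row_mx -scalerDl subrK scale1r.
by rewrite !scale_scalar_mx mulr0 mulr1 raddf0 add0r.
Qed.

Lemma scalar_mx1_inj : injective (fun a : R => a%:M : 'rV[R]_1).
Proof. by move=> a b /matrixP/(_ 0 0); rewrite !mxE eqxx !mulr1n. Qed.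

Lemma natr_ord_inj (i j : 'I_m) : i%:R = j%:R :> R -> i = j.
Proof. by move=> /eqP; rewrite eqr_nat => /eqP/val_inj. Qed.

Lemma natr_ord_close (i j : 'I_m) : `|i%:R - j%:R : R| < 1 -> i = j.
Proof.
move=> ij; apply/val_inj/eqP; rewrite eqn_leq; apply/andP.
move: ij; rewrite ltr_norml => /andP[h1 h2].
by split; rewrite -ltnS -(ltr_nat R) -natr1; lra.
Qed.

Lemma interval_complex : complex interval_edges.
Proof.
split.
  move=> _ /mapP[j _ ->] /= /eq_row_mx[_ /scalar_mx1_inj /eqP].
  by rewrite eq_sym oner_eq0.
move=> _ _ s r /mapP[j _ ->] /mapP[i _ ->] _ _; rewrite !interval_edge_pt.
by move=> /eq_row_mx[/scalar_mx1_inj/natr_ord_inj -> _]; left.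
Qed.

Lemma interval_body : body interval_edges = copies m (@unit_interval R).
Proof.
apply/seteqP; split=> x.
  move=> [_ [s [/mapP[j _ ->] s01 ->]]]; rewrite interval_edge_pt.
  by exists j => //; exists s%:M; rewrite // /unit_interval/= mxE eqxx.
move=> [j _ [z z01 <-]]; exists (interval_edge j), (z 0 0); split=> //.
  by apply/mapP; exists j; rewrite ?mem_enum.
by rewrite interval_edge_pt -rV1P.
Qed.

Lemma interval_verts (j : 'I_m) (i : bool) :
  row_mx (j%:R%:M : 'rV[R]_1) (i%:R%:M : 'rV[R]_1) \in verts interval_edges.
Proof.
have jE : interval_edge j \in interval_edges.
  by apply/mapP; exists j; rewrite ?mem_enum.
rewrite mem_cat; case: i; apply/orP; [right|left].
  exact: (map_f snd jE).
exact: (map_f fst jE).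
Qed.

Lemma interval_locally_arc : locally_arc (copies m (@unit_interval R)).
Proof.
(* With [d < 1] no point of another copy is near [u], as its first coordinate differs by at least
   1. *)
apply: locally_arc_paths => e e0; pose d := Num.min 1 e / 2.
have min0 : 0 < Num.min 1 e by rewrite lt_min ltr01.
have min1 : Num.min 1 e <= 1 by rewrite ge_min lexx.
have mine : Num.min 1 e <= e by rewrite ge_min lexx orbT.
have d0 : 0 < d by rewrite /d; lra.
have d1 : d < 1 by rewrite /d; lra.
have de : d < e by rewrite /d; lra.
exists d => // _ [j _ [x /andP[x0 x1] <-]]; set s0 := x 0 0 in x0 x1.
pose l := Num.max 0 (s0 - d); pose r := Num.min 1 (s0 + d).
have lP : [/\ 0 <= l, s0 - d <= l & (l <= 0 \/ l <= s0 - d)].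
  rewrite /l !le_max !ge_max lexx lexx orbT; split=> //.
  by case: (leP 0 (s0 - d)) => h; [right|left]; rewrite ?lexx ?andbT ?h// ltW.
have rP : [/\ r <= 1, r <= s0 + d & (1 <= r \/ s0 + d <= r)].
  rewrite /r !ge_min !le_min lexx lexx orbT; split=> //.
  by case: (leP 1 (s0 + d)) => h; [left|right]; rewrite ?lexx ?andbT ?h// ltW.
move: lP rP => [l0 l1 l2] [r1 r2 r3].
have inlr s : l <= s <= r -> 0 <= s <= 1 /\ `|s - s0| <= d.
  by move=> sl; rewrite ler_norml; split; lra.
exists (fun s => row_mx (j%:R%:M : 'rV[R]_1) (s%:M : 'rV[R]_1)), l, r; split.
- split; first by case: l2; case: r3; lra.
  have := @pwl_affine R 1 (1 + 1) (row_mx 0 1%:M) (row_mx j%:R%:M 0).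
  apply: eq_pwl => z; rewrite mul_mx_row mulmx0 mulmx1 add_row_mx add0r addr0.
  by rewrite -rV1P.
- move=> s /inlr[s01 _]; exists j => //; exists s%:M => //.
  by rewrite /unit_interval/= mxE eqxx.
- by move=> s s' _ _ /eq_row_mx[_ /scalar_mx1_inj].
- move=> _ [i _ [y /andP[y0 y1] <-]].
  rewrite opp_row_mx add_row_mx => /(norm_row_mx_lt _ _ d0)[].
  rewrite -raddfB/= norm_scalar_mx1 => ij yx.
  have -> : i = j by apply: natr_ord_close; exact: lt_trans d1.
  have : `|y 0 0 - s0| < d.
    by have := coord_le_norm (y - x) 0; rewrite !mxE => h; exact: le_lt_trans yx.
  rewrite ltr_norml => yd; exists (y 0 0); last by rewrite -rV1P.
  by rewrite /l /r ge_max le_min; apply/andP; split; apply/andP; split; lra.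
move=> s /inlr[_ sd]; rewrite (rV1P x) opp_row_mx add_row_mx subrr -raddfB/=.
apply/norm_row_mx_lt => //; rewrite normr0 norm_scalar_mx1; split=> //.
exact: le_lt_trans de.
Qed.

End interval_copies.

(** * The circle as the boundary of a square *)

Section circle_copies.
Variables (R : realType) (m : nat).

(** On a side of the square, [p] is the coordinate that is constant; this covers all four sides by
    one formula. *)
Definition plane_pt (p : 'I_2) (a b : R) : 'rV[R]_2 :=
  \row_i (if i == p then a else b).

Definition other (p : 'I_2) : 'I_2 := if p == 0 then 1 else 0.

Lemma other_neq p : (other p == p) = false.
Proof. by rewrite /other; case: (eqVneq p 0) => [->//|/negPf]; rewrite eq_sym. Qed.

Lemma ord2P (p i : 'I_2) : i = p \/ i = other p.
Proof.
rewrite /other; have I2 (k : 'I_2) : k = 0 \/ k = 1.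
  by case: k => [[|[|k]] hk] //; [left|right]; exact: val_inj.
by case: (I2 p) => ->; case: (I2 i) => ->; rewrite ?eqxx /=; auto.
Qed.

Lemma plane_ptl p a b : plane_pt p a b 0 p = a.
Proof. by rewrite mxE eqxx. Qed.

Lemma plane_ptr p a b : plane_pt p a b 0 (other p) = b.
Proof. by rewrite mxE other_neq. Qed.

Lemma plane_ptE p (x : 'rV[R]_2) : x = plane_pt p (x 0 p) (x 0 (other p)).
Proof.
by apply/rowP => i; rewrite mxE; case: (ord2P p i) => ->; rewrite ?eqxx ?other_neq.
Qed.

Lemma plane_pt_inj p a b a' b' :
  plane_pt p a b = plane_pt p a' b' -> a = a' /\ b = b'.
Proof.
move=> e; have := congr1 (fun x : 'rV_2 => x 0 p) e.
have := congr1 (fun x : 'rV_2 => x 0 (other p)) e.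
by rewrite /= !plane_ptl !plane_ptr.
Qed.

Lemma plane_ptB p a b a' b' :
  plane_pt p a b - plane_pt p a' b' = plane_pt p (a - a') (b - b').
Proof. by apply/rowP => i; rewrite !mxE; case: ifP. Qed.

Lemma norm_plane_pt_lt p a b c : 0 < c ->
  (`|plane_pt p a b| < c <-> `|a| < c /\ `|b| < c).
Proof.
move=> c0; split=> [/(ltr_mxnorm _ c0) H|[h1 h2]].
  by have := H p; have := H (other p); rewrite plane_ptl plane_ptr.
by apply/ltr_mxnorm => // i; rewrite mxE; case: ifP.
Qed.

Lemma norm_plane_pt_le p a b c : 0 <= c ->
  (`|plane_pt p a b| <= c <-> `|a| <= c /\ `|b| <= c).
Proof.
move=> c0; split=> [/(ler_mxnorm _ c0) H|[h1 h2]].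
  by have := H p; have := H (other p); rewrite plane_ptl plane_ptr.
by apply/ler_mxnorm => // i; rewrite mxE; case: ifP.
Qed.

Definition sg (b : bool) : R := if b then 1 else -1.

Lemma unit_sphereP (x : 'rV[R]_2) : @unit_sphere R 2 x <->
  exists p e b, `|b| <= 1 /\ x = plane_pt p (sg e) b.
Proof.
split.
  rewrite /unit_sphere/= => x1.
  have [p xp] : exists p, 1 <= `|x 0 p|.
    apply: contrapT => /forallNP H; have : `|x| < 1.
      by apply/ltr_mxnorm => // i; rewrite ltNge; apply/negP/H.
    by rewrite x1 ltxx.
  have xl i : `|x 0 i| <= 1 by rewrite -x1; exact: coord_le_norm.
  exists p, (0 <= x 0 p), (x 0 (other p)); split; first exact: xl.
  rewrite {1}(plane_ptE p x); congr plane_pt; have := xl p; move: xp.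
  by rewrite /sg; case: (leP 0 (x 0 p)) => h; rewrite ?(ger0_norm h) ?(ltr0_norm h); lra.
move=> [p [e [b [b1 ->]]]]; apply/eqP; rewrite eq_le; apply/andP; split.
  by apply/norm_plane_pt_le => //; rewrite /sg; case: e; rewrite ?normrN normr1.
have := coord_le_norm (plane_pt p (sg e) b) p; rewrite plane_ptl.
by rewrite /sg; case: e; rewrite ?normrN normr1.
Qed.

Definition side (j : 'I_m) (p : 'I_2) (e : bool) (b : R) : 'rV[R]_(1 + 2) :=
  row_mx (j%:R%:M : 'rV[R]_1) (plane_pt p (sg e) b).

Definition circle_edge (t : 'I_m * 'I_2 * bool) :
    'rV[R]_(1 + 2) * 'rV[R]_(1 + 2) :=
  (side t.1.1 t.1.2 t.2 (-1), side t.1.1 t.1.2 t.2 1).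

Definition circle_edges :=
  [seq circle_edge t | t <- enum {: 'I_m * 'I_2 * bool}].

Lemma circle_edge_pt t s :
  edge_pt (circle_edge t) s = side t.1.1 t.1.2 t.2 (2 * s - 1).
Proof.
rewrite /edge_pt/= /side !scale_row_mx add_row_mx -scalerDl subrK scale1r.
congr row_mx; apply/rowP => i; rewrite !mxE; case: ifP => _; ring.
Qed.

Lemma circle_complex : complex circle_edges.
Proof.
split.
  move=> _ /mapP[t _ ->] /= /eq_row_mx[_ /plane_pt_inj[_]]; lra.
move=> _ _ s r /mapP[[[j p] e] _ ->] /mapP[[[j' p'] e'] _ ->] s01 r01.
rewrite !circle_edge_pt /= => /eq_row_mx[/scalar_mx1_inj/natr_ord_inj -> h].
have [pp|pp] := ord2P p p'; move: h; rewrite pp => h.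
  left; have [ee _] := plane_pt_inj h; congr (circle_edge (_, _, _)).
  by move: ee; rewrite /sg; case: (e); case: (e') => //; lra.
right; split.
  have := congr1 (fun x : 'rV_2 => x 0 (other p)) h.
  by rewrite /= plane_ptr plane_ptl /sg; case: (e') => h'; [right|left]; lra.
have pE : p = other (other p).
  by case: (ord2P (other p) p) => // e2; have := other_neq p; rewrite -e2 eqxx.
have := congr1 (fun x : 'rV_2 => x 0 p) h.
rewrite /= plane_ptl {2}pE plane_ptr /sg; case: (e) => h'; [right|left]; lra.
Qed.

Lemma circle_body : body circle_edges = copies m (@unit_sphere R 2).
Proof.
apply/seteqP; split=> x.
  move=> [_ [s [/mapP[[[j p] e] _ ->] s01 ->]]]; rewrite circle_edge_pt.
  exists j => //; exists (plane_pt p (sg e) (2 * s - 1)) => //.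
  by apply/unit_sphereP; exists p, e, (2 * s - 1); split=> //; rewrite ler_norml; lra.
move=> [j _ [z /unit_sphereP[p [e [b [b1 ->]]]] <-]].
exists (circle_edge (j, p, e)), ((b + 1) / 2); split.
- by apply/mapP; exists (j, p, e) => //; rewrite mem_enum.
- by move: b1; rewrite ler_norml; lra.
rewrite circle_edge_pt /side/=; congr (row_mx _ (plane_pt _ _ _)).
by lra.
Qed.

(* Near the side where the coordinate [p] is [1] or [-1], the boundary of the
   square is parametrized by the other coordinate, continued around the two
   adjacent corners. *)
Let ca (s : R) : R := Num.min 1 (2 - Num.max s (- s)).
Let cb (s : R) : R := Num.max (-1) (Num.min 1 s).

Let cabP s : -2 <= s <= 2 ->
  [/\ ca s = 1 & cb s = s] /\ -1 <= s <= 1 \/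
  [/\ ca s = 2 - s & cb s = 1] /\ 1 < s \/ [/\ ca s = 2 + s & cb s = -1] /\ s < -1.
Proof.
move=> s2; rewrite /ca /cb.
have h11 : Num.max (-1) 1 = 1 :> R by rewrite max_r//; lra.
case: (leP s (- s)) => h1; case: (leP 1 s) => h2; case: (leP (-1) s) => h4;
  rewrite ?h11; case: (leP 1 (2 - _)) => h3; try (by exfalso; lra);
  first [by left; split; [split; lra|lra]|
    by right; left; split; [split; lra|lra]|
    by right; right; split; [split; lra|lra]].
Qed.

Let cab_id s : -1 <= s <= 1 -> ca s = 1 /\ cb s = s.
Proof.
move=> s1; have /cabP[[]//|] : -2 <= s <= 2 by lra.
by case=> -[_ ?]; exfalso; lra.
Qed.

Let cab_inj s s' : -2 <= s <= 2 -> -2 <= s' <= 2 ->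
  ca s = ca s' -> cb s = cb s' -> s = s'.
Proof.
move=> s2 s2' + +; have /cabP H := s2; have /cabP H' := s2'.
case: H => [[[-> ->] ?]|[[[-> ->] ?]|[[-> ->] ?]]];
case: H' => [[[-> ->] ?]|[[[-> ->] ?]|[[-> ->] ?]]] ? ?; lra.
Qed.

Let cab_norm s : -2 <= s <= 2 -> `|ca s| <= 1 /\ `|cb s| <= 1.
Proof.
rewrite !ler_norml => s2; have /cabP := s2.
by move=> [[[-> ->] ?]|[[[-> ->] ?]|[[-> ->] ?]]]; split; lra.
Qed.

Let cab_near s y0 d e : -1 <= y0 <= 1 -> d <= 1 / 4 -> 2 * d < e ->
  y0 - 2 * d <= s <= y0 + 2 * d -> `|ca s - 1| < e /\ `|cb s - y0| < e.
Proof.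
move=> y01 d1 de sd; rewrite !ltr_norml; have /cabP : -2 <= s <= 2 by lra.
by move=> [[[-> ->] ?]|[[[-> ->] ?]|[[-> ->] ?]]]; split; lra.
Qed.

Let cab_corner e (t : R) : 1 <= t <= 2 -> ca (sg e * t) = 2 - t /\ cb (sg e * t) = sg e.
Proof.
rewrite /sg; case: e => t12.
  have /cabP : -2 <= 1 * t <= 2 by lra.
  by move=> [[[-> ->] ?]|[[[-> ->] ?]|[[-> ->] ?]]]; lra.
have /cabP : -2 <= -1 * t <= 2 by lra.
by move=> [[[-> ->] ?]|[[[-> ->] ?]|[[-> ->] ?]]]; lra.
Qed.

(** A point within [d] of [u] is on the same side or, around a corner, on an adjacent one. In the
    second case the way is at most [d] to the corner and [d] beyond it, whence the parameter
    interval of radius [2 d]. The bound [1 / 4] excludes the opposite side and keeps parameters in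
    [[-2, 2]]. *)
Lemma circle_locally_arc : locally_arc (copies m (@unit_sphere R 2)).
Proof.
apply: locally_arc_paths => e e0; pose d := Num.min 1 e / 4.
have min0 : 0 < Num.min 1 e by rewrite lt_min ltr01.
have min1 : Num.min 1 e <= 1 by rewrite ge_min lexx.
have mine : Num.min 1 e <= e by rewrite ge_min lexx orbT.
have d0 : 0 < d by rewrite /d; lra.
have d1 : d <= 1 / 4 by rewrite /d; lra.
have de : 2 * d < e by rewrite /d; lra.
exists d => // _ [j _ [x /unit_sphereP[p [eps [y0 [y01 ->]]]] <-]].
move: y01; rewrite ler_norml => y01.
have sg2 b : sg b * sg b = 1 by rewrite /sg; case: b; rewrite ?mulrNN mulr1.
have sgn b : `|sg b| = 1 by rewrite /sg; case: b; rewrite ?normrN normr1.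
pose c s : 'rV[R]_(1 + 2) := row_mx (j%:R%:M : 'rV[R]_1) (plane_pt p (sg eps * ca s) (cb s)).
have s2 s : y0 - 2 * d <= s <= y0 + 2 * d -> -2 <= s <= 2 by lra.
exists c, (y0 - 2 * d), (y0 + 2 * d); split.
- split; first by lra.
  have pz : pwls (fun z : 'rV[R]_1 => z 0 0) by exact: pwls_coord.
  apply: pwl_coords => i; rewrite /c.
  rewrite (_ : (fun x => _) = fun z : 'rV[R]_1 =>
    match fintype.split i with inl _ => j%:R | inr i => if i == p then sg eps * ca (z 0 0) else cb (z 0 0) end).
    case: (fintype.split i) => [_|i']; first exact: pwls_cst.
    case: (i' == p).
      apply/pwls_mull/pwls_min; first exact: pwls_cst.
      apply: pwls_add; first exact: pwls_cst.
      by apply/pwls_opp/pwls_max => //; exact: pwls_opp.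
    by apply: pwls_max; [exact: pwls_cst|apply: pwls_min => //; exact: pwls_cst].
  apply/funext => z; rewrite mxE; case: (fintype.split i) => i'; rewrite mxE //.
  by rewrite !ord1 eqxx mulr1n.
- move=> s /s2 s_2; have H := cabP s_2; exists j => //; exists (plane_pt p (sg eps * ca s) (cb s)) => //.
  apply/eqP; rewrite eq_le; apply/andP; split.
    apply/norm_plane_pt_le => //; rewrite normrM sgn mul1r.
    exact: cab_norm.
  case: H => [[[Ha Hb] ?]|[[[Ha Hb] ?]|[[Ha Hb] ?]]].
  + have := coord_le_norm (plane_pt p (sg eps * ca s) (cb s)) p.
    by rewrite plane_ptl normrM sgn Ha normr1 !mulr1.
  + have := coord_le_norm (plane_pt p (sg eps * ca s) (cb s)) (other p).
    by rewrite plane_ptr Hb normr1.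
  + have := coord_le_norm (plane_pt p (sg eps * ca s) (cb s)) (other p).
    by rewrite plane_ptr Hb normrN normr1.
- move=> s s' /s2 H /s2 H' /eq_row_mx[_ /plane_pt_inj[e1 e2]].
  apply: cab_inj => //; have := congr1 (fun x => sg eps * x) e1.
  by rewrite !mulrA sg2 !mul1r.
- move=> _ [i _ [y /unit_sphereP yS <-]].
  rewrite opp_row_mx add_row_mx => /(norm_row_mx_lt _ _ d0)[].
  rewrite -raddfB/= norm_scalar_mx1 => ij.
  have -> : i = j by apply: natr_ord_close; lra.
  rewrite (plane_ptE p y) plane_ptB => /(norm_plane_pt_lt _ _ _ d0)[].
  rewrite !ltr_norml => ya yb.
  have yab : [/\ y 0 p = sg eps & `|y 0 (other p)| <= 1] \/
      [/\ `|y 0 p| <= 1 & exists e', y 0 (other p) = sg e'].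
    move: yS ya => [p' [e' [b [b1 ->]]]] ya.
    case: (ord2P p p') ya => [->|pp'].
      rewrite plane_ptl plane_ptr => ya; left; split=> //.
      move: ya; rewrite /sg; case: (e'); case: (eps) => //; lra.
    have pE : p = other p'.
      by case: (ord2P p' p) => // e2; have := other_neq p; rewrite -pp' e2 eqxx.
    move=> _; right; split; first by rewrite pE plane_ptr.
    by exists e'; rewrite -pp' plane_ptl.
  case: yab => [[ya1 yb1]|[ya1 [e' yb1]]].
    move: yb1; rewrite ler_norml => yb1; exists (y 0 (other p)); first by lra.
    have [ca_id cb_id] : ca (y 0 (other p)) = 1 /\ cb (y 0 (other p)) = y 0 (other p).
      exact: cab_id.
    rewrite /c ya1; congr (row_mx _ (plane_pt _ _ _)).
      by rewrite ca_id mulr1.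
    by rewrite cb_id.
  (* Up to sign, the parameter of a point beyond the corner: it is 1 at the corner and grows along
     the adjacent side. *)
  pose t := 2 - sg eps * y 0 p.
  have t1 : 1 <= t < 1 + d.
    rewrite /t; move: ya ya1; rewrite ler_norml /sg; case: (eps) => ? ?; lra.
  exists (sg e' * t).
    by move: yb; rewrite yb1 /sg; case: (e') => ?; lra.
  have [tE1 tE2] : ca (sg e' * t) = 2 - t /\ cb (sg e' * t) = sg e'.
    by apply: cab_corner; lra.
  rewrite /c tE1 tE2 yb1 /t.
  congr (row_mx _ (plane_pt _ _ _)).
  by rewrite opprB addrC subrK mulrA sg2 mul1r.
move=> s sd; rewrite /c opp_row_mx add_row_mx subrr plane_ptB.
apply/norm_row_mx_lt => //; rewrite normr0; split=> //.
apply/norm_plane_pt_lt => //.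
have -> : sg eps * ca s - sg eps = sg eps * (ca s - 1) by rewrite mulrBr mulr1.
by rewrite normrM sgn mul1r; exact: cab_near sd.
Qed.

End circle_copies.

(** * A chart of the sphere *)

Section sphere_chart.
Variables (R : realType) (z : 'rV[R]_3) (d : R).
Hypothesis d0 : 0 < d.
Hypothesis zd : forall i, `|z 0 i| + d < 1.

(** The slope of the middle piece: from the centre to the boundary of the cube of radius 4 it rises
    by [4 c = d], exactly the radius of the cap. *)
Let c : R := d / 4.
(** By [a i] from above and [b i] from below the interval [[-1, 1]] shrinks to the interval
    [[z 0 i - d, z 0 i + d]] of the cap. *)
Let a (i : 'I_3) : R := 1 - z 0 i - d.
Let b (i : 'I_3) : R := 1 + z 0 i - d.

Let ab0 i : 0 < a i /\ 0 < b i.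
Proof.
have := zd i; rewrite /a /b -ltrBrDr ltr_norml => /andP[h1 h2]; split; lra.
Qed.

Let d1 : d < 1. Proof. by have := zd 0; have := normr_ge0 (z 0 0); lra. Qed.

Let c0 : 0 < c. Proof. by rewrite divr_gt0. Qed.

(* For fixed [A], [B] and [k] an increasing homeomorphism of the line, which
   maps [[-1-t, 1+t]] onto [[lo, hi]] if [A = 1+t-hi] and [B = 1+t+lo]. *)
Definition squeeze (A B k y : R) : R := Num.max (y - A) (Num.min (y + B) (c * y + k)).

Definition unsqueeze (A B k p : R) : R :=
  Num.min (p + A) (Num.max (p - B) ((p - k) / c)).

(** The inverse of a maximum of increasing bijections of the line is the minimum of their inverses,
    and dually; [e1] and [e2] express this for the piece of slope [c]. *)
Lemma squeezeK A B k : cancel (squeeze A B k) (unsqueeze A B k).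
Proof.
move=> y; rewrite /squeeze /unsqueeze.
have e1 p : (p - k) / c <= y <-> p <= c * y + k.
  by rewrite ler_pdivrMr// lerBlDr [y * c]mulrC.
have e2 p : y <= (p - k) / c <-> c * y + k <= p.
  by rewrite ler_pdivlMr// lerBrDr [y * c]mulrC.
set p := Num.max _ _; apply/eqP; rewrite eq_le; apply/andP; split.
  rewrite ge_min; have : p <= y - A \/ p <= y + B /\ p <= c * y + k.
    rewrite /p !ge_max; have [h|h] := leP (Num.min (y + B) (c * y + k)) (y - A).
      by left; rewrite lexx.
    by right; rewrite !ge_min !lexx ?orbT !andbT; split; apply: le_trans (ltW h) _;
      rewrite ge_min lexx ?orbT.
  case=> [h|[h1 /e1 h2]]; first by apply/orP; left; lra.
  apply/orP; right; rewrite ge_max h2 andbT; lra.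
have pA : y - A <= p by rewrite /p le_max lexx.
rewrite le_min; apply/andP; split; first by lra.
rewrite le_max; have : Num.min (y + B) (c * y + k) <= p by rewrite /p le_max lexx orbT.
rewrite ge_min => /orP[h|/e2->]; last by rewrite orbT.
by apply/orP; left; lra.
Qed.

Lemma unsqueezeK A B k : cancel (unsqueeze A B k) (squeeze A B k).
Proof.
move=> p; rewrite /squeeze /unsqueeze.
have e1 y : (p - k) / c <= y <-> p <= c * y + k.
  by rewrite ler_pdivrMr// lerBlDr [y * c]mulrC.
have e2 y : y <= (p - k) / c <-> c * y + k <= p.
  by rewrite ler_pdivlMr// lerBrDr [y * c]mulrC.
set y := Num.min _ _; apply/eqP; rewrite eq_le; apply/andP; split.
  have yA : y <= p + A by rewrite /y ge_min lexx.
  rewrite ge_max; apply/andP; split; first by lra.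
  rewrite ge_min; have : y <= Num.max (p - B) ((p - k) / c).
    by rewrite /y ge_min lexx orbT.
  rewrite le_max => /orP[h|/e2->]; last by rewrite orbT.
  by apply/orP; left; lra.
rewrite le_max; have : p + A <= y \/ p - B <= y /\ (p - k) / c <= y.
  rewrite /y !le_min; have [h|h] := leP (p + A) (Num.max (p - B) ((p - k) / c)).
    by left; rewrite lexx.
  by right; rewrite !le_max !lexx ?orbT !andbT; split; apply: le_trans (ltW h);
    rewrite le_max lexx ?orbT.
case=> [h|[h1 /e1 h2]]; first by apply/orP; left; lra.
by apply/orP; right; rewrite le_min h2 andbT; lra.
Qed.

(* The unit sphere, which is the boundary of a cube, without the cap of radius
   [d] around [(z, 1)] is wrapped by the cube of radius 4: the points of norm
   [1 + t] go to height [t - 1] for [0 <= t <= 2], and for [t = 2 + tau] to the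
   boundary of a box in the top face, which shrinks to that of the cap. *)
Definition sphere_map (t tau : R) (y : 'rV[R]_3) : 'rV[R]_(3 + 1) :=
  row_mx (\row_i squeeze (t + tau * a i) (t + tau * b i) (tau * z 0 i) (y 0 i))
         ((Num.min t 2 - 1)%:M).

Definition sphere_unmap (t tau : R) (x : 'rV[R]_(3 + 1)) : 'rV[R]_3 :=
  \row_i unsqueeze (t + tau * a i) (t + tau * b i) (tau * z 0 i) (x 0 (lshift 1 i)).

(** With [extra], these are the [t] and [tau] of the wrapping; on the cube of radius 4 they reach 3
    and 1. *)
Definition depth (y : 'rV[R]_3) : R := Num.max 0 (`|y| - 1).
Definition extra (y : 'rV[R]_3) : R := Num.max 0 (depth y - 2).

Let u (x : 'rV[R]_(3 + 1)) (i : 'I_3) : R :=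
  Num.min ((a i)^-1 * (1 - x 0 (lshift 1 i))) ((b i)^-1 * (1 + x 0 (lshift 1 i))).

(** The value of [tau] read off from a point of the sphere: the largest [r] such that the point lies
    over the box of level [r] and at height at least [2 r] above the bottom. It vanishes on the
    bottom by the second condition and on the lateral faces by the first, so no case distinction is
    needed. *)
Definition coextra (x : 'rV[R]_(3 + 1)) : R :=
  Num.min (2^-1 * (x 0 (rshift 3 0) + 1))
    (Num.min (u x 0) (Num.min (u x 1) (u x 2))).

Definition codepth (x : 'rV[R]_(3 + 1)) : R := x 0 (rshift 3 0) + 1 + coextra x.

Let I3 (i : 'I_3) : [\/ i = 0, i = 1 | i = 2].
Proof.
by case: i => [[|[|[|k]]] hk] //; [constructor 1|constructor 2|constructor 3];
  exact: val_inj.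
Qed.

Let le_u x i r : r <= u x i <->
  r * a i <= 1 - x 0 (lshift 1 i) /\ r * b i <= 1 + x 0 (lshift 1 i).
Proof.
have [a0 b0] := ab0 i; rewrite /u le_min ![_^-1 * _]mulrC !ler_pdivlMr//.
by split=> [/andP|] // [-> ->].
Qed.

Let coextraP x r : r <= coextra x <-> 2 * r <= x 0 (rshift 3 0) + 1 /\
  forall i, r * a i <= 1 - x 0 (lshift 1 i) /\ r * b i <= 1 + x 0 (lshift 1 i).
Proof.
have le_min4 (k1 k2 k3 k4 : R) : (r <= Num.min k1 (Num.min k2 (Num.min k3 k4))) =
    [&& r <= k1, r <= k2, r <= k3 & r <= k4] by rewrite !le_min.
rewrite /coextra le_min4 [2^-1 * _]mulrC ler_pdivlMr// [r * 2]mulrC; split.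
  move=> /and4P[-> h0 h1 h2]; split=> // i; apply/le_u.
  by case: (I3 i) => ->.
by move=> [-> H]; rewrite !(le_u _ _ _).2//.
Qed.

Let coextra_attained x : [\/ 2 * coextra x = x 0 (rshift 3 0) + 1,
  exists i, coextra x * a i = 1 - x 0 (lshift 1 i) |
  exists i, coextra x * b i = 1 + x 0 (lshift 1 i)].
Proof.
have ui i : u x i * a i = 1 - x 0 (lshift 1 i) \/ u x i * b i = 1 + x 0 (lshift 1 i).
  have [a0 b0] := ab0 i; rewrite /u.
  by case: leP => _; [left|right]; rewrite mulrAC mulVf ?mul1r ?gt_eqF.
have [e|[i e]] : coextra x = 2^-1 * (x 0 (rshift 3 0) + 1) \/ exists i, coextra x = u x i.
  rewrite /coextra; case: leP => _; first by left.
  right; case: (leP (u x 0)) => _; first by exists 0.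
  by case: leP => _; [exists 1|exists 2].
  by constructor 1; rewrite e; lra.
by rewrite e; case: (ui i) => h; [constructor 2|constructor 3]; exists i.
Qed.

Let norm_attained (y : 'rV[R]_3) : 0 < `|y| -> exists i, `|y 0 i| = `|y|.
Proof.
move=> y0; apply: contrapT => /forallNP H; have : `|y| < `|y|; last by rewrite ltxx.
apply/ltr_mxnorm => // i; rewrite lt_neqAle coord_le_norm andbT; exact/eqP/H.
Qed.

(** Up to radius [3 + tau] the middle piece stays inside the box of level [tau]; equality at
    [tau = 1] reflects the choice of [c]. *)
Let key tau : 0 <= tau -> tau <= 1 -> c * (3 + tau) <= 1 - tau + tau * d.
Proof.
move=> t0 t1; have : 0 <= (1 - tau) * (1 - 3 / 4 * d).
  by apply: mulr_ge0; have := d1; lra.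
by rewrite /c; lra.
Qed.

(** For [t > 0] a coordinate of maximal absolute value is sent to an end of its box interval. This
    bounds [coextra] from above by [tau], and if [tau = 0] it puts the image on a lateral face of
    the cube. For [t = 0] the image is on the bottom, for [t = 2 + tau] on the top. *)
Lemma sphere_chart_inverse_data (y : 'rV[R]_3) : `|y| <= 4 ->
  let x := sphere_map (depth y) (extra y) y in
  [/\ `|x| = 1, coextra x = extra y & codepth x = depth y].
Proof.
move=> y4; set t := depth y; set tau := extra y; set x := sphere_map t tau y.
have t0 : 0 <= t by rewrite /t /depth le_max lexx.
have tau0 : 0 <= tau by rewrite /tau /extra le_max lexx.
have yt : `|y| <= 1 + t.
  by have : `|y| - 1 <= t; [rewrite /t /depth le_max lexx orbT|lra].
have t3 : t <= 3 by rewrite /t /depth ge_max; apply/andP; split; lra.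
have tau_t : t - 2 <= tau by rewrite /tau /extra le_max lexx orbT.
have tau1 : tau <= 1 by rewrite /tau /extra ge_max; apply/andP; split; rewrite -/t; lra.
have tauE : tau = 0 \/ t = 2 + tau.
  rewrite /tau /extra -/t; case: (leP 0 (t - 2)) => h; [right|left] => //; lra.
have ytE : t = 0 \/ `|y| = 1 + t.
  rewrite /t /depth; case: (leP 0 (`|y| - 1)) => h; [right|left] => //; lra.
have ct : c * (1 + t) <= 1 - tau + tau * d.
  case: tauE => [->|->]; last by have := key tau0 tau1; rewrite addrA; congr (c * _ <= _); lra.
  rewrite mul0r; have : c * (1 + t) <= c * 4 by rewrite ler_pM2l//; lra.
  by rewrite /c; have := d1; lra.
have yi i : - (1 + t) <= y 0 i <= 1 + t.
  by rewrite -ler_norml; apply: le_trans yt; exact: coord_le_norm.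
have cy i : - (c * (1 + t)) <= c * y 0 i <= c * (1 + t).
  by have := yi i; rewrite -mulrN !ler_pM2l.
have xi i : x 0 (lshift 1 i) = squeeze (t + tau * a i) (t + tau * b i) (tau * z 0 i) (y 0 i).
  by rewrite /x /sphere_map row_mxEl mxE.
have x4 : x 0 (rshift 3 0) = Num.min t 2 - 1.
  by rewrite /x /sphere_map row_mxEr mxE eqxx mulr1n.
have taua i : tau * a i = tau - tau * z 0 i - tau * d by rewrite /a; ring.
have taub i : tau * b i = tau + tau * z 0 i - tau * d by rewrite /b; ring.
have xhi i : x 0 (lshift 1 i) <= 1 - tau * a i.
  rewrite xi /squeeze ge_max ge_min; have := yi i; have := cy i; have := taua i.
  by move=> h1 h2 h3; apply/andP; split; [lra|apply/orP; right; lra].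
have xlo i : -1 + tau * b i <= x 0 (lshift 1 i).
  rewrite xi /squeeze le_max le_min; have := yi i; have := cy i; have := taub i.
  by move=> h1 h2 h3; apply/orP; right; apply/andP; split; lra.
have edge : t = 0 \/ exists i, x 0 (lshift 1 i) = 1 - tau * a i \/
    x 0 (lshift 1 i) = -1 + tau * b i.
  case: ytE => [->|ye]; [by left|right].
  have [|i ei] := @norm_attained y; first by rewrite ye; lra.
  exists i; move: ei; rewrite ye; have [h|h] := leP 0 (y 0 i).
    rewrite ger0_norm// => yE; left; apply/eqP; rewrite eq_le xhi/= xi /squeeze.
    by rewrite le_max; apply/orP; left; lra.
  rewrite ltr0_norm// => yE; right; apply/eqP; rewrite eq_le xlo andbT xi /squeeze.
  have ta : 0 <= tau * a i by rewrite mulr_ge0// ltW//; have [] := ab0 i.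
  have tb : 0 <= tau * b i by rewrite mulr_ge0// ltW//; have [] := ab0 i.
  by rewrite ge_max ge_min; apply/andP; split; [lra|apply/orP; left; lra].
have ta i : 0 <= tau * a i by rewrite mulr_ge0// ltW//; have [] := ab0 i.
have tb i : 0 <= tau * b i by rewrite mulr_ge0// ltW//; have [] := ab0 i.
have m2 : [/\ Num.min t 2 <= 2, Num.min t 2 <= t & 0 <= Num.min t 2].
  by rewrite !ge_min !lexx orbT le_min; split=> //; apply/andP; split; lra.
have m2E : Num.min t 2 = t - tau.
  case: tauE => e; first by rewrite min_l; lra.
  by rewrite min_r; lra.
have coE : coextra x = tau.
  apply/eqP; rewrite eq_le; apply/andP; split; last first.
    apply/coextraP; split; first by rewrite x4 m2E; case: tauE => ->; lra.
    by move=> i; have := xhi i; have := xlo i; split; lra.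
  have /coextraP := lexx (coextra x); rewrite x4 m2E => -[h4 H].
  case: edge => [t00|[i ei]]; first by lra.
  have [h1 h2] := H i; have [a0 b0] := ab0 i.
  case: ei => ei.
    by rewrite -(ler_pM2r a0); lra.
  by rewrite -(ler_pM2r b0); lra.
split=> //; last by rewrite /codepth coE x4 m2E; lra.
have x4n : `|(Num.min t 2 - 1)%:M : 'rV[R]_1| <= 1.
  by rewrite norm_scalar_mx1 ler_norml; case: m2 => *; lra.
apply/eqP; rewrite eq_le; apply/andP; split.
  apply/norm_row_mx_le => //; split=> //; apply/ler_mxnorm => // i.
  rewrite mxE -xi ler_norml; have := xhi i; have := xlo i; have := ta i; have := tb i.
  by move=> *; apply/andP; split; lra.
case: edge => [t00|[i ei]].
  have := coord_le_norm x (rshift 3 0); rewrite x4 t00 min_l// sub0r normrN normr1//.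
case: tauE => [tau00|tE].
  have := coord_le_norm x (lshift 1 i); apply: le_trans.
  case: ei => ->; rewrite tau00 mul0r ?subr0 ?addr0 ?normrN normr1//.
have := coord_le_norm x (rshift 3 0); apply: le_trans; rewrite x4 min_r; last by lra.
by rewrite (_ : 2 - 1 = 1 :> R) ?normr1//; lra.
Qed.

(** Surjectivity onto the complement of the open cap. Again a coordinate at an end of its box
    interval is found, here to compute the norm of the preimage. *)
Lemma sphere_chart_data (x : 'rV[R]_(3 + 1)) : `|x| = 1 ->
  ~ (x 0 (rshift 3 0) = 1 /\ forall i, `|x 0 (lshift 1 i) - z 0 i| < d) ->
  let y := sphere_unmap (codepth x) (coextra x) x in
  [/\ `|y| <= 4, depth y = codepth x, extra y = coextra x &
      Num.min (codepth x) 2 - 1 = x 0 (rshift 3 0)].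
Proof.
move=> x1 ncap; set t := codepth x; set tau := coextra x; set y := sphere_unmap _ _ _.
set x4 := x 0 (rshift 3 0) in ncap *; pose p i := x 0 (lshift 1 i).
have xin k : -1 <= x 0 k <= 1 by rewrite -ler_norml -x1 coord_le_norm.
have x4in : -1 <= x4 <= 1 by exact: xin.
have pin i : -1 <= p i <= 1 by exact: xin.
have tau0 : 0 <= tau.
  apply/coextraP; rewrite -/x4; split; first by lra.
  by move=> i; rewrite !mul0r; have := pin i; rewrite /p; split; lra.
have /coextraP := lexx (coextra x); rewrite -/tau -/x4 => -[tau4 H].
have tau1 : tau <= 1 by lra.
have tE : t = x4 + 1 + tau by [].
have ta i : 0 <= tau * a i by rewrite mulr_ge0// ltW//; have [] := ab0 i.
have tb i : 0 <= tau * b i by rewrite mulr_ge0// ltW//; have [] := ab0 i.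
have taua i : tau * a i = tau - tau * z 0 i - tau * d by rewrite /a; ring.
have taub i : tau * b i = tau + tau * z 0 i - tau * d by rewrite /b; ring.
have face : [\/ x4 = -1, x4 = 1 | exists i, p i = 1 \/ p i = -1].
  apply: contrapT => nf; have : `|x| < 1; last by rewrite x1 ltxx.
  apply/ltr_mxnorm => // k; rewrite ltr_norml !lt_neqAle.
  have /andP[-> ->] := xin k; rewrite !andbT.
  rewrite -(splitK k); case: (fintype.split k) => [i|i] /=.
    by apply/andP; split; apply/eqP => e; apply: nf; constructor 3; exists i; [right|left].
  rewrite ord1; apply/andP; split; apply/eqP => e; apply: nf.
    by constructor 1.
  by constructor 2.
have tau_or : tau = 0 \/ x4 = 1.
  case: face => [e|e|[i ei]]; [left; lra|by right|left].
  have [a0 b0] := ab0 i; have [h1 h2] := H i; case: ei => ei.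
    by apply/eqP; rewrite -(mulIr_eq0 _ (mulIf (lt0r_neq0 a0))) eq_le ta andbT; move: h1; rewrite -/(p i) ei; lra.
  by apply/eqP; rewrite -(mulIr_eq0 _ (mulIf (lt0r_neq0 b0))) eq_le tb andbT; move: h2; rewrite -/(p i) ei; lra.
have t0 : 0 <= t by lra.
have t3 : t <= 3 by lra.
have yiE i : y 0 i = unsqueeze (t + tau * a i) (t + tau * b i) (tau * z 0 i) (p i).
  by rewrite mxE.
have yhi i : y 0 i <= 1 + t.
  by rewrite yiE /unsqueeze ge_min; have [h1 _] := H i; apply/orP; left; rewrite /p; lra.
have ylo i : - (1 + t) <= y 0 i.
  rewrite yiE /unsqueeze le_min le_max; have [_ h2] := H i; have := pin i; have := ta i.
  by rewrite /p => *; apply/andP; split; [lra|apply/orP; left; lra].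
have ct : tau = 0 \/ x4 = 1 -> c * (1 + t) <= 1 - tau + tau * d.
  case=> [e|e]; last by have := key tau0 tau1; rewrite tE e; congr (c * _ <= _); lra.
  rewrite e mul0r; have : c * (1 + t) <= c * 3 by rewrite ler_pM2l//; lra.
  by rewrite /c; have := d1; lra.
have {}ct := ct tau_or.
have edge : t = 0 \/ exists i, tau * a i = 1 - p i \/ tau * b i = 1 + p i.
  have [x41|x41] := eqVneq x4 1.
    right; have [e|[i e]|[i e]] := coextra_attained x; rewrite -/tau -/x4 in e;
      [|by exists i; left|by exists i; right].
    (* On the top face with the height bound attained, the point is in the closed box of the cap.
       Being outside the open cap, it is on the boundary of this box. *)
    have tau_1 : tau = 1 by lra.
    have /existsNP[i Hi] : ~ forall i, `|x 0 (lshift 1 i) - z 0 i| < d.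
      by move=> Hi; apply: ncap.
    exists i; have [h1 h2] := H i; move: Hi; rewrite ltr_norml => Hi.
    have := taua i; have := taub i; rewrite tau_1 /p => h3 h4.
    rewrite tau_1 in h1 h2; have [h|h] := leP d (x 0 (lshift 1 i) - z 0 i).
      by left; lra.
    right; have : x 0 (lshift 1 i) - z 0 i <= - d.
      by rewrite leNgt; apply/negP => h'; apply: Hi; rewrite h h'.
    by lra.
  have tau00 : tau = 0 by case: tau_or => // e; rewrite e eqxx in x41.
  case: face => [e|e|[i ei]]; first by left; lra.
    by rewrite e eqxx in x41.
  by right; exists i; rewrite tau00 !mul0r; case: ei => ->; [left|right]; lra.
have normy : `|y| = 1 + t \/ t = 0 /\ `|y| <= 1.
  have yle : `|y| <= 1 + t.
    by apply/ler_mxnorm => [|i]; [lra|rewrite ler_norml yhi ylo].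
  case: edge => [e|[i ei]]; first by right; split=> //; lra.
  left; apply/eqP; rewrite eq_le yle /=; have := coord_le_norm y i; apply: le_trans.
  have [h1 h2] := H i.
  have cd (r : R) : r <= (p i - tau * z 0 i) / c <-> c * r <= p i - tau * z 0 i.
    by rewrite ler_pdivlMr// [r * c]mulrC.
  have dc (r : R) : (p i - tau * z 0 i) / c <= r <-> p i - tau * z 0 i <= c * r.
    by rewrite ler_pdivrMr// [r * c]mulrC.
  have := taua i; have := taub i => h3 h4; case: ei => ei.
    apply: le_trans (ler_norm _); rewrite yiE /unsqueeze le_min le_max.
    apply/andP; split; first by lra.
    by apply/orP; right; apply/cd; lra.
  rewrite -normrN; apply: le_trans (ler_norm _); rewrite lerNr yiE /unsqueeze.
  rewrite ge_min ge_max; apply/orP; right; apply/andP; split; first by lra.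
  by apply/dc; rewrite mulrN; lra.
have dE : depth y = t.
  rewrite /depth; case: normy => [->|[-> h]]; first by rewrite max_r; lra.
  by rewrite max_l//; lra.
split=> //.
- by case: normy => [->|[_ h]]; lra.
- rewrite /extra dE; case: tau_or => e; first by rewrite max_l; lra.
  by rewrite max_r; lra.
case: tau_or => e; first by rewrite min_l; lra.
by rewrite min_r; lra.
Qed.

Definition sphere_param (y : 'rV[R]_3) : 'rV[R]_(3 + 1) :=
  sphere_map (depth (4 *: y)) (extra (4 *: y)) (4 *: y).

Definition sphere_coord (x : 'rV[R]_(3 + 1)) : 'rV[R]_3 :=
  4^-1 *: sphere_unmap (codepth x) (coextra x) x.

Lemma sphere_paramK (y : 'rV[R]_3) : `|y| <= 1 ->
  `|sphere_param y| = 1 /\ sphere_coord (sphere_param y) = y.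
Proof.
move=> y1; have y4 : `|4 *: y| <= 4 by rewrite normrZ ger0_norm//; lra.
have [h1 h2 h3] := sphere_chart_inverse_data y4; split=> //.
rewrite /sphere_coord /sphere_param h2 h3; apply/rowP => i.
by rewrite mxE mxE row_mxEl mxE squeezeK mxE mulKf.
Qed.

Lemma sphere_coordK (x : 'rV[R]_(3 + 1)) : `|x| = 1 ->
  ~ (x 0 (rshift 3 0) = 1 /\ forall i, `|x 0 (lshift 1 i) - z 0 i| < d) ->
  `|sphere_coord x| <= 1 /\ sphere_param (sphere_coord x) = x.
Proof.
move=> x1 ncap; have [h1 h2 h3 h4] := sphere_chart_data x1 ncap; split.
  by rewrite /sphere_coord normrZ ger0_norm ?invr_ge0//; lra.
rewrite /sphere_param /sphere_coord scalerA mulfV// scale1r h2 h3.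
rewrite -[RHS]hsubmxK /sphere_map h4; congr row_mx.
  by apply/rowP => i; rewrite !mxE unsqueezeK.
by rewrite [RHS]rV1P mxE.
Qed.

Let pwls_norm n : pwls (fun y : 'rV[R]_n => `|y|).
Proof.
have E (y : 'rV[R]_n) : `|y| = \big[Num.max/0]_(i < n) Num.max (y 0 i) (- y 0 i).
  have H i : Num.max (y 0 i) (- y 0 i) = `|y 0 i|.
    by have [h|h] := leP 0 (y 0 i); [rewrite max_l ?ger0_norm|rewrite max_r ?ltr0_norm]; lra.
  apply/eqP; rewrite eq_le; apply/andP; split.
    apply/ler_mxnorm => [|i]; first exact: bigmax_ge_id.
    by rewrite -H; exact: le_bigmax.
  by rewrite bigmax_le// => i _; rewrite H coord_le_norm.
rewrite (funext E); elim: (index_enum _) => [|i s IH].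
  by rewrite (_ : (fun _ => _) = fun=> 0); [exact: pwls_cst|apply/funext => y; rewrite big_nil].
rewrite (_ : (fun _ => _) = fun y : 'rV[R]_n => Num.max (Num.max (y 0 i) (- y 0 i))
  (\big[Num.max/0]_(i <- s) Num.max (y 0 i) (- y 0 i))); last first.
  by apply/funext => y; rewrite big_cons.
apply: pwls_max => //; apply: pwls_max; first exact: pwls_coord.
exact/pwls_opp/pwls_coord.
Qed.

Let pwls_mulr n (k : R) (f : 'rV[R]_n -> R) : pwls f -> pwls (fun x => f x * k).
Proof. by move=> /(pwls_mull k); apply: eq_pwl => x; rewrite mulrC. Qed.

Lemma pwl_sphere_param : pwl sphere_param.
Proof.
have pn : pwls (fun y : 'rV[R]_3 => `|4 *: y|).
  have := pwls_mull 4 (@pwls_norm 3).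
  by apply: eq_pwl => y; rewrite normrZ ger0_norm.
have pt : pwls (fun y : 'rV[R]_3 => depth (4 *: y)).
  apply: pwls_max; first exact: pwls_cst.
  by apply: pwls_add => //; exact: pwls_cst.
have ptau : pwls (fun y : 'rV[R]_3 => extra (4 *: y)).
  apply: pwls_max; first exact: pwls_cst.
  by apply: pwls_add => //; exact: pwls_cst.
apply: pwl_row_mx; last first.
  by apply: pwls_add; [apply: pwls_min => //; exact: pwls_cst|exact: pwls_cst].
apply: pwl_coords => i; pose yi (y : 'rV[R]_3) : R := 4 * y 0 i.
have py : pwls yi by exact/pwls_mull/pwls_coord.
have : pwls (fun y => squeeze (depth (4 *: y) + extra (4 *: y) * a i)
   (depth (4 *: y) + extra (4 *: y) * b i) (extra (4 *: y) * z 0 i) (yi y)).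
  apply: pwls_max.
    by apply: pwls_add => //; apply/pwls_opp/pwls_add => //; exact: pwls_mulr.
  apply: pwls_min.
    by apply: pwls_add => //; apply/pwls_add => //; exact: pwls_mulr.
  by apply: pwls_add; [exact: pwls_mull|exact: pwls_mulr].
by apply: eq_pwl => y; rewrite !mxE.
Qed.

Lemma pwl_sphere_coord : pwl sphere_coord.
Proof.
have pu i : pwls (fun x => u x i).
  have pxi : pwls (fun x : 'rV[R]_(3 + 1) => x 0 (lshift 1 i)) by exact: pwls_coord.
  apply: pwls_min; apply/pwls_mull/pwls_add; try exact: pwls_cst.
    exact: pwls_opp.
  exact: pxi.
have px4 : pwls (fun x : 'rV[R]_(3 + 1) => x 0 (rshift 3 0)) by exact: pwls_coord.
have ptau : pwls coextra.
  apply: pwls_min; first by apply/pwls_mull/pwls_add => //; exact: pwls_cst.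
  apply: pwls_min; first exact: pu.
  by apply: pwls_min; exact: pu.
have pt : pwls codepth.
  by do 2! apply: pwls_add => //; exact: pwls_cst.
apply: pwl_coords => i.
have pxi : pwls (fun x : 'rV[R]_(3 + 1) => x 0 (lshift 1 i)) by exact: pwls_coord.
have : pwls (fun x => 4^-1 * unsqueeze (codepth x + coextra x * a i)
   (codepth x + coextra x * b i) (coextra x * z 0 i) (x 0 (lshift 1 i))).
  apply/pwls_mull/pwls_min.
    by do 2! apply: pwls_add => //; exact: pwls_mulr.
  apply: pwls_max.
    by apply: pwls_add => //; apply/pwls_opp/pwls_add => //; exact: pwls_mulr.
  by apply/pwls_mulr/pwls_add => //; apply/pwls_opp/pwls_mulr.
by apply: eq_pwl => x; rewrite !mxE.
Qed.

End sphere_chart.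

(** * A point of the top face missed by a link *)

Lemma segment_one_side (R : realType) (V : normedModType R) (f : V -> R)
    (U : set V) (a b : V) (c : R) :
  {within U, continuous f} ->
  (forall s : R, 0 <= s <= 1 -> U (a + s *: (b - a)) /\ f (a + s *: (b - a)) <> c) ->
  f a < c -> f b < c.
Proof.
move=> cf H fa; rewrite ltNge; apply/negP => fb.
pose p (s : R) := a + s *: (b - a).
have cp : {within `[0, 1]%classic, continuous (f \o p)}.
  apply: (@within_comp _ _ _ _ _ U _ f) => //.
    apply: continuous_subspaceT => s.
    have h1 : {for s, continuous (fun t : R => t *: (b - a))}.
      by apply: continuousZr_tmp; exact: cvg_id.
    have h2 : {for s, continuous (fun _ : R => a)} by exact: cst_continuous.
    exact: continuousD h2 h1.
  by move=> _ [s /= + <-]; rewrite in_itv/= => /H[].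
have [|s] := IVT ler01 cp (v := c).
  rewrite /= /p scale0r addr0 scale1r addrC subrK ge_min le_max.
  by rewrite (ltW fa) fb orbT.
by rewrite in_itv/= => /H[].
Qed.

(** The first coordinate only takes the integer values that number the copies, and [c] is chosen off
    these. Any other coordinate attains a value strictly between -1 and 1 once on each of the two
    sides of a square along which it varies. *)
Lemma circle_level_finite (R : realType) (m : nat) (i : 'I_(1 + 2)) (lo hi : R) :
  lo < hi ->
  (exists2 x : 'rV[R]_(1 + 2), copies m (@unit_sphere R 2) x & x 0 i = lo) ->
  (exists2 x : 'rV[R]_(1 + 2), copies m (@unit_sphere R 2) x & x 0 i = hi) ->
  exists (c : R) (X : seq 'rV[R]_(1 + 2)), lo < c < hi /\
    forall x, copies m (@unit_sphere R 2) x -> x 0 i = c -> x \in X.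
Proof.
move=> lohi [x xD xlo] [x' x'D xhi].
rewrite -(splitK i); rewrite -(splitK i) in xlo xhi.
case: (fintype.split i) xlo xhi => k /= xlo xhi.
  have hl : 0 < hi - lo by rewrite subr_gt0.
  have [d /andP[d0 d1] dN] := real_notin [seq j%:R - lo | j : 'I_m <- enum 'I_m] hl.
  by exists (lo + d), [::]; split; [lra|move=> _ [j _ [y _ <-]]];
    rewrite row_mxEl ord1 mxE eqxx mulr1n => e; case/negP: dN; apply/mapP;
    exists j; rewrite ?mem_enum// e addrC addKr.
have bound y : copies m (@unit_sphere R 2) y -> -1 <= y 0 (rshift 1 k) <= 1.
  move=> [j _ [w w1 <-]]; rewrite row_mxEr -ler_norml.
  by have := coord_le_norm w k; rewrite (w1 : `|w| = 1).
have := bound x xD; have := bound x' x'D; rewrite xlo xhi => hi1 lo1.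
pose c := (lo + hi) / 2; exists c.
exists [seq row_mx (t.1%:R%:M : 'rV[R]_1) (plane_pt (other k) (sg R t.2) c) |
  t : 'I_m * bool <- enum {: 'I_m * bool}]; split; first by rewrite /c; lra.
move=> _ [j _ [w /unit_sphereP[p [e [b [b1 ->]]]] <-]]; rewrite row_mxEr => wc.
apply/mapP; exists (j, e); rewrite ?mem_enum//=; congr row_mx.
have [pk|pk] := ord2P p k; move: wc; rewrite pk.
  by rewrite plane_ptl /c /sg => ce; exfalso; move: ce; case: (e); lra.
rewrite plane_ptr => ->.
suff -> : other (other p) = p by [].
by case: (ord2P (other p) p) => // e2; have := other_neq p; rewrite -e2 eqxx.
Qed.

(* Otherwise the inverse of [L] maps an open cube injectively into the circles.
   There a coordinate takes some intermediate value at finitely many points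
   only, but finitely many points do not separate the cube. *)
Lemma embedded_circles_miss (R : realType) (m : nat)
    (L : 'rV[R]_(1 + 2) -> 'rV[R]_(3 + 1)) :
  embedding (copies m (@unit_sphere R 2)) setT L ->
  exists2 z : 'rV[R]_3, `|z| < 1 & ~ (L @` copies m (@unit_sphere R 2)) (row_mx z 1%:M).
Proof.
set D := copies m _ => -[_ cL [g gL cg]]; apply: contrapT => noz.
have onto z : `|z| < 1 -> (L @` D) (row_mx z 1%:M).
  by move=> z1; apply: contrapT => nz; apply: noz; exists z.
pose psi (z : 'rV[R]_3) := g (row_mx z (1%:M : 'rV[R]_1)).
have psiD z : `|z| < 1 -> D (psi z) /\ L (psi z) = row_mx z 1%:M.
  by move=> /onto[x Dx xz]; rewrite /psi -xz gL.
pose U := [set z : 'rV[R]_3 | `|z| < 1].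
have cpsi : {within U, continuous psi}.
  apply: (@within_comp _ _ _ _ _ (L @` D)) cg; last first.
    by move=> _ [z z1 <-]; exact: onto.
  apply: continuous_subspaceT.
  have -> : (fun z : 'rV[R]_3 => row_mx z (1%:M : 'rV[R]_1)) =
      fun z => z *m row_mx 1%:M 0 + row_mx 0 1%:M.
    apply/funext => z; rewrite mul_mx_row mulmx1 mulmx0 add_row_mx addr0.
    by rewrite add0r.
  exact: continuous_mulmx_row.
pose a : 'rV[R]_3 := 0; pose b : 'rV[R]_3 := const_mx (1 / 2).
have a1 : `|a| < 1 by rewrite normr0.
have b1 : `|b| < 1.
  by apply/ltr_mxnorm => // i; rewrite mxE ger0_norm; lra.
have [Da La] := psiD a a1; have [Db Lb] := psiD b b1.
have ab : psi a != psi b.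
  apply/eqP => e; have : a = b by move: La; rewrite e Lb => /eq_row_mx[].
  by move=> /rowP/(_ 0); rewrite !mxE; lra.
have [i psii] : exists i, psi a 0 i != psi b 0 i.
  apply/existsP; apply: contraNT ab => /existsPn H; apply/eqP/rowP => i.
  by have := H i; rewrite negbK => /eqP.
have main u v : `|u| < 1 -> `|v| < 1 -> psi u 0 i < psi v 0 i -> False.
  move=> u1 v1 uv; have [Du _] := psiD u u1; have [Dv _] := psiD v v1.
  have [||c [X [/andP[uc cv] HX]]] := @circle_level_finite R m i _ _ uv.
  - by exists (psi u).
  - by exists (psi v).
  pose N := [seq lsubmx (L x : 'rV[R]_(3 + 1)) | x <- X].
  have HN z : `|z| < 1 -> psi z 0 i = c -> z \in N.
    move=> z1 zc; have [Dz Lz] := psiD z z1.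
    by apply/mapP; exists (psi z); [exact: HX|rewrite Lz row_mxKl].
  (* The path from [u] to [v] is bent at a point [w] in general position to the points of [N]
     themselves, whence [id]. *)
  have [w [_ w1 gen _]] := exists_generic_position (u :: v :: N) id id (ltW u1) (@ltr01 R).
  have cf : {within U, continuous (fun z => psi z 0 i)}.
    apply: (@within_comp _ _ _ _ _ setT _ (fun x : 'rV[R]_(1 + 2) => x 0 i) cpsi) => //.
    by apply: continuous_subspaceT; exact: coord_continuous.
  have seg x y s : `|x| < 1 -> `|y| < 1 -> 0 <= s <= 1 -> U (x + s *: (y - x)).
    move=> x1 y1 s01; have -> : x + s *: (y - x) = (1 - s) *: x + s *: y + 0 *: x - 0.
      by apply/rowP => k; rewrite !mxE; ring.
    by apply: convex_combination_lt; rewrite ?subr0//; lra.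
  (* A point of [N] on the segment from [x] to [w], other than [x], would span with [x] a line
     through [w], against general position. *)
  have off x : x \in (u :: v :: N) -> `|x| < 1 -> psi x 0 i <> c ->
      forall s, 0 <= s <= 1 -> psi (x + s *: (w - x)) 0 i <> c.
    move=> xN x1 xc s s01 sc.
    have nN := HN _ (seg x w s x1 w1 s01) sc.
    have nN' : x + s *: (w - x) \in (u :: v :: N) by rewrite !inE nN !orbT.
    have [l [l1 _ /eqP l3]] := gen x (x + s *: (w - x)) x x xN nN' xN xN.
    have s0 : s = 0.
      have := congr1 (fun M : 'M[R]_(1, 1) => M 0 0) l1.
      rewrite addrAC subrr add0r -scalemxAl [LHS]mxE [RHS]mxE => /eqP.
      by rewrite mulf_eq0 => /orP[/eqP//|/eqP].
    by apply: xc; move: sc; rewrite s0 scale0r addr0.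
  have uN : u \in (u :: v :: N) by rewrite mem_head.
  have vN : v \in (u :: v :: N) by rewrite !inE eqxx orbT.
  have wc : psi w 0 i < c.
    apply: (segment_one_side cf _ uc) => s s01; split; first exact: seg.
    by apply: off => //; move=> e; move: uc; rewrite e ltxx.
  have : psi v 0 i < c.
    apply: (segment_one_side cf _ wc) => s s01; split; first exact: seg.
    have -> : w + s *: (v - w) = v + (1 - s) *: (w - v).
      by apply/rowP => k; rewrite !mxE; ring.
    apply: off => //; last by lra.
    by move=> e; move: cv; rewrite e ltxx.
  lra.
by move: psii; rewrite neq_lt => /orP[]; exact: main.
Qed.

(** The compact image keeps a distance [r] from the missed point [(z, 1)]. With [d] at most [r / 2],
    no point within [d] of the image is in the cap; the other bound on [d] keeps the cap inside the
    top face. *)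
Lemma links_sphere_chart (R : realType) (m : nat)
    (L : 'rV[R]_(1 + 2) -> 'rV[R]_4) : top_link (links R m) L ->
  exists (h : 'rV[R]_3 -> 'rV[R]_4) (g : 'rV[R]_4 -> 'rV[R]_3) (e : R),
  [/\ pwl h, pwl g,
    forall z, @unit_ball R 3 z -> @unit_sphere R 4 (h z) /\ g (h z) = z, 0 < e &
    forall x y, copies m (@unit_sphere R 2) x -> @unit_sphere R 4 y ->
      `|L x - y| < e -> @unit_ball R 3 (g y) /\ h (g y) = y].
Proof.
move=> [embL _]; set D := copies m _.
have cD : compact D by rewrite /D -circle_body; exact/compact_body/circle_complex.
have embT : embedding D setT (L : 'rV[R]_(1 + 2) -> 'rV[R]_(3 + 1)).
  by have [_ cL gL] := embL.
have [z z1 nz] := embedded_circles_miss embT.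
have [_ cL _] := embL.
have clL : closed (L @` D).
  by apply: compact_closed; [exact: norm_hausdorff|exact: continuous_compact].
have [r r0 Hr] : exists2 r : R, 0 < r & forall x, D x ->
    r <= `|(row_mx z 1%:M : 'rV[R]_(3 + 1)) - L x|.
  have : nbhs (row_mx z 1%:M : 'rV[R]_(3 + 1)) (~` (L @` D)).
    by apply: open_nbhs_nbhs; split=> //; exact: closed_openC.
  move=> /nbhs_normP[r /= r0 Hr]; exists r => // x Dx; rewrite leNgt; apply/negP => lt.
  by apply: (Hr (L x) lt); exists x.
pose d := Num.min (r / 2) ((1 - `|z|) / 2).
have d0 : 0 < d by rewrite lt_min; apply/andP; split; lra.
have dr : d <= r / 2 by rewrite ge_min lexx.
have d1 : d <= (1 - `|z|) / 2 by rewrite ge_min lexx orbT.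
have zd i : `|z 0 i| + d < 1.
  have := coord_le_norm z i; have := normr_ge0 z; lra.
exists (sphere_param z d), (sphere_coord z d), d; split=> //.
- exact: pwl_sphere_param.
- exact: pwl_sphere_coord.
- by move=> w; exact: (sphere_paramK d0 zd).
move=> x y Dx y1 xy; apply: (sphere_coordK d0 zd) => // -[y4 yz].
have := Hr x Dx; apply/negP; rewrite -ltNge.
have : `|(row_mx z 1%:M : 'rV[R]_(3 + 1)) - (y : 'rV[R]_(3 + 1))| < d.
  rewrite -[y in X in X < _](@hsubmxK _ 1 3 1) opp_row_mx add_row_mx.
  apply/norm_row_mx_lt => //; split.
    by apply/ltr_mxnorm => // i; rewrite !mxE distrC.
  rewrite (rV1P (rsubmx _)) -raddfB/= norm_scalar_mx1 mxE y4 subrr normr0//.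
move=> zy; have := ler_distD y (row_mx z 1%:M : 'rV[R]_(3 + 1)) (L x).
by rewrite (distrC y (L x)); lra.
Qed.

Lemma compact_cylinder (R : realType) (n : nat) (E : seq ('rV[R]_n * 'rV[R]_n)) :
  complex E -> compact (cylinder (body E)).
Proof.
move=> /(pl_slide (fun=> 0 : 'rV[R]_0) (fun=> 0) (fun=> 0) 0); exact: pl_compact.
Qed.

Lemma compact_norm_lt (R : realType) (n q : nat) (D : set 'rV[R]_n)
    (f : 'rV[R]_n -> 'rV[R]_q) : compact D -> {within D, continuous f} ->
  exists2 N : R, 0 < N & forall x, D x -> `|f x| < N.
Proof.
move=> cD cf; have : bounded_set (f @` D).
  exact/compact_bounded/continuous_compact.
move=> [M [_ HM]]; exists (Num.max 0 M + 2).
  by rewrite ltr_wpDl// le_max lexx.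
move=> x Dx; have M1 : M < Num.max 0 M + 1.
  by rewrite ltr_pwDr// le_max lexx orbT.
by have := HM _ M1 (f x) (ex_intro2 _ _ x Dx erefl); rewrite /=; lra.
Qed.

(** As [L] is bounded by [N], the factor R^2 is scaled by [N + 1], which leaves room for maps at
    distance less than 1; on the first factor [[-1, 1]] goes to [[0, 1]]. Both maps are affine and
    inverse to each other on the whole space. *)
Lemma string_links_chart (R : realType) (m : nat) (p : 'I_m -> 'rV[R]_2)
    (L : 'rV[R]_(1 + 1) -> 'rV[R]_(1 + 2)) : top_link (string_links p) L ->
  exists (h g : 'rV[R]_(1 + 2) -> 'rV[R]_(1 + 2)),
  [/\ pwl h, pwl g,
    forall z, @unit_ball R 3 z -> target (string_links p) (h z) /\ g (h z) = z &
    forall x y, source (string_links p) x -> target (string_links p) y ->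
      `|L x - y| < 1 -> @unit_ball R 3 (g y) /\ h (g y) = y].
Proof.
move=> [[_ cL _] _].
have cD : compact (source (string_links p)).
  by rewrite /= -interval_body; exact/compact_body/interval_complex.
have [N N0 HN] := compact_norm_lt cD cL.
pose h (z : 'rV[R]_(1 + 2)) : 'rV[R]_(1 + 2) :=
  row_mx (2^-1 *: (lsubmx z + const_mx 1)) ((N + 1) *: rsubmx z).
pose g (y : 'rV[R]_(1 + 2)) : 'rV[R]_(1 + 2) :=
  row_mx (2 *: lsubmx y - const_mx 1) ((N + 1)^-1 *: rsubmx y).
have N1 : N + 1 != 0 by rewrite gt_eqF// addr_gt0.
have gK z : g (h z) = z.
  rewrite /g /h !row_mxKl !row_mxKr !scalerA mulVf// mulfV// !scale1r addrK.
  exact: hsubmxK.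
have hK y : h (g y) = y.
  rewrite /g /h !row_mxKl !row_mxKr subrK !scalerA mulVf// mulfV// !scale1r.
  exact: hsubmxK.
exists h, g; split.
- have := pwl_affine (block_mx ((2^-1 : R)%:M : 'M[R]_1) 0 0 ((N + 1)%:M : 'M[R]_2))
    (row_mx (const_mx 2^-1 : 'rV[R]_1) 0).
  apply: eq_pwl => z; rewrite -[z in LHS](@hsubmxK _ 1 1 2) mul_row_block add_row_mx.
  rewrite /h !mulmx0 !mul_mx_scalar !addr0 add0r scalerDr; congr (row_mx (_ + _) _).
  by apply/rowP => i; rewrite !mxE mulr1.
- have := pwl_affine (block_mx ((2 : R)%:M : 'M[R]_1) 0 0 ((N + 1)^-1%:M : 'M[R]_2))
    (row_mx (- const_mx 1 : 'rV[R]_1) 0).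
  apply: eq_pwl => z; rewrite -[z in LHS](@hsubmxK _ 1 1 2) mul_row_block add_row_mx.
  by rewrite /g !mulmx0 !mul_mx_scalar !addr0 add0r.
- move=> z z1; split=> //=; rewrite /unit_interval/= row_mxKl !mxE.
  have := le_trans (coord_le_norm z (lshift 2 (0 : 'I_1) : 'I_(1 + 2))) z1; rewrite ler_norml; lra.
move=> x y Dx y01 xy; split=> //; apply/(@norm_row_mx_le R 1 2) => //; split.
  apply/ler_mxnorm => // i; rewrite !mxE ord1 ler_norml.
  by move: y01; rewrite /= /unit_interval/= mxE; lra.
apply/ler_mxnorm => // i; rewrite !mxE normrM gtr0_norm ?invr_gt0 ?addr_gt0//.
rewrite ler_pdivrMl ?addr_gt0// mulr1; apply: le_trans (coord_le_norm y _) _.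
have -> : y = L x - (L x - y) by rewrite opprB addrC subrK.
by apply: le_trans (ler_normB _ _) _; have := HN x Dx; lra.
Qed.

Lemma links_locally_quasi_constant (R : realType) (m k : nat)
    (L : 'rV[R]_(1 + 2) -> 'rV[R]_4) : top_link (links R m) L ->
  locally_quasi_constant (links R m) k L.
Proof.
move=> topL; have [h [g [e [pwlh pwlg hK e0 near]]]] := links_sphere_chart topL.
by apply: (@chart_locally_quasi_constant _ _ _ (links R m) _ _ h g L e
  (circle_complex R m) (circle_body R m) (@circle_locally_arc R m)).
Qed.

Lemma string_links_locally_quasi_constant (R : realType) (m k : nat)
    (p : 'I_m -> 'rV[R]_2) (L : 'rV[R]_(1 + 1) -> 'rV[R]_(1 + 2)) :
  top_link (string_links p) L -> locally_quasi_constant (string_links p) k L.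
Proof.
move=> topL; have [h [g [pwlh pwlg hK near]]] := string_links_chart topL.
apply: (@chart_locally_quasi_constant _ _ _ (string_links p) _ _ h g L 1
  (interval_complex R m) (interval_body R m) (@interval_locally_arc R m)) => //.
by move=> _ [j [i ->]]; exact: interval_verts.
Qed.

Theorem corollary1p4 (R : realType) (m : nat) :
  (* (a) *)
  ((forall (k : nat) (L : 'rV[R]_(1 + 2) -> 'rV[R]_4),
      top_link (links R m) L ->
      exists2 e : R, 0 < e &
        forall L0 L1 : 'rV[R]_(1 + 2) -> 'rV[R]_4,
          pl_link (links R m) L0 -> pl_link (links R m) L1 ->
          c0_close (links R m) e L L0 -> c0_close (links R m) e L L1 ->
          strongly_quasi_isotopic (links R m) k L0 L1) /\
   (forall (p : 'I_m -> 'rV[R]_2), injective p ->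
      forall (k : nat) (L : 'rV[R]_(1 + 1) -> 'rV[R]_(1 + 2)),
      top_link (string_links p) L ->
      exists2 e : R, 0 < e &
        forall L0 L1 : 'rV[R]_(1 + 1) -> 'rV[R]_(1 + 2),
          pl_link (string_links p) L0 -> pl_link (string_links p) L1 ->
          c0_close (string_links p) e L L0 -> c0_close (string_links p) e L L1 ->
          strongly_quasi_isotopic (string_links p) k L0 L1)) /\
  (* (b) *)
  ((forall L0 L1 : 'rV[R]_(1 + 2) -> 'rV[R]_4,
      pl_link (links R m) L0 -> pl_link (links R m) L1 ->
      top_isotopic (links R m) L0 L1 ->
      forall k : nat, strongly_quasi_isotopic (links R m) k L0 L1) /\
   (forall (p : 'I_m -> 'rV[R]_2), injective p ->
      forall L0 L1 : 'rV[R]_(1 + 1) -> 'rV[R]_(1 + 2),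
      pl_link (string_links p) L0 -> pl_link (string_links p) L1 ->
      top_isotopic (string_links p) L0 L1 ->
      forall k : nat, strongly_quasi_isotopic (string_links p) k L0 L1)).
Proof.
split; split.
- by move=> k L /(links_locally_quasi_constant k)[e e0 [H _]]; exists e.
- by move=> p _ k L /(string_links_locally_quasi_constant k)[e e0 [H _]]; exists e.
- move=> L0 L1 l0 l1 iso k; apply: isotopic_quasi_isotopic l0 l1 iso.
  + by rewrite /= -circle_body; exact/compact_body/circle_complex.
  + by rewrite /= -circle_body; exact/compact_cylinder/circle_complex.
  + by move=> L; exact: links_locally_quasi_constant.
- move=> p _ L0 L1 l0 l1 iso k; apply: isotopic_quasi_isotopic l0 l1 iso.
  + by rewrite /= -interval_body; exact/compact_body/interval_complex.
  + by rewrite /= -interval_body; exact/compact_cylinder/interval_complex.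
  + by move=> L; exact: string_links_locally_quasi_constant.
Qed.
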